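(* Let $N\ge 1$ and, for $t\in(0,\frac N2)$, let $\mathcal P_{\ln}(t,\cdot)$ be the logarithmic diffusion kernel $$\mathcal P_{\ln}(t,x)=(2\pi)^{-N}\int_{\mathbb R^N}|\xi|^{-2t}e^{ix\cdot\xi}\,d\xi$$ (inverse Fourier transform of $|\xi|^{-2t}$ in the sense of tempered distributions). Then $$\mathcal P_{\ln}(t,x)=\mathcal P_0(t)\,|x|^{2t-N}\quad\text{for }(t,x)\in(0,\tfrac N2)\times(\mathbb R^N\setminus\{0\}),\qquad \mathcal P_0(t)=\pi^{-\frac N2}4^{-t}\frac{\Gamma(\frac{N-2t}{2})}{\Gamma(t)}.$$ Furthermore: (i) for every $t\in(0,\frac N2)$, $\mathcal P_{\ln}(t,\cdot)\notin L^1(\mathbb R^N)$, but $\mathcal P_{\ln}(t,\cdot)\in L^{\frac{N}{N-2t},\infty}(\mathbb R^N)$; (ii) $\mathcal P_{\ln}(t,\cdot)$ blows up uniformly in any compact set of $\mathbb R^N$ as $t\to(\frac N2)^-$; more precisely, for every $x\neq0$, $$\lim_{t\to(\frac N2)^-}(N-2t)\,\mathcal P_{\ln}(t,x)=\frac{2}{(4\pi)^{\frac N2}\,\Gamma(\frac N2)};$$ (iii) for every $x\ne0$, $\lim_{t\to0^+}\mathcal P_{\ln}(t,x)=0$, and $\lim_{t\to0^+}\mathcal P_{\ln}(t,\cdot)=\delta_0$ in the sense that $$\lim_{t\to0^+}\int_{\mathbb R^N}\mathcal P_{\ln}(t,x)\varphi(x)\,dx=\varphi(0)\quad\text{for all }\varphi\in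 C_c(\mathbb R^N).$$
   Context: $L^{p,\infty}(\mathbb R^N)$ denotes the Marcinkiewicz (weak $L^p$) space with exponent $p$. $C_c(\mathbb R^N)$ is the space of continuous functions with compact support. $\Gamma$ is the Gamma function. *)

(* Defs.v *)
From HB Require Import structures.
From mathcomp Require Import all_boot all_order all_algebra.
From mathcomp Require Import complex.
From mathcomp Require Import all_classical all_reals all_analysis.
Set Implicit Arguments.
Unset Strict Implicit.
Unset Printing Implicit Defensive.
Import Order.TTheory GRing.Theory Num.Theory.
Import numFieldNormedType.Exports.
Local Open Scope classical_set_scope.
Local Open Scope ring_scope.
Local Open Scope complex_scope.

(** Points of [R^n] are row vectors. As for [n.-tuple T] in MathComp-Analysis,
    the sigma-algebra is the one generated by the coordinates, that is the
    Borel sigma-algebra. *)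

Definition rV_display : measure_display -> measure_display.
Proof. exact. Qed.

Section measurable_rV.
Context (R : realType) (n : nat).

Let coord (i : 'I_n) (v : 'rV[R]_n) : R := v ord0 i.

Let rV_set0 : g_sigma_preimage coord set0.
Proof. exact: sigma_algebra0. Qed.

Let rV_setC A : g_sigma_preimage coord A -> g_sigma_preimage coord (~` A).
Proof. exact: sigma_algebraC. Qed.

Let rV_bigcup (F : _^nat) : (forall i, g_sigma_preimage coord (F i)) ->
  g_sigma_preimage coord (\bigcup_i (F i)).
Proof. exact: sigma_algebra_bigcup. Qed.

HB.instance Definition _ :=
  @isMeasurable.Build (rV_display default_measure_display) 'rV[R]_n
    (g_sigma_preimage coord) rV_set0 rV_setC rV_bigcup.

End measurable_rV.

Section measurable_rV_lemmas.
Context (R : realType).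

Lemma measurable_coord n (i : 'I_n) :
  measurable_fun [set: 'rV[R]_n] (fun v => v ord0 i).
Proof.
move=> _ Y mY; rewrite setTI; apply: sub_sigma_algebra => /=.
rewrite -bigcup_seq/=; exists i => /=; first by rewrite mem_index_enum.
by exists Y => //; rewrite setTI.
Qed.

Lemma measurable_fun_rVP d (T : measurableType d) n (f : T -> 'rV[R]_n) :
  (forall i, measurable_fun setT (fun x => f x ord0 i)) ->
  measurable_fun setT f.
Proof.
move=> mf.
have sub : g_sigma_preimage (fun (i : 'I_n) x => f x ord0 i) `<=` measurable.
  apply: smallest_sub; first exact: sigma_algebra_measurable.
  case: n => [|n] in f mf *; first by rewrite big_ord0.
  rewrite -bigcup_mkord_ord; apply: bigcup_sub => i Ii.
  by move=> A [B mB <-]; exact: mf.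
move=> _ A mA; apply: sub.
by rewrite (g_sigma_preimage_comp (fun i (v : 'rV[R]_n) => v ord0 i) f); exists A.
Qed.

Definition cons_rV n (p : R * 'rV[R]_n) : 'rV[R]_n.+1 :=
  row_mx (p.1)%:M p.2.

Lemma cons_rV0 n (p : R * 'rV[R]_n) : cons_rV p ord0 ord0 = p.1.
Proof.
have -> : (ord0 : 'I_(1 + n)) = lshift n (ord0 : 'I_1) by exact: val_inj.
by apply: etrans (row_mxEl _ _ _ _) _; rewrite mxE eqxx.
Qed.

Lemma cons_rVS n (p : R * 'rV[R]_n) (i : 'I_n) :
  cons_rV p ord0 (lift ord0 i) = p.2 ord0 i.
Proof.
have -> : (lift ord0 i : 'I_(1 + n)) = rshift 1 i by exact: val_inj.
exact: row_mxEr.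
Qed.

Lemma measurable_cons_rV n :
  measurable_fun [set: R * 'rV[R]_n] (@cons_rV n).
Proof.
apply: measurable_fun_rVP => i; case: (unliftP ord0 i) => [j|] ->.
  rewrite (_ : (fun x => _) = (fun v : 'rV[R]_n => v ord0 j) \o snd).
    exact: measurableT_comp (@measurable_coord n j) measurable_snd.
  by apply/funext => p /=; rewrite cons_rVS.
rewrite (_ : (fun x => _) = fst); first exact: measurable_fst.
by apply/funext => p /=; rewrite cons_rV0.
Qed.

Definition uncons_rV n (v : 'rV[R]_n.+1) : R * 'rV[R]_n :=
  (v ord0 ord0, \row_i v ord0 (lift ord0 i)).

Lemma cons_rVK n : cancel (@cons_rV n) (@uncons_rV n).
Proof.
move=> p; rewrite /uncons_rV cons_rV0 [RHS]surjective_pairing; congr pair.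
by apply/rowP => i; rewrite mxE cons_rVS.
Qed.

Lemma measurable_uncons_rV n :
  measurable_fun [set: 'rV[R]_n.+1] (@uncons_rV n).
Proof.
apply/measurable_fun_pairP; split; first exact: measurable_coord.
apply: measurable_fun_rVP => i.
rewrite (_ : (fun x => _) = (fun v : 'rV[R]_n.+1 => v ord0 (lift ord0 i))).
  exact: measurable_coord.
by apply/funext => v /=; rewrite mxE.
Qed.

End measurable_rV_lemmas.

(** [lebesgue_rV 0] is the unit mass on the one-point space, and
    [lebesgue_rV n.+1] is the product of the one-dimensional Lebesgue measure
    and [lebesgue_rV n], transported by [(a, v) |-> (a, v_0, ..., v_(n-1))]. *)
Fixpoint lebesgue_rV (R : realType) (n : nat) : set 'rV[R]_n -> \bar R :=
  match n with
  | 0 => dirac (0 : 'rV[R]_0)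
  | m.+1 => pushforward (lebesgue_measure \x @lebesgue_rV R m)%E (@cons_rV R m)
  end.
Arguments lebesgue_rV {R n}.

Section pushforward_cons_rV.
Context (R : realType) (n : nat).
Variable mu : {sigma_finite_measure set 'rV[R]_n -> \bar R}.
Local Open Scope ereal_scope.

Let nu := pushforward (lebesgue_measure \x mu) (@cons_rV R n).

Let measurable_preimage A : measurable A -> measurable (@cons_rV R n @^-1` A).
Proof. by move=> mA; rewrite -[X in measurable X]setTI; exact: measurable_cons_rV. Qed.

Let nu0 : nu set0 = 0.
Proof. by rewrite /nu /pushforward preimage_set0 measure0. Qed.

Let nu_ge0 A : 0 <= nu A.
Proof. exact: (measure_ge0 (lebesgue_measure \x mu)). Qed.

Let nu_sigma_additive : semi_sigma_additive nu.
Proof.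
move=> F mF tF mUF; rewrite /nu /pushforward preimage_bigcup.
apply: measure_semi_sigma_additive.
- by move=> k; exact: measurable_preimage.
- apply/trivIsetP => /= i j _ _ ij; rewrite -preimage_setI.
  by move/trivIsetP : tF => /(_ _ _ _ _ ij) ->//; rewrite preimage_set0.
- by rewrite -preimage_bigcup; exact: measurable_preimage.
Qed.

HB.instance Definition _ := isMeasure.Build _ _ _
  nu nu0 nu_ge0 nu_sigma_additive.

Let nu_sigma_finite : sigma_finite setT nu.
Proof.
have /sigma_finiteP[F [FT ndF Foo]] := sigma_finiteT (@lebesgue_measure R).
have /sigma_finiteP[G [GT ndG Goo]] := sigma_finiteT mu.
exists (fun k => @uncons_rV R n @^-1` (F k `*` G k)).
  apply/seteqP; split => // v _.
  have : [set: measurableTypeR R] (uncons_rV v).1 by [].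
  rewrite FT => -[i _ Fi].
  have : [set: 'rV[R]_n] (uncons_rV v).2 by [].
  rewrite GT => -[j _ Gj].
  exists (maxn i j) => //; split.
  - by move: Fi; exact/subsetPset/ndF/leq_maxl.
  - by move: Gj; exact/subsetPset/ndG/leq_maxr.
move=> k; have [mF Fk] := Foo k; have [mG Gk] := Goo k; split.
  rewrite -[X in measurable X]setTI; apply: measurable_uncons_rV => //.
  exact: measurableX.
rewrite /nu /pushforward -comp_preimage (_ : _ \o _ = id).
  by rewrite preimage_id product_measure1E// lte_mul_pinfty// ge0_fin_numE.
by apply/funext => p /=; rewrite cons_rVK.
Qed.

HB.instance Definition _ := Measure_isSigmaFinite.Build _ _ _
  nu nu_sigma_finite.

Lemma pushforward_cons_rV_sigma_finite_measure :
  exists m : {sigma_finite_measure set 'rV[R]_n.+1 -> \bar R},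
    pushforward (lebesgue_measure \x mu) (@cons_rV R n) =
    m :> (set 'rV[R]_n.+1 -> \bar R).
Proof. by exists nu. Qed.

End pushforward_cons_rV.

Section lebesgue_rV_measure.
Context (R : realType) (n : nat).
Local Open Scope ereal_scope.

Lemma lebesgue_rV_sigma_finite_measure :
  exists m : {sigma_finite_measure set 'rV[R]_n -> \bar R},
    lebesgue_rV = m :> (set 'rV[R]_n -> \bar R).
Proof.
elim: n => [|k [m mE]]; first by exists (dirac (0%R : 'rV[R]_0)).
have [m' m'E] := pushforward_cons_rV_sigma_finite_measure m.
by exists m'; rewrite /= mE.
Qed.

Let lebesgue_rV0 : @lebesgue_rV R n set0 = 0.
Proof. by have [m ->] := lebesgue_rV_sigma_finite_measure. Qed.

Let lebesgue_rV_ge0 A : 0 <= @lebesgue_rV R n A.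
Proof. by have [m ->] := lebesgue_rV_sigma_finite_measure. Qed.

Let lebesgue_rV_sigma_additive : semi_sigma_additive (@lebesgue_rV R n).
Proof.
have [m ->] := lebesgue_rV_sigma_finite_measure.
exact: measure_semi_sigma_additive.
Qed.

HB.instance Definition _ := isMeasure.Build _ _ _
  (@lebesgue_rV R n) lebesgue_rV0 lebesgue_rV_ge0 lebesgue_rV_sigma_additive.

Let lebesgue_rV_sigma_finite : sigma_finite setT (@lebesgue_rV R n).
Proof.
have [m ->] := lebesgue_rV_sigma_finite_measure; exact: sigma_finiteT.
Qed.

HB.instance Definition _ := Measure_isSigmaFinite.Build _ _ _
  (@lebesgue_rV R n) lebesgue_rV_sigma_finite.

End lebesgue_rV_measure.

Lemma lebesgue_rV_box (R : realType) (n : nat) (A : 'I_n -> set R) :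
  (forall i, measurable (A i)) ->
  lebesgue_rV [set v : 'rV[R]_n | forall i, A i (v ord0 i)] =
  (\prod_(i < n) lebesgue_measure (A i))%E.
Proof.
elim: n => [|n IH] in A * => mA.
  rewrite big_ord0 /= diracE mem_set// => -[] //.
rewrite big_ord_recl /=.
rewrite -(IH (fun i => A (lift ord0 i))); last by move=> i; exact: mA.
have mB : measurable [set v : 'rV[R]_n | forall i, A (lift ord0 i) (v ord0 i)].
  rewrite (_ : mkset _ =
      \bigcap_(i in [set: 'I_n]) (fun v : 'rV[R]_n => v ord0 i) @^-1` A (lift ord0 i)).
    apply: fin_bigcap_measurable; first exact: finite_finset.
    by move=> i _; rewrite -[X in measurable X]setTI; exact: measurable_coord.
  by apply/seteqP; split => v /= h i; [move=> _|]; exact: h.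
have mA0 : @measurable _ (measurableTypeR R) (A ord0) by exact: mA.
rewrite -product_measure1E//.
rewrite /pushforward; congr (product_measure1 _ _ _).
apply/seteqP; split => -[a v] /=.
  move=> h; split; first by have := h ord0; rewrite cons_rV0.
  by move=> i; have := h (lift ord0 i); rewrite cons_rVS.
move=> [h0 h] i; case: (unliftP ord0 i) => [j|] ->.
  by rewrite cons_rVS; exact: h.
by rewrite cons_rV0.
Qed.

Section kernel.
Context (R : realType) (N : nat).
Local Notation V := 'rV[R]_N.
Local Notation leb := (@lebesgue_rV R N).

(** The norm [`|x|] carried by ['rV[R]_N] in the library is the sup norm. *)
Definition enorm (x : V) : R := Num.sqrt (\sum_i x ord0 i ^+ 2).

Definition dot (x y : V) : R := \sum_i x ord0 i * y ord0 i.

Definition integrableC (f : V -> R[i]) : Prop :=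
  leb.-integrable setT (fun x => (complex.Re (f x))%:E) /\
  leb.-integrable setT (fun x => (complex.Im (f x))%:E).

Definition integralC (f : V -> R[i]) : R[i] :=
  (\int[leb]_x complex.Re (f x)) +i* (\int[leb]_x complex.Im (f x)).

(** Weak [L^p], for [0 < p < +oo]: the quasi-norm
    [sup_(l > 0) l * leb {|f| > l}^(1/p)] is finite. *)
Definition weakLp (p : R) (f : V -> R[i]) : Prop :=
  [/\ measurable_fun setT (fun x => complex.Re (f x)),
      measurable_fun setT (fun x => complex.Im (f x)) &
      exists C : R, forall l : R, 0 < l ->
        ((l `^ p)%:E * leb [set x | (l < Normc.normc (f x))%R] <= C%:E)%E].

Definition Cc (phi : V -> R[i]) : Prop :=
  continuous (phi : V -> R[i]^o) /\ compact (closure [set x | phi x != 0]).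

(** Iterated partial derivative along the coordinates listed in [s]. *)
Definition partials (s : seq 'I_N) (f : V -> R) : V -> R :=
  foldr (fun i g => fun x => 'D_('e_i) g x) f s.

Definition smooth (f : V -> R) : Prop :=
  forall s : seq 'I_N, continuous (partials s f) /\
    forall (x : V) (i : 'I_N), derivable (partials s f) x 'e_i.

Definition schwartzR (f : V -> R) : Prop :=
  smooth f /\ forall (s : seq 'I_N) (k : nat),
    exists C : R, forall x, enorm x ^+ k * `|partials s f x| <= C.

Definition schwartz (phi : V -> R[i]) : Prop :=
  schwartzR (fun x => complex.Re (phi x)) /\
  schwartzR (fun x => complex.Im (phi x)).

(** [(2 pi)^-N \int e^(i x . xi) phi(xi) dxi] *)
Definition inverse_fourier (phi : V -> R[i]) (x : V) : R[i] :=
  ((2 * pi) ^- N)%:C *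
  integralC (fun xi => (cos (dot x xi) +i* sin (dot x xi)) * phi xi).

(** Functions which define a tempered distribution
    [regular_distribution f] by an absolutely convergent integral. *)
Definition tempered_function (f : V -> R[i]) : Prop :=
  exists m : nat, integrableC (fun x => ((1 + enorm x) ^- m)%:C * f x).

(** Only the values of a distribution at Schwartz functions are relevant. *)
Definition distribution : Type := (V -> R[i]) -> R[i].

Definition regular_distribution (f : V -> R[i]) : distribution :=
  fun phi => integralC (fun x => f x * phi x).

Definition inverse_fourier_distribution (u : distribution) : distribution :=
  fun phi => u (inverse_fourier phi).

Definition is_inverse_fourier (f g : V -> R[i]) : Prop :=
  [/\ tempered_function f, tempered_function g &
      forall phi, schwartz phi ->
        regular_distribution g phi =
        inverse_fourier_distribution (regular_distribution f) phi].

(** [P t] is a function representing the inverse Fourier transform of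
    [|xi|^(-2t)]. A distribution determines it only almost everywhere; its
    pointwise values off the origin are those of the representative which is
    continuous there. The value at the origin is left free. The symbol
    [|xi|^(-2t)] takes the irrelevant value [powR 0 (-2t) = 0] at the origin. *)
Definition log_diffusion_kernel (P : R -> V -> R[i]) : Prop :=
  forall t : R, 0 < t < N%:R / 2 ->
    is_inverse_fourier (fun xi => (enorm xi `^ (- (2 * t)))%:C) (P t) /\
    forall x : V, x != 0 -> {for x, continuous (P t : V -> R[i]^o)}.

Definition Gamma (s : R) : R :=
  \int[lebesgue_measure]_(x in `]0, +oo[) (x `^ (s - 1) * expR (- x)).

Definition P0 (t : R) : R :=
  pi `^ (- (N%:R / 2)) * 4 `^ (- t) * (Gamma ((N%:R - 2 * t) / 2) / Gamma t).

End kernel.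
Arguments Gamma {R} s.
Arguments P0 {R} N t.

(* Main.v *)
Require Import Defs.
From mathcomp Require Import all_boot all_order all_algebra.
From mathcomp Require Import complex.
From mathcomp Require Import all_classical all_reals all_analysis.
From mathcomp Require Import measurable_realfun gauss_integral.
From mathcomp Require Import ring lra.
Set Implicit Arguments.
Unset Strict Implicit.
Unset Printing Implicit Defensive.
Import Order.TTheory GRing.Theory Num.Theory.
Import numFieldNormedType.Exports.
Local Open Scope classical_set_scope.
Local Open Scope ring_scope.
Local Open Scope complex_scope.

(** Everything is reduced to Gaussian integrals. For [q > 0], the power [q^(-t)]
    is the Laplace transform at [q] of [s^(t-1) / Gamma t]
    ([integral_tpow_expR_Gamma]), so off the origin [|y|^(-2t)] is a
    superposition over [s > 0] of the Gaussians [e^(-s|y|^2)]. The Fourier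
    integral of such a Gaussian is [(pi/s)^(n/2) e^(-|x|^2/(4s))]
    ([integral_gauss_cos_rV]), and the same superposition of the transforms is
    a multiple of [|x|^(2t-n)] as soon as [t < n/2]
    ([integral_tpow_expR_inv]); collecting the factors gives the constant [P0].

    As an identity of distributions this is
    [\int |y|^(-2t) f^(y) dy = c \int |x|^(2t-n) f(x) dx] for Schwartz [f]
    ([integral_tpow_fcos]). It needs the absolute convergence of the left-hand
    side, hence a decay of the Fourier integral [f^] of order [|y|^(-2n)]
    ([fcos_decay]). To obtain it, note that translating [f] by half a period of
    [x |-> e^(i y.x)] in a coordinate direction changes the sign of [f^(y)]; so
    [f^(y)] is bounded by the Fourier integral of an iterated difference of [f]
    with step [pi / |y_i|], and differences are bounded by derivatives.

    This shows that the powers are a kernel ([log_diffusion_kernel_power]).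
    Conversely a kernel equals them at every [a != 0]: two tempered functions
    which define the same distribution have the same integrals against the
    Gaussians [e^(-s|x-a|^2)], which are Schwartz functions
    ([schwartz_gaussian]) and concentrate at [a] as [s] grows
    ([gaussian_test], [tempered_eq]).

    The rest is read off the formula [P0 |x|^(2t-n)]. It is not integrable
    because its Laplace superposition diverges ([integral_tpow_rV]), while its
    superlevel sets are punctured balls, of measure at most a multiple of [r^n]
    ([lebesgue_rV_ball_le]). By the functional equation and the continuity of
    [Gamma], [(n - 2t) P0] has a positive limit at [n/2] and [P0] tends to [0]
    at [0]. For the limit [delta_0], the Gaussian mean of the kernel is exactly
    [4^(-t) Gamma(n/2-t) / Gamma(n/2)], which tends to [1], and its mean of
    [|x|^(1/2) e^(-|x|^2)] tends to [0], so that only the value of the test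
    function at the origin matters ([power_approximate_identity]). *)

(** * Integrals of real-valued functions *)

Lemma ge0_integrable d (T : measurableType d) (R : realType)
    (mu : {measure set T -> \bar R}) (f : T -> R) :
  measurable_fun setT f -> (forall x, 0 <= f x) ->
  (\int[mu]_x (f x)%:E < +oo)%E -> mu.-integrable setT (EFin \o f).
Proof.
move=> mf f0 foo; apply/integrableP; split; first exact/measurable_EFinP.
rewrite (eq_integral (fun x => (f x)%:E))// => x _.
by rewrite /= ger0_norm.
Qed.

Section integrableR.
Context d (T : measurableType d) (R : realType) (mu : {measure set T -> \bar R}).
Implicit Types f g : T -> R.
Local Notation integrableR f := (mu.-integrable setT (EFin \o f)).

Lemma integrableRD f g :
  integrableR f -> integrableR g -> integrableR (fun x => f x + g x).
Proof.
by move=> fi gi; exact: (integrableD measurableT fi gi).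
Qed.

Lemma integrableRZl k f : integrableR f -> integrableR (fun x => k * f x).
Proof. by move=> fi; exact: (integrableZl measurableT k fi). Qed.

Lemma integrableRB f g :
  integrableR f -> integrableR g -> integrableR (fun x => f x - g x).
Proof. by move=> fi gi; exact: (integrableB measurableT fi gi). Qed.

Lemma le_integrableR f g : measurable_fun setT f ->
  (forall x, `|f x| <= g x) -> integrableR g -> integrableR f.
Proof.
move=> mf fg; apply: le_integrable => //; first exact/measurable_EFinP.
by move=> x _ /=; rewrite lee_fin (le_trans (fg x))// ler_norm.
Qed.

Lemma integrableR_measurable f : integrableR f -> measurable_fun setT f.
Proof. by move/measurable_int/measurable_EFinP. Qed.

End integrableR.

Lemma ge0_integralZlR d (T : measurableType d) (R : realType)
    (mu : {measure set T -> \bar R}) (k : R) (f : T -> R) :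
  0 <= k -> measurable_fun setT f -> (forall x, 0 <= f x) ->
  (\int[mu]_x (k * f x)%:E = k%:E * \int[mu]_x (f x)%:E)%E.
Proof.
move=> k0 mf f0; rewrite -ge0_integralZl_EFin//; last exact/measurable_EFinP.
by move=> x _; rewrite lee_fin.
Qed.

Section fubiniR.
Context d1 d2 (T1 : measurableType d1) (T2 : measurableType d2) (R : realType).
Variables (m1 : {sigma_finite_measure set T1 -> \bar R})
  (m2 : {sigma_finite_measure set T2 -> \bar R}).
Variable f : T1 -> T2 -> R.
Hypothesis mf : measurable_fun setT (fun z : T1 * T2 => f z.1 z.2).
Local Open Scope ereal_scope.

Lemma tonelliR : (forall x y, 0 <= f x y)%R ->
  \int[m1]_x \int[m2]_y (f x y)%:E = \int[m2]_y \int[m1]_x (f x y)%:E.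
Proof.
move=> f0; apply: (fubini_tonelli (fun z => (f z.1 z.2)%:E)).
  exact/measurable_EFinP.
by move=> z; rewrite lee_fin.
Qed.

Lemma fubiniR : \int[m1]_x \int[m2]_y `|f x y|%:E < +oo ->
  \int[m1]_x \int[m2]_y (f x y)%:E = \int[m2]_y \int[m1]_x (f x y)%:E.
Proof.
move=> foo; apply: (@Fubini _ _ _ _ _ m1 m2 (fun z => (f z.1 z.2)%:E)).
apply/integrable12ltyP; first exact/measurable_EFinP.
exact: foo.
Qed.

End fubiniR.

(** * Integrals over the line *)

Section line_integrals.
Context {R : realType}.
Local Notation mu := (@lebesgue_measure R).
Implicit Types (a b r s t y : R).

Let affine r b : measurableTypeR R -> measurableTypeR R := fun x => r * x + b.

Let measurable_affine r b : measurable_fun setT (affine r b).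
Proof.
by apply: measurable_funD => //; apply: measurable_funM.
Qed.

Let affine_preimage r b (c d : R) : 0 < r ->
  (fun x => r * x + b) @^-1` `]c, d] = `](c - b) / r, (d - b) / r]%classic.
Proof.
move=> r0; apply/seteqP; split => x /=; rewrite !in_itv/=.
  by rewrite ltr_pdivrMr// ler_pdivlMr// ltrBlDr lerBrDr (mulrC x).
by rewrite ltr_pdivrMr// ler_pdivlMr// ltrBlDr lerBrDr (mulrC x).
Qed.

(** The image of the Lebesgue measure by an affine map is determined on
    intervals. *)
Lemma ge0_integral_affine (f : R -> \bar R) r b : 0 < r ->
  measurable_fun setT f -> (forall x, 0 <= f x)%E ->
  (\int[mu]_x f x = r%:E * \int[mu]_x f (r * x + b)%R)%E.
Proof.
move=> r0 mf f0.
pose nu0 : {measure set (measurableTypeR R) -> \bar R} :=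
  measure_function_pushforward__canonical__measure_function_Measure mu
    (@measurable_affine r b).
pose nu := mscale (NngNum (ltW r0)) nu0.
transitivity (\int[nu]_x f x)%E.
  apply: eq_measure_integral => A mA _; apply: lebesgue_measure_unique => // X.
  move=> [[c d]] _ <-; rewrite /nu /mscale/= /pushforward.
  rewrite -[mscale _ _ _]/(r%:E * mu (affine r b @^-1` `]c, d]))%E.
  rewrite /affine affine_preimage// !lebesgue_measure_itv/= !lte_fin.
  rewrite ltr_pM2r ?invr_gt0// ltrD2r; case: ifPn => cd; last by rewrite mule0.
  rewrite -!EFinD -EFinM; congr EFin.
  by rewrite -mulrBl mulrCA divff ?gt_eqF// mulr1; lra.
rewrite /nu ge0_integral_mscale//=.
by rewrite ge0_integral_pushforward//; exact: measurable_affine.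
Qed.
End line_integrals.

(** * The Gamma function *)

(** The truncated power [s_+^a]; it makes every Mellin transform an integral
    over the whole line. *)
Definition tpow {R : realType} (a s : R) : R := if 0 < s then s `^ a else 0.

Section tpow.
Context {R : realType}.
Implicit Types (a b c r s t y : R).

Lemma tpow_ge0 a s : 0 <= tpow a s.
Proof. by rewrite /tpow; case: ifP => // _; exact: powR_ge0. Qed.

Lemma tpowE a s : 0 < s -> tpow a s = s `^ a.
Proof. by rewrite /tpow => ->. Qed.

Lemma tpow_le0 a s : s <= 0 -> tpow a s = 0.
Proof. by rewrite /tpow ltNge => ->. Qed.

Lemma tpowD a b s : tpow (a + b) s = tpow a s * tpow b s.
Proof.
rewrite /tpow; case: ifPn => s0; last by rewrite mulr0.
by rewrite powRD// (gt_eqF s0) implybT.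
Qed.

Lemma tpowM a r s : 0 < r -> tpow a (r * s) = r `^ a * tpow a s.
Proof.
move=> r0; rewrite /tpow pmulr_rgt0//; case: ifPn => s0; last by rewrite mulr0.
by rewrite powRM// ltW.
Qed.

Lemma measurable_tpow a : measurable_fun setT (tpow a).
Proof.
rewrite /tpow; apply: measurable_fun_if => //.
- exact: measurable_fun_ltr.
- by apply: measurable_funTS; exact: measurable_powR.
Qed.

Lemma tpow_le_add a b c s : a <= b <= c -> tpow b s <= tpow a s + tpow c s.
Proof.
move=> /andP[ab bc]; rewrite /tpow; case: ifPn => s0; last by rewrite addr0.
have [s1|s1] := leP s 1.
  rewrite (@le_trans _ _ (s `^ a))// ?lerDl ?powR_ge0//.
  by apply: ger_powR => //; rewrite s0.
rewrite (@le_trans _ _ (s `^ c))// ?lerDr ?powR_ge0//.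
by apply: ler_powR => //; exact: ltW.
Qed.

End tpow.

Section gammaE.
Context {R : realType}.
Local Notation mu := (@lebesgue_measure R).
Implicit Types (a b c r s t y : R).
Local Open Scope ereal_scope.

(** The extended-real value of the integral: the algebraic identities come
    first, and the convergence ([gammaE_lty]) is deduced from them. *)
Definition gammaE a : \bar R := \int[mu]_s (tpow (a - 1) s * expR (- s))%:E.

Lemma ge0_integral_if (p : pred R) (f : R -> R) :
  \int[mu]_(x in [set x | p x]) (f x)%:E =
  \int[mu]_x (if p x then f x else 0%R)%:E.
Proof.
rewrite integral_mkcond; apply: eq_integral => x _.
rewrite /patch; have [px|px] := boolP (p x); first by rewrite mem_set.
by rewrite memNset//; exact/negP.
Qed.

Lemma Gamma_fine a : Gamma a = fine (gammaE a).
Proof.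
rewrite /Gamma /gammaE /Rintegral; congr fine.
rewrite (_ : [set` `]0%R, +oo[] = [set x | (0 < x)%R]); last first.
  by apply/seteqP; split => x /=; rewrite in_itv/= andbT.
rewrite ge0_integral_if; apply: eq_integral => x _; congr EFin.
by rewrite /tpow; case: ifP => //; rewrite mul0r.
Qed.

Let mexp y : measurable_fun setT (fun s : R => expR (- (y * s))).
Proof.
by apply: measurableT_comp => //; apply: measurableT_comp => //; apply: measurable_funM.
Qed.

Lemma gammaE_ge0 a : 0 <= gammaE a.
Proof.
by apply: integral_ge0 => s _; rewrite lee_fin mulr_ge0 ?tpow_ge0 ?expR_ge0.
Qed.

(** The Laplace transform of a power is a power, by scaling. *)
Lemma integral_tpow_expR a y : (0 < y)%R ->
  \int[mu]_s (tpow (a - 1) s * expR (- (y * s)))%:E = (y `^ (- a))%:E * gammaE a.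
Proof.
move=> y0.
have mf : measurable_fun setT (fun s => (tpow (a - 1) s * expR (- s))%:E).
  apply/measurable_EFinP; apply: measurable_funM; first exact: measurable_tpow.
  by apply: measurableT_comp => //; apply: measurableT_comp.
have f0 s : 0 <= (tpow (a - 1) s * expR (- s))%:E.
  by rewrite lee_fin mulr_ge0 ?tpow_ge0 ?expR_ge0.
rewrite /gammaE [in RHS](ge0_integral_affine 0%R y0 mf f0).
under [X in _ * (_ * X)]eq_integral.
  move=> s _; rewrite addr0 tpowM// -mulrA.
  over.
rewrite ge0_integralZlR; last 3 first.
- exact: powR_ge0.
- by apply: measurable_funM; [exact: measurable_tpow|exact: mexp].
- by move=> s; rewrite mulr_ge0 ?tpow_ge0 ?expR_ge0.
rewrite !muleA -!EFinM.
rewrite [X in (_ * X * _)%R](_ : y = (y `^ 1)%R); last by rewrite powRr1// ltW.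
rewrite -!powRD ?(gt_eqF y0) ?implybT//.
by rewrite [X in (_ `^ X)%R](_ : _ = 0)%R ?powRr0 ?mul1e//; lra.
Qed.

(** The fundamental theorem of calculus on the half-line [x >= 1]. *)
Let integral_tail (f F : R -> R) :
  (forall x : R, 1 <= x -> 0 <= f x)%R -> (forall x : R, (0 < x)%R -> {for x, continuous f}) ->
  (forall x : R, (0 < x)%R -> is_derive x 1%R F (f x)) -> F x @[x --> +oo%R] --> 0%R ->
  \int[mu]_x (if 1 <= x then f x else 0)%R%:E = (- F 1)%R%:E.
Proof.
move=> f0 cf dF F0.
have pos x : (1 <= x -> 0 < x)%R by move=> h; apply: lt_le_trans h.
have dF' x : (0 < x)%R -> derivable F x 1 by move=> x0; have := dF _ x0; case.
rewrite -(ge0_integral_if (fun x => 1 <= x)%R).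
rewrite (_ : [set x | _] = `[1%R, +oo[%classic); last first.
  by apply/seteqP; split => x /=; rewrite in_itv/= andbT.
rewrite (@ge0_continuous_FTC2y _ f F 1 0)//.
- by rewrite sub0e.
- apply: continuous_in_subspaceT => x; rewrite inE/= in_itv/= andbT => x1.
  by apply: cf; exact: pos.
- by move=> x x1; apply/dF'/pos/ltW.
- apply: cvg_at_right_filter; apply: differentiable_continuous.
  by apply/derivable1_diffP; exact: dF'.
- move=> x; rewrite in_itv/= andbT => x1.
  have x0 : (0 < x)%R by apply/pos/ltW.
  by rewrite derive1E; have := dF _ x0; case.
Qed.

Let integral_tail_powR a : (0 < a)%R ->
  \int[mu]_x (if 1 <= x then x `^ (- (a + 1)) else 0)%R%:E = (a^-1)%:E.
Proof.
move=> a0.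
rewrite (_ : a^-1 = - (- a^-1 * 1 `^ (- a)))%R; last by rewrite powR1 mulr1 opprK.
apply: (integral_tail (F := fun x => - a^-1 * x `^ (- a)))%R.
- by move=> x _; exact: powR_ge0.
- move=> x x0; apply: differentiable_continuous; apply/derivable1_diffP.
  by apply: derivable_powR; rewrite in_itv/= andbT.
- move=> x x0; have d := is_derive1_powR (- a) x0.
  have := is_deriveZ (- a^-1)%R d.
  rewrite (_ : _ *: _ = x `^ (- (a + 1)))%R//.
  rewrite /GRing.scale/= mulrA mulNr mulrN opprK mulVf ?gt_eqF// mul1r.
  by congr (_ `^ _)%R; lra.
- rewrite -[X in _ --> X](mulr0 (- a^-1)%R); apply: cvgM; first exact: cvg_cst.
  apply/cvgrPdist_lt => e e0; near=> x.
  have x0 : (0 < x)%R by near: x; exact: nbhs_pinfty_gt.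
  rewrite sub0r normrN ger0_norm ?powR_ge0// powRN invf_plt ?posrE ?powR_gt0//.
  have -> : (e^-1 = (e^-1 `^ a^-1) `^ a)%R.
    by rewrite -powRrM mulVf ?gt_eqF// powRr1// ltW ?invr_gt0.
  suff x1 : (e^-1 `^ a^-1 < x)%R.
    by rewrite gt0_ltr_powR ?nnegrE ?powR_ge0 ?(ltW x0).
  by near: x; exact: nbhs_pinfty_gt.
Unshelve. all: by end_near. Qed.

Let integral_tail_expR s : (0 < s)%R ->
  \int[mu]_x (if 1 <= x then expR (- (x * s)) else 0)%R%:E = (expR (- s) / s)%:E.
Proof.
move=> s0.
have d (x : R) : is_derive x 1%R (fun x : R => - s^-1 * expR (- (x * s)))%R (expR (- (x * s))).
  have d1 : is_derive x 1%R (fun x : R => - (x * s))%R (- s)%R.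
    rewrite (_ : (fun x : R => _) = ( - s) \*: (@id R))%R; last first.
      by apply/funext => z /=; rewrite [RHS]mulNr mulrC.
    by apply: is_derive_eq; rewrite /GRing.scale/= mulr1.
  have := is_deriveZ (- s^-1)%R (is_derive1_comp (is_derive_expR _) d1).
  rewrite (_ : _ *: _ = expR (- (x * s)))%R//.
  rewrite /GRing.scale/=; field.
  by rewrite gt_eqF.
rewrite (_ : expR (- s) / s = - (- s^-1 * expR (- (1 * s))))%R; last first.
  by rewrite mul1r mulNr opprK mulrC.
apply: (integral_tail (F := fun x => - s^-1 * expR (- (x * s))))%R.
- by move=> x _; exact: expR_ge0.
- move=> x _; apply: continuous_comp; last exact: continuous_expR.
  by apply: cvgN; apply: cvgM => //; exact: cvg_cst.
- rewrite -[X in _ --> X](mulr0 (- s^-1)%R); apply: cvgM; first exact: cvg_cst.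
  apply: (@cvg_comp _ _ _ (fun x : R => x * s)%R (fun x => expR (- x)) _ (pinfty_nbhs R)).
    exact: gt0_cvgMly.
  exact: cvgr_expR.
Qed.

(** The functional equation comes from Tonelli's theorem applied to
    [y, s |-> s^a e^(-ys)] on [y >= 1], whose integral in [s] is
    [Gamma (a + 1) y^(-a-1)] and whose integral in [y] is [s^(a-1) e^(-s)]. *)
Lemma gammaES a : (0 < a)%R -> gammaE a = (a^-1)%:E * gammaE (a + 1).
Proof.
move=> a0.
pose f (z : measurableTypeR R * measurableTypeR R) :=
  (tpow a z.2 * (if 1 <= z.1 then expR (- (z.1 * z.2)) else 0))%R%:E.
have mf : measurable_fun setT f.
  apply/measurable_EFinP; apply: measurable_funM.
    by apply: (measurableT_comp (measurable_tpow a)).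
  apply: measurable_fun_if => //.
    exact: measurable_fun_ler.
  apply: measurable_funTS; apply: measurableT_comp => //; apply: measurableT_comp => //.
  exact: measurable_funM.
have f0 z : 0 <= f z.
  by rewrite lee_fin mulr_ge0 ?tpow_ge0//; case: ifP => // _; exact: expR_ge0.
have := @fubini_tonelli _ _ _ _ R mu mu f mf f0.
rewrite (_ : (fun y => \int[mu]_s f (y, s)) = (fun y =>
    (if 1 <= y then y `^ (- (a + 1)) else 0)%R%:E * gammaE (a + 1))); last first.
  apply/funext => y; rewrite /f/=; case: ifPn => y1; last first.
    by rewrite mul0e integral0_eq// => s _; rewrite mulr0.
  have y0 : (0 < y)%R by exact: lt_le_trans y1.
  rewrite -(integral_tpow_expR (a + 1) y0).
  by apply: eq_integral => s _; rewrite addrK.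
rewrite [X in _ = X](_ : _ = gammaE a).
  move=> <-; rewrite ge0_integralZr//.
  - by rewrite integral_tail_powR.
  - apply/measurable_EFinP; apply: measurable_fun_if => //.
      exact: measurable_fun_ler.
    by apply: measurable_funTS; exact: measurable_powR.
  - by move=> y _; rewrite lee_fin; case: ifP => // _; exact: powR_ge0.
  - exact: gammaE_ge0.
apply: eq_integral => s _; rewrite /f/=; have [s0|s0] := leP s 0%R.
  by rewrite (tpow_le0 (a - 1) s0) mul0r integral0_eq// => y _; rewrite tpow_le0// mul0r.
rewrite ge0_integralZlR; last 3 first.
- exact: tpow_ge0.
- apply: measurable_fun_if => //.
    exact: measurable_fun_ler.
  by apply: measurable_funTS; under eq_fun do rewrite mulrC; exact: mexp.
- by move=> y; case: ifP => // _; exact: expR_ge0.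
rewrite integral_tail_expR// -EFinM (tpowD a (-1)); congr EFin.
by rewrite (tpowE (-1) s0) powR_inv1 ?ltW//; ring.
Qed.

Lemma gammaE1 : gammaE 1 = 1.
Proof.
rewrite /gammaE subrr.
transitivity (\int[mu]_s (if 0 < s then expR (- s) else 0)%R%:E).
  apply: eq_integral => s _; rewrite /tpow powRr0.
  by case: ifP => _; rewrite ?mul1r ?mul0r.
rewrite -(ge0_integral_if (fun x => 0 < x)%R).
rewrite (_ : [set x | _] = `]0%R, +oo[%classic); last first.
  by apply/seteqP; split => x /=; rewrite in_itv/= andbT.
rewrite integral_itv_obnd_cbnd; last first.
  apply/measurable_EFinP/measurable_funTS.
  by apply: measurableT_comp => //; apply: measurableT_comp.
have d (x : R) : is_derive x 1%R (fun x => - expR (- x))%R (expR (- x)).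
  have d1 : is_derive x 1%R (fun x : R => - x)%R (-1)%R by apply: is_derive_eq.
  have := is_deriveN (is_derive1_comp (is_derive_expR (- x)) d1).
  by rewrite mulrN1 opprK.
rewrite (@ge0_continuous_FTC2y _ _ (fun x => - expR (- x))%R 0 0)//.
- by rewrite oppr0 expR0 sub0e -EFinN opprK.
- apply: continuous_subspaceT => x; apply: continuous_comp; last exact: continuous_expR.
  exact: opp_continuous.
- by rewrite -oppr0; apply: cvgN; exact: cvgr_expR.
- apply: cvg_at_right_filter; apply: cvgN.
  apply: continuous_comp; last exact: continuous_expR.
  exact: opp_continuous.
- by move=> x _; rewrite derive1E derive_val.
Qed.

Lemma gammaE_natS n : gammaE n.+1%:R = (n`!%:R)%:E.
Proof.
elim: n => [|n IH]; first by rewrite fact0 gammaE1.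
have := @gammaES n.+1%:R (ltr0Sn _ _); rewrite natr1 IH.
rewrite factS natrM => /(congr1 (fun z => n.+1%:R%:E * z)).
by rewrite muleA -!EFinM divff ?pnatr_eq0// mul1e => ->.
Qed.

Lemma gammaE_le_add a b c : (a <= b <= c)%R -> gammaE b <= gammaE a + gammaE c.
Proof.
move=> abc.
have mg d : measurable_fun setT (fun s => (tpow (d - 1) s * expR (- s))%:E).
  apply/measurable_EFinP; apply: measurable_funM; first exact: measurable_tpow.
  by apply: measurableT_comp => //; apply: measurableT_comp.
have g0 d s : 0 <= (tpow (d - 1) s * expR (- s))%:E.
  by rewrite lee_fin mulr_ge0 ?tpow_ge0 ?expR_ge0.
rewrite {2 3}/gammaE -(ge0_integralD mu measurableT (fun s _ => g0 a s) (mg a) (fun s _ => g0 c s) (mg c)).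
apply: ge0_le_integral => //.
- exact: mg.
- by apply: emeasurable_funD; exact: mg.
- move=> s _; rewrite -EFinD lee_fin -mulrDl ler_wpM2r ?expR_ge0//.
  by apply: tpow_le_add; lra.
Qed.

(** Finiteness at the integers propagates to [a >= 1], since an intermediate power
    is at most the sum of the two extreme ones, and then to [a > 0] by the
    functional equation. *)
Lemma gammaE_lty a : (0 < a)%R -> gammaE a < +oo.
Proof.
have h b : (1 <= b)%R -> gammaE b < +oo.
  move=> b1; pose n := Num.truncn b.
  have /andP[nb bn] := truncn_itv (le_trans ler01 b1).
  apply: (@le_lt_trans _ _ (gammaE 1 + gammaE (Num.truncn b).+1%:R)).
    by apply: gammaE_le_add; rewrite b1 ltW.
  by rewrite gammaE1 gammaE_natS -EFinD ltry.
move=> a0; rewrite gammaES//; apply: lte_mul_pinfty; rewrite ?lee_fin ?invr_ge0 ?ltW//.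
by apply: h; lra.
Qed.

Lemma gammaE_Gamma a : (0 < a)%R -> gammaE a = (Gamma a)%:E.
Proof.
by move=> a0; rewrite Gamma_fine fineK// ge0_fin_numE ?gammaE_ge0// gammaE_lty.
Qed.
Local Close Scope ereal_scope.

Lemma GammaS a : 0 < a -> Gamma (a + 1) = a * Gamma a.
Proof.
move=> a0; have := gammaES a0; rewrite !gammaE_Gamma//; last by lra.
by move=> [->]; rewrite mulrA divff ?gt_eqF// mul1r.
Qed.

Lemma Gamma1 : Gamma 1 = 1 :> R.
Proof. by apply: EFin_inj; rewrite -gammaE_Gamma// gammaE1. Qed.

(** If [Gamma a] vanished, so would all the [Gamma (a + n)], and hence, by
    [gammaE_le_add], [Gamma] at an integer between [a] and some [a + n]. *)
Lemma Gamma_gt0 a : 0 < a -> 0 < Gamma a.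
Proof.
move=> a0.
have G0 b : 0 < b -> 0 <= Gamma b.
  by move=> b0; rewrite -lee_fin -gammaE_Gamma// gammaE_ge0.
rewrite lt_neqAle G0// andbT eq_sym; apply/eqP => Ga0.
have GaD n : Gamma (a + n%:R) = 0.
  elim: n => [|n IH]; first by rewrite addr0.
  by rewrite -natr1 addrA GammaS ?IH ?mulr0// ltr_wpDr.
have /andP[_ an] := truncn_itv (ltW a0); set n := (Num.truncn a).+1 in an.
have nan : a <= n%:R <= a + n%:R by rewrite ltW//= lerDr ltW.
have := gammaE_le_add nan.
rewrite !gammaE_Gamma ?ltr0n// ?ltr_wpDr// Ga0 GaD -EFinD lee_fin addr0.
apply/negP; rewrite -ltNge -lte_fin -gammaE_Gamma ?ltr0n// gammaE_natS lte_fin.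
by rewrite ltr0n fact_gt0.
Qed.

Lemma integral_tpow_expR_Gamma a y : 0 < a -> 0 < y ->
  (\int[mu]_s (tpow (a - 1) s * expR (- (y * s)))%:E = (Gamma a * y `^ (- a))%:E)%E.
Proof.
by move=> a0 y0; rewrite integral_tpow_expR// gammaE_Gamma// -EFinM mulrC.
Qed.

Lemma measurable_gamma_integrand a :
  measurable_fun setT (fun s : R => tpow (a - 1) s * expR (- s)).
Proof.
apply: measurable_funM; first exact: measurable_tpow.
by apply: measurableT_comp => //; apply: measurableT_comp.
Qed.

Lemma integrable_gamma a : 0 < a ->
  mu.-integrable setT (EFin \o (fun s => tpow (a - 1) s * expR (- s))).
Proof.
move=> a0; apply: ge0_integrable.
- exact: measurable_gamma_integrand.
- by move=> s; rewrite mulr_ge0 ?tpow_ge0 ?expR_ge0.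
- exact: gammaE_lty.
Qed.

(** Dominated convergence: near [a] the integrand is below the sum of those at
    [a / 2] and [a + 1]. *)
Lemma continuous_Gamma a : 0 < a -> {for a, continuous (@Gamma R)}.
Proof.
move=> a0.
have -> : @Gamma R = fun a => \int[mu]_s (tpow (a - 1) s * expR (- s)).
  by apply/funext => b; rewrite Gamma_fine.
apply: (@continuity_under_integral R _ _ mu (fun a s => tpow (a - 1) s * expR (- s))
  setT measurableT (a / 2) (a + 1) _ _
  (fun s => (tpow (a / 2 - 1) s + tpow (a + 1 - 1) s) * expR (- s))).
- by move=> b /=; rewrite in_itv/= => /andP[ab _]; apply: integrable_gamma; lra.
- apply/aeW => s _ b _; rewrite /tpow; have [s0|s0] := boolP (0 < s); last first.
    by rewrite mul0r; exact: cst_continuous.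
  apply: cvgM; last exact: cvg_cst.
  rewrite /powR gt_eqF//; apply: continuous_comp; last exact: continuous_expR.
  by apply: cvgM; [apply: cvgB => //; exact: cvg_cst|exact: cvg_cst].
- rewrite (_ : (fun s => _) = (fun s => tpow (a / 2 - 1) s * expR (- s) +
      tpow (a + 1 - 1) s * expR (- s))); last by apply/funext => s; rewrite mulrDl.
  by apply: integrableRD; apply: integrable_gamma; lra.
- move=> b /=; rewrite in_itv/= => /andP[b1 b2]; apply/aeW => s _.
  rewrite ger0_norm ?mulr_ge0 ?tpow_ge0 ?expR_ge0// ler_wpM2r ?expR_ge0//.
  by apply: tpow_le_add; lra.
- by rewrite inE/= in_itv/=; lra.
Qed.

(** The Beta integral: multiply by [Gamma c], write [(1 + s)^(-c) Gamma c] as a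
    Laplace transform, and integrate in [s] first. *)
Lemma beta_integral t c : 0 < t < c ->
  (\int[mu]_s (Gamma c * (tpow (t - 1) s * (1 + s) `^ (- c)))%:E =
   (Gamma t * Gamma (c - t))%:E)%E.
Proof.
move=> /andP[t0 tc]; have c0 : 0 < c by exact: lt_trans tc.
pose f s v := tpow (t - 1) s * (tpow (c - 1) v * expR (- ((1 + s) * v))).
have mf : measurable_fun setT (fun z : measurableTypeR R * measurableTypeR R => f z.1 z.2).
  apply: measurable_funM; first exact: (measurableT_comp (measurable_tpow (t - 1))).
  apply: measurable_funM; first exact: (measurableT_comp (measurable_tpow (c - 1))).
  apply: measurableT_comp => //; apply: measurableT_comp => //.
  by apply: measurable_funM => //; apply: measurable_funD.
have f0 s v : 0 <= f s v by rewrite !mulr_ge0 ?tpow_ge0 ?expR_ge0.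
transitivity (\int[mu]_s \int[mu]_v (f s v)%:E)%E.
  apply: eq_integral => s _; rewrite /f; have [s0|s0] := leP s 0.
    rewrite (tpow_le0 _ s0) mul0r mulr0 integral0_eq// => v _.
    by rewrite mul0r.
  rewrite ge0_integralZlR.
  - by rewrite integral_tpow_expR_Gamma ?ltr_wpDr ?ltW// -EFinM mulrCA.
  - exact: tpow_ge0.
  - by apply: measurable_funM; [exact: measurable_tpow|exact: mexp].
  - by move=> v; rewrite mulr_ge0 ?tpow_ge0 ?expR_ge0.
rewrite (tonelliR mu mu mf f0).
transitivity (\int[mu]_v (Gamma t * (tpow (c - t - 1) v * expR (- v)))%:E)%E.
  apply: eq_integral => v _; rewrite /f; have [v0|v0] := leP v 0.
    rewrite !(tpow_le0 _ v0) mul0r mulr0 integral0_eq// => s _.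
    by rewrite mul0r mulr0.
  transitivity (\int[mu]_s ((tpow (c - 1) v * expR (- v)) *
      (tpow (t - 1) s * expR (- (v * s))))%:E)%E.
    apply: eq_integral => s _; congr EFin.
    by rewrite mulrDl opprD expRD mul1r (mulrC s v); ring.
  rewrite ge0_integralZlR.
  - rewrite integral_tpow_expR_Gamma// -EFinM; congr EFin.
    rewrite -(tpowE (- t) v0) (_ : c - t - 1 = c - 1 + - t); last by lra.
    by rewrite (tpowD (c - 1)); ring.
  - by rewrite mulr_ge0 ?tpow_ge0 ?expR_ge0.
  - by apply: measurable_funM; [exact: measurable_tpow|exact: mexp].
  - by move=> s; rewrite mulr_ge0 ?tpow_ge0 ?expR_ge0.
rewrite ge0_integralZlR.
- by rewrite -[X in (_ * X)%E]/(gammaE (c - t)) gammaE_Gamma ?subr_gt0.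
- exact/ltW/Gamma_gt0.
- exact: measurable_gamma_integrand.
- by move=> v; rewrite mulr_ge0 ?tpow_ge0 ?expR_ge0.
Qed.

Let minvexp y : measurable_fun setT (fun s : R => expR (- (y * tpow (- 1) s))).
Proof.
apply: measurableT_comp => //; apply: measurableT_comp => //.
by apply: measurable_funM => //; exact: measurable_tpow.
Qed.

Let integral_tpow_expR_inv_scale b y : 0 < y ->
  (\int[mu]_s (tpow (- b - 1) s * expR (- (y * tpow (- 1) s)))%:E =
   (y `^ (- b))%:E * \int[mu]_s (tpow (- b - 1) s * expR (- tpow (- 1) s))%:E)%E.
Proof.
move=> y0.
have mf : measurable_fun setT
    (fun s => (tpow (- b - 1) s * expR (- (y * tpow (- 1) s)))%:E).
  apply/measurable_EFinP; apply: measurable_funM; first exact: measurable_tpow.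
  exact: minvexp.
have f0 s : (0 <= (tpow (- b - 1) s * expR (- (y * tpow (- 1) s)))%:E)%E.
  by rewrite lee_fin mulr_ge0 ?tpow_ge0 ?expR_ge0.
rewrite (ge0_integral_affine 0 y0 mf f0).
under [X in (_ * X)%E]eq_integral.
  move=> s _; rewrite addr0 !tpowM// mulrA powR_inv1 ?ltW// divff ?gt_eqF// mul1r.
  rewrite -mulrA.
  over.
rewrite ge0_integralZlR.
- rewrite muleA -EFinM; congr (_%:E * _)%E.
  rewrite -[X in X * _](powRr1 (ltW y0)) -powRD ?(gt_eqF y0) ?implybT//.
  by congr (_ `^ _); lra.
- exact: powR_ge0.
- apply: measurable_funM; first exact: measurable_tpow.
  by under eq_fun do rewrite -[X in - X]mul1r; exact: minvexp.
- by move=> s; rewrite mulr_ge0 ?tpow_ge0 ?expR_ge0.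
Qed.

(** The inversion [s = 1 / u] in the Gamma integral follows from the Beta integral.
    Let [J] be the integral to be computed. With [y tpow (-1) s] in the exponent
    it becomes [y^(-b) J] by homogeneity, so integrating it against [y^b e^(-y)]
    gives [J]; in the other order, this double integral is
    [Gamma (b + 1) B(1, b) = Gamma b]. *)
Let integral_tpow_expR_inv1 b : 0 < b ->
  (\int[mu]_s (tpow (- b - 1) s * expR (- tpow (- 1) s))%:E = (Gamma b)%:E)%E.
Proof.
move=> b0.
pose f y s := tpow b y * expR (- y) * (tpow (- b - 1) s * expR (- (y * tpow (- 1) s))).
have mf : measurable_fun setT (fun z : measurableTypeR R * measurableTypeR R => f z.1 z.2).
  apply: measurable_funM; [apply: measurable_funM|apply: measurable_funM].
  - exact: (measurableT_comp (measurable_tpow b)).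
  - by apply: measurableT_comp => //; apply: measurableT_comp.
  - exact: (measurableT_comp (measurable_tpow (- b - 1))).
  - apply: measurableT_comp => //; apply: measurableT_comp => //.
    by apply: measurable_funM => //; exact: (measurableT_comp (measurable_tpow (- 1))).
have f0 s v : 0 <= f s v by rewrite !mulr_ge0 ?tpow_ge0 ?expR_ge0.
set J := (LHS); have J0 : (0 <= J)%E.
  by apply: integral_ge0 => s _; rewrite lee_fin mulr_ge0 ?tpow_ge0 ?expR_ge0.
transitivity (\int[mu]_y \int[mu]_s (f y s)%:E)%E.
  transitivity (\int[mu]_y ((tpow (1 - 1) y * expR (- y))%:E * J))%E.
    rewrite ge0_integralZr//.
    - by rewrite -[X in (X * _)%E]/(gammaE 1) gammaE1 mul1e.
    - apply/measurable_EFinP; exact: measurable_gamma_integrand.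
    - by move=> v _; rewrite lee_fin mulr_ge0 ?tpow_ge0 ?expR_ge0.
  apply: eq_integral => y _; rewrite /f; have [y0|y0] := leP y 0.
    rewrite (tpow_le0 _ y0) mul0r mul0e integral0_eq// => s _.
    by rewrite (tpow_le0 _ y0) !mul0r.
  rewrite ge0_integralZlR.
  - rewrite integral_tpow_expR_inv_scale// muleA -EFinM; congr (_%:E * _)%E.
    by rewrite -(tpowE (- b) y0) mulrAC -tpowD !subrr.
  - by rewrite mulr_ge0 ?tpow_ge0 ?expR_ge0.
  - by apply: measurable_funM; [exact: measurable_tpow|exact: minvexp].
  - by move=> s; rewrite mulr_ge0 ?tpow_ge0 ?expR_ge0.
rewrite (tonelliR mu mu mf f0).
have -> : Gamma b = Gamma 1 * Gamma (b + 1 - 1) by rewrite Gamma1 mul1r addrK.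
rewrite -beta_integral; last by lra.
apply: eq_integral => s _; rewrite /f; have [s0|s0] := leP s 0.
  rewrite !(tpow_le0 _ s0) mul0r mulr0 integral0_eq// => y _.
  by rewrite mul0r mulr0.
transitivity (\int[mu]_y (tpow (- b - 1) s *
    (tpow (b + 1 - 1) y * expR (- ((1 + s^-1) * y))))%:E)%E.
  apply: eq_integral => y _; congr EFin.
  rewrite addrK (tpowE (- 1) s0) powR_inv1 ?ltW//.
  by rewrite mulrDl opprD expRD mul1r (mulrC y); ring.
have s1 : 0 < 1 + s^-1 by rewrite addr_gt0// invr_gt0.
rewrite ge0_integralZlR.
- rewrite integral_tpow_expR_Gamma//; last by lra.
  rewrite -EFinM mulrCA; congr (_ * _)%:E.
  rewrite (_ : 1 + s = s * (1 + s^-1)); last by rewrite mulrDr mulr1 divff ?gt_eqF// addrC.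
  rewrite powRM ?ltW// subrr !tpowE// powRr0 mul1r.
  by congr (_ `^ _ * _); lra.
- exact: tpow_ge0.
- by apply: measurable_funM; [exact: measurable_tpow|exact: mexp].
- by move=> y; rewrite mulr_ge0 ?tpow_ge0 ?expR_ge0.
Qed.

(** The inversion [s = 1 / u] of the Gamma integral. *)
Lemma integral_tpow_expR_inv b y : 0 < b -> 0 < y ->
  (\int[mu]_s (tpow (- b - 1) s * expR (- (y * tpow (- 1) s)))%:E =
   (Gamma b * y `^ (- b))%:E)%E.
Proof.
move=> b0 y0.
by rewrite integral_tpow_expR_inv_scale// integral_tpow_expR_inv1// -EFinM mulrC.
Qed.
End gammaE.

(** * The Fourier transform of a Gaussian on the line *)

Section gauss_line.
Context {R : realType}.
Local Notation mu := (@lebesgue_measure R).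
Implicit Types (a b c r s t u x y z : R).

Lemma integral_shift (f : R -> \bar R) b : measurable_fun setT f ->
  (\int[mu]_x f (x + b)%R = \int[mu]_x f x)%E.
Proof.
move=> mf; rewrite [LHS]integralE [RHS]integralE; congr (_ - _)%E.
- rewrite (ge0_integral_affine b ltr01 (measurable_funepos mf) (funepos_ge0 f)) mul1e.
  by apply: eq_integral => x _; rewrite !funeposE mul1r.
- rewrite (ge0_integral_affine b ltr01 (measurable_funeneg mf) (funeneg_ge0 f)) mul1e.
  by apply: eq_integral => x _; rewrite !funenegE mul1r.
Qed.

Let mgauss s : measurable_fun setT (fun u : R => expR (- (s * u ^+ 2))).
Proof.
apply: measurableT_comp => //; apply: measurableT_comp => //.
by apply: measurable_funM => //; exact: measurable_funX.
Qed.

Lemma integral_gauss_scale s : 0 < s ->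
  (\int[mu]_u (expR (- (s * u ^+ 2)))%:E = (Num.sqrt (pi / s))%:E)%E.
Proof.
move=> s0; have q0 : 0 < Num.sqrt s by rewrite sqrtr_gt0.
have mg : measurable_fun setT (fun u : R => (gauss_fun u)%:E).
  by apply/measurable_EFinP; exact: measurable_gauss_fun.
have g0 (u : R) : (0 <= (gauss_fun u)%:E)%E by rewrite lee_fin gauss_fun_ge0.
have := integralT_gauss (R := R).
rewrite (ge0_integral_affine 0 q0 mg g0).
under eq_integral do rewrite addr0 /gauss_fun exprMn sqr_sqrtr ?ltW//.
move=> /(congr1 (fun z : \bar R => (Num.sqrt s)^-1%:E * z)%E).
rewrite muleA -EFinM mulVf ?gt_eqF// mul1e => ->.
by rewrite -EFinM sqrtrM ?pi_ge0// sqrtrV ?ltW// mulrC.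
Qed.

Lemma integrable_gauss_scale s : 0 < s ->
  mu.-integrable setT (EFin \o (fun u => expR (- (s * u ^+ 2)))).
Proof.
move=> s0; apply: ge0_integrable; first exact: mgauss.
  by move=> u; exact: expR_ge0.
by rewrite integral_gauss_scale// ltry.
Qed.

Let mcosl x b : measurable_fun setT (fun u : R => cos (x * u + b)).
Proof.
apply: (measurableT_comp (f := @cos R)).
  by apply: continuous_measurable_fun; exact: continuous_cos.
by apply: measurable_funD => //; exact: measurable_funM.
Qed.

Let msinl x b : measurable_fun setT (fun u : R => sin (x * u + b)).
Proof.
apply: (measurableT_comp (f := @sin R)).
  by apply: continuous_measurable_fun; exact: continuous_sin.
by apply: measurable_funD => //; exact: measurable_funM.
Qed.

Let F s b x := \int[mu]_u (expR (- (s * u ^+ 2)) * cos (x * u + b)).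
Let S s b x := \int[mu]_u (u * expR (- (s * u ^+ 2)) * sin (x * u + b)).

Lemma integrable_gauss_cos s b x : 0 < s ->
  mu.-integrable setT (EFin \o (fun u => expR (- (s * u ^+ 2)) * cos (x * u + b))).
Proof.
move=> s0; apply: le_integrableR (integrable_gauss_scale s0).
  by apply: measurable_funM; [exact: mgauss|exact: mcosl].
by move=> u; rewrite normrM (ger0_norm (expR_ge0 _)) ler_piMr ?expR_ge0 ?cos_max.
Qed.

(** Half of the Gaussian absorbs the factor [|u|], as [e^z >= 1 + z]. *)
Let mul_gauss_le s u : 0 < s ->
  `|u| * expR (- (s * u ^+ 2)) <= Num.max 1 s^-1 * expR (- (s / 2 * u ^+ 2)).
Proof.
move=> s0.
rewrite (_ : - (s * u ^+ 2) = - (s / 2 * u ^+ 2) - (s / 2 * u ^+ 2)); last by lra.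
rewrite expRD mulrA ler_pM2r ?expR_gt0// expRN ler_pdivrMr ?expR_gt0//.
have e1 := expR_ge1Dx (s / 2 * u ^+ 2).
have u2 : u ^+ 2 = `|u| ^+ 2 by rewrite real_normK ?num_real.
have m1 : 1 <= Num.max 1 s^-1 :> R by rewrite le_max lexx.
have m2 : 1 <= s * Num.max 1 s^-1.
  by rewrite -ler_pdivrMl// mulr1 le_max lexx orbT.
apply: (@le_trans _ _ (Num.max 1 s^-1 * (1 + s / 2 * u ^+ 2))); last first.
  by rewrite ler_wpM2l//; lra.
rewrite u2; move: (normr_ge0 u); set w := `|u| => w0.
set m := Num.max _ _ in m1 m2 *.
have : 0 <= (w - 1) ^+ 2 by exact: sqr_ge0.
by nra.
Qed.

Let is_derive_F s b x : 0 < s -> is_derive x 1 (F s b) (- S s b x).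
Proof.
move=> s0.
pose f x u := expR (- (s * u ^+ 2)) * cos (x * u + b).
have df z u : is_derive z 1 (f ^~ u) (- (u * expR (- (s * u ^+ 2)) * sin (z * u + b))).
  have d1 : is_derive z 1 (fun z => z * u + b) u.
    rewrite (_ : (fun z => _) = (u \*: (@id R) + cst b)); last first.
      by apply/funext => y /=; rewrite [RHS]/GRing.add/= /GRing.scale/= mulrC.
    by apply: is_derive_eq; rewrite addr0 /GRing.scale/= mulr1.
  have := is_deriveZ (expR (- (s * u ^+ 2))) (is_derive1_comp (is_derive_cos _) d1).
  by rewrite (_ : _ *: _ = - (u * expR (- (s * u ^+ 2)) * sin (z * u + b)))// /GRing.scale/=; ring.
have d1f z u : partial1of2 f z u = - (u * expR (- (s * u ^+ 2)) * sin (z * u + b)).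
  by rewrite partial1of2E; have [] := df z u.
have xI : `]x - 1, x + 1[%classic x by rewrite /= in_itv/=; lra.
have intf z : `]x - 1, x + 1[%classic z -> mu.-integrable setT (EFin \o f z).
  by move=> _; exact: integrable_gauss_cos.
have derf z u : `]x - 1, x + 1[%classic z -> setT u -> derivable (f ^~ u) z 1.
  by move=> _ _; have [] := df z u.
pose G u := Num.max 1 s^-1 * expR (- (s / 2 * u ^+ 2)).
have M0 : 0 <= Num.max 1 s^-1 by rewrite le_max ler01.
have G0 u : 0 <= G u by rewrite mulr_ge0 ?expR_ge0.
have iG : mu.-integrable setT (EFin \o G).
  by apply: integrableRZl; apply: integrable_gauss_scale; rewrite divr_gt0.
have fG z u : `]x - 1, x + 1[%classic z -> setT u -> `|partial1of2 f z u| <= G u.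
  move=> _ _; rewrite d1f normrN !normrM (ger0_norm (expR_ge0 _)).
  apply: le_trans (mul_gauss_le u s0).
  by rewrite ler_piMr ?mulr_ge0 ?expR_ge0 ?sin_max.
have := derivable_under_integral measurableT xI intf derf G0 iG fG.
have := differentiation_under_integral measurableT xI intf derf G0 iG fG.
rewrite derive1E => DF dF; split => //.
rewrite [LHS]DF /S -mulN1r -RintegralZl//.
  by apply: eq_Rintegral => u _; rewrite d1f mulN1r.
apply: le_integrableR iG.
  apply: measurable_funM; last exact: msinl.
  by apply: measurable_funM => //; exact: mgauss.
move=> u; have := fG x u xI I; rewrite d1f normrN.
by [].
Qed.

(** Integration by parts: the integrand is the derivative of
    [e^(-su^2) sin (xu + b)]. It is obtained by differentiating with respect to
    [c] the integral of the translate by [c], which does not depend on [c]. *)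
Let ibp s b x : 0 < s ->
  \int[mu]_u (expR (- (s * u ^+ 2)) *
    (x * cos (x * u + b) - 2 * s * u * sin (x * u + b))) = 0.
Proof.
move=> s0.
pose f c u := expR (- (s * (u + c) ^+ 2)) * sin (x * (u + c) + b).
pose g v := expR (- (s * v ^+ 2)) * (x * cos (x * v + b) - 2 * s * v * sin (x * v + b)).
have df c u : is_derive c 1 (f ^~ u) (g (u + c)).
  have d0 : is_derive c 1 (fun c => u + c) 1.
    rewrite (_ : (fun _ => _) = (cst u + @id R)); last by [].
    by apply: is_derive_eq; rewrite add0r.
  have d1 : is_derive c 1 (fun c => x * (u + c) + b) x.
    have := is_deriveD (is_deriveZ x d0) (is_derive_cst b c 1).
    by rewrite addr0 /GRing.scale/= mulr1.
  have d2 : is_derive c 1 (fun c => - (s * (u + c) ^+ 2)) (- (2 * s * (u + c))).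
    have := is_deriveZ (- s) (is_deriveX 2 d0).
    rewrite (_ : _ *: _ = - (2 * s * (u + c))); last first.
      by rewrite /GRing.scale/=; ring.
    by rewrite (_ : _ \*: _ = (fun c => - (s * (u + c) ^+ 2)))//; apply/funext => z /=; rewrite [LHS]mulNr.
  have := is_deriveM (is_derive1_comp (is_derive_expR _) d2) (is_derive1_comp (is_derive_sin _) d1).
  rewrite (_ : _ *: _ + _ *: _ = g (u + c))// /g /GRing.scale/=; ring.
have d1f c u : partial1of2 f c u = g (u + c).
  by rewrite partial1of2E; have [] := df c u.
have xI : `]-1, 1[%classic (0 : R) by rewrite /= in_itv/=; lra.
have mf c : measurable_fun setT (f c).
  apply: measurable_funM.
    apply: measurableT_comp => //; apply: measurableT_comp => //.
    apply: measurable_funM => //; apply: measurable_funX.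
    exact: measurable_funD.
  apply: (measurableT_comp (f := @sin R)).
    by apply: continuous_measurable_fun; exact: continuous_sin.
  apply: measurable_funD => //; apply: measurable_funM => //.
  exact: measurable_funD.
pose K := (`|x| + 2 * s * Num.max 1 s^-1) * expR (s / 2).
(* by [(u + c)^2 = u^2/2 + (u + 2c)^2/2 - c^2], as [|c| < 1] *)
have e4 c u : `]-1, 1[%classic c ->
    expR (- (s / 2 * (u + c) ^+ 2)) <= expR (s / 2) * expR (- (s / 4 * u ^+ 2)).
  rewrite /= in_itv/= -expRD ler_expR => /andP[c1 c2].
  have c3 : c ^+ 2 <= 1 by nra.
  have : 0 <= (u + 2 * c) ^+ 2 by exact: sqr_ge0.
  have : 0 <= s / 4 * ((u + 2 * c) ^+ 2 + 2 * (1 - c ^+ 2)).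
    apply: mulr_ge0; first by rewrite divr_ge0// ltW.
    by apply: addr_ge0; [exact: sqr_ge0|apply: mulr_ge0; rewrite ?subr_ge0].
  nra.
pose G u := K * expR (- (s / 4 * u ^+ 2)).
have M0 : 0 <= Num.max 1 s^-1 by rewrite le_max ler01.
have s0' := ltW s0.
have A0 : 0 <= `|x| + 2 * s * Num.max 1 s^-1 by rewrite addr_ge0// !mulr_ge0.
have K0 : 0 <= K by rewrite mulr_ge0 ?expR_ge0.
have G0 u : 0 <= G u by rewrite mulr_ge0 ?expR_ge0.
have iG : mu.-integrable setT (EFin \o G).
  by apply: integrableRZl; apply: integrable_gauss_scale; rewrite divr_gt0.
have gG c u : `]-1, 1[%classic c -> `|g (u + c)| <= G u.
  move=> cI; rewrite /g; set v := u + c.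
  rewrite /G /K -mulrA.
  apply: (@le_trans _ _ ((`|x| + 2 * s * Num.max 1 s^-1) * expR (- (s / 2 * v ^+ 2)))).
    rewrite normrM (ger0_norm (expR_ge0 _)) mulrC.
    apply: (@le_trans _ _ ((`|x| + 2 * s * `|v|) * expR (- (s * v ^+ 2)))).
      rewrite ler_pM2r ?expR_gt0// (le_trans (ler_normB _ _))// lerD//.
        by rewrite normrM ler_piMr// cos_max.
      rewrite !normrM (ger0_norm (ler0n _ _)) (ger0_norm s0').
      by apply: ler_wpM2l; [rewrite mulr_ge0|rewrite ler_piMr ?sin_max].
    rewrite !(mulrDl `|x|) lerD//.
      by rewrite ler_wpM2l// ler_expR lerN2 ler_wpM2r ?sqr_ge0//; lra.
    by rewrite -!(mulrA (2 * s)); apply: ler_wpM2l; [rewrite mulr_ge0|exact: mul_gauss_le].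
  by rewrite -(mulrA (_ + _) (expR (s / 2))); apply: ler_wpM2l => //; exact: e4.
have fi c : `]-1, 1[%classic c -> mu.-integrable setT (EFin \o f c).
  move=> cI; have s40 : 0 < s / 4 by rewrite divr_gt0.
  apply: (le_integrableR _ _ (integrableRZl (expR (s / 2)) (integrable_gauss_scale s40))).
    exact: mf.
  move=> u; rewrite normrM (ger0_norm (expR_ge0 _)).
  apply: (@le_trans _ _ (expR (- (s * (u + c) ^+ 2)))).
    by rewrite ler_piMr ?expR_ge0 ?sin_max.
  by apply: le_trans (e4 _ _ cI); rewrite ler_expR lerN2 ler_wpM2r ?sqr_ge0//; lra.
have derf c u : `]-1, 1[%classic c -> setT u -> derivable (f ^~ u) c 1.
  by move=> _ _; have [] := df c u.
have fG c u : `]-1, 1[%classic c -> setT u -> `|partial1of2 f c u| <= G u.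
  by move=> cI _; rewrite d1f gG.
have := differentiation_under_integral measurableT xI fi derf G0 iG fG.
rewrite (_ : (fun _ => _) = cst (\int[mu]_u f 0 u)); last first.
  apply/funext => c /=; rewrite /Rintegral; congr fine.
  have mf0 : measurable_fun setT (EFin \o f 0) by apply/measurable_EFinP.
  rewrite -(integral_shift c mf0).
  by apply: eq_integral => u _ /=; rewrite /f !addr0.
rewrite derive1_cst => /esym <-.
by apply: eq_Rintegral => u _; rewrite d1f addr0.
Qed.

(** Let [F x] be the integral. Differentiating under the integral sign and
    integrating by parts gives [F' = - x / (2s) F], so that
    [F x * e^(x^2/(4s))] is constant. The phase [b] is kept so that the formula
    can be iterated over the coordinates. *)
Lemma integral_gauss_cos s b x : 0 < s ->
  (\int[mu]_u (expR (- (s * u ^+ 2)) * cos (x * u + b))%:E =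
   (cos b * (Num.sqrt (pi / s) * expR (- (x ^+ 2 / (4 * s)))))%:E)%E.
Proof.
move=> s0.
have <- : (F s b x)%:E = (\int[mu]_u (expR (- (s * u ^+ 2)) * cos (x * u + b))%:E)%E.
  by rewrite /F /Rintegral fineK//; apply: integrable_fin_num (integrable_gauss_cos b x s0).
congr EFin.
have F0 : F s b 0 = cos b * Num.sqrt (pi / s).
  rewrite /F; under eq_Rintegral do rewrite mul0r add0r mulrC.
  rewrite RintegralZl//; last exact: integrable_gauss_scale.
  by rewrite /Rintegral integral_gauss_scale.
have FS z : S s b z = z / (2 * s) * F s b z.
  have iF := integrable_gauss_cos b z s0.
  have iS : mu.-integrable setT
      (EFin \o (fun u => u * expR (- (s * u ^+ 2)) * sin (z * u + b))).
    have s20 : 0 < s / 2 by rewrite divr_gt0.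
    apply: (le_integrableR _ _ (integrableRZl (Num.max 1 s^-1) (integrable_gauss_scale s20))).
      apply: measurable_funM; last exact: msinl.
      by apply: measurable_funM => //; exact: mgauss.
    move=> u; rewrite !normrM (ger0_norm (expR_ge0 _)).
    apply: le_trans (mul_gauss_le u s0).
    by rewrite ler_piMr ?mulr_ge0 ?expR_ge0 ?sin_max.
  have := ibp b z s0.
  rewrite (_ : (fun u => _) = (fun u => z * (expR (- (s * u ^+ 2)) * cos (z * u + b)) -
     2 * s * (u * expR (- (s * u ^+ 2)) * sin (z * u + b)))); last first.
    by apply/funext => u; ring.
  rewrite RintegralB//; [|exact: integrableRZl|exact: integrableRZl].
  rewrite !RintegralZl// -/(F s b z) -/(S s b z) => /eqP.
  rewrite subr_eq0 => /eqP E; apply: (@mulfI _ (2 * s)); first by rewrite gt_eqF ?mulr_gt0.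
  by rewrite -E; field; rewrite gt_eqF.
pose H z := F s b z * expR (z ^+ 2 / (4 * s)).
have dH z : is_derive z 1 H 0.
  have d1 : is_derive z 1 (fun z => z ^+ 2 / (4 * s)) (z / (2 * s)).
    have := is_deriveZ (4 * s)^-1 (is_deriveX 2 (is_derive_id z 1)).
    rewrite (_ : _ *: _ = z / (2 * s)); last first.
      by rewrite /GRing.scale/=; field; rewrite gt_eqF.
    rewrite (_ : _ \*: _ = (fun z => z ^+ 2 / (4 * s)))//.
    by apply/funext => y /=; rewrite [LHS]mulrC.
  have := is_deriveM (is_derive_F b z s0) (is_derive1_comp (is_derive_expR _) d1).
  rewrite (_ : _ + _ = 0)// /GRing.scale/= FS; ring.
have : H x = H 0 by exact: is_derive_0_is_cst.
rewrite /H F0 expr0n mul0r expR0 mulr1 => /(congr1 ( *%R^~ (expR (- (x ^+ 2 / (4 * s)))))).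
by rewrite -(mulrA (F s b x)) -expRD subrr expR0 mulr1 mulrA.
Qed.
End gauss_line.

(** * Integration over R^n *)

Section measurable_rV_continuous.
Context {R : realType} {n : nat}.
Local Notation V := 'rV[R]_n.

(** Every open set is a countable union of cubes with rational centres, and
    cubes are measurable for the sigma-algebra generated by the coordinates. *)
Lemma open_measurable_rV (U : set V) : open U -> measurable U.
Proof.
move=> oU.
pose B (p : 'rV[rat]_n * nat) : set V :=
  [set y | forall i, ball (ratr (p.1 ord0 i) : R) (p.2.+1%:R^-1) (y ord0 i)].
pose F p := if `[< B p `<=` U >] then B p else set0.
have mB p : measurable (B p).
  rewrite (_ : B p = \bigcap_(i in [set: 'I_n]) (fun v : V => v ord0 i) @^-1`
      ball (ratr (p.1 ord0 i) : R) (p.2.+1%:R^-1)); last first.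
    by apply/seteqP; split => v /= h i; [move=> _|]; exact: h.
  apply: fin_bigcap_measurable; first exact: finite_finset.
  move=> i _; rewrite -[X in measurable X]setTI; apply: measurable_coord => //.
  exact: measurable_ball.
suff -> : U = \bigcup_p F p.
  apply: countable_bigcupT_measurable; first exact: countableP.
  by move=> p; rewrite /F; case: ifP.
apply/seteqP; split => [x Ux|x [p _]]; last first.
  by rewrite /F; case: ifPn => // /asboolP; apply.
have /nbhs_ballP[e /= e0 xeU] : nbhs x U by exact: open_nbhs_nbhs.
have e20 : 0 < e / 2 by rewrite divr_gt0.
pose k := Num.truncn (e / 2)^-1.
have k0 : (0 : R) < k.+1%:R^-1 by rewrite invr_gt0 ltr0n.
have ke : k.+1%:R^-1 <= e / 2.
  rewrite invf_ple ?posrE ?ltr0n//.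
  have ie : 0 <= (e / 2)^-1 by rewrite invr_ge0 ltW.
  by have /andP[_ /ltW] := truncn_itv ie.
have [d dE] : exists d : R, d = k.+1%:R^-1 by exists k.+1%:R^-1.
rewrite -dE in k0 ke.
have qP i : exists q : rat, ball (ratr q : R) d (x ord0 i).
  have /rat_in_itvoo[q] : x ord0 i - d < x ord0 i + d by lra.
  rewrite in_itv/= => /andP[q1 q2]; exists q.
  by rewrite /ball/= ltr_distl; apply/andP; split; lra.
have /choice[q qx] := qP.
have Bx : B (\row_i q i, k) x by move=> i /=; rewrite mxE -dE.
exists (\row_i q i, k) => //; rewrite /F asboolT// => y By.
apply: xeU; split => // i j; rewrite !ord1.
have := By j; have := Bx j; rewrite /= -dE /ball/= => h1 h2.
rewrite (_ : x ord0 j - y ord0 j = (ratr ((\row_i q i) ord0 j) - y ord0 j) -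
  (ratr ((\row_i q i) ord0 j) - x ord0 j)); last by ring.
by rewrite (le_lt_trans (ler_normB _ _))//; lra.
Qed.

Lemma continuous_measurable_rV (f : V -> R) : continuous f -> measurable_fun setT f.
Proof.
move=> /continuousP cf; apply: (measurability _ (RGenOpens.measurableE R)).
move=> _ [_ [a [b ->] <-]]; rewrite setTI; apply: open_measurable_rV.
exact/cf/interval_open.
Qed.

End measurable_rV_continuous.

Section squared_norm.
Context {R : realType}.

Definition sqn n (x : 'rV[R]_n) : R := \sum_i x ord0 i ^+ 2.

Lemma sqn_ge0 n (x : 'rV[R]_n) : 0 <= sqn x.
Proof. by apply: sumr_ge0 => i _; exact: sqr_ge0. Qed.

Lemma sqn_eq0 n (x : 'rV[R]_n) : (sqn x == 0) = (x == 0).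
Proof.
rewrite psumr_eq0; last by move=> i _; exact: sqr_ge0.
apply/allP/eqP => [h|-> i _]; last by rewrite mxE expr0n eqxx.
apply/rowP => i; rewrite mxE; apply/eqP; rewrite -sqrf_eq0.
by apply: h; rewrite mem_index_enum.
Qed.

Lemma sqn_gt0 n (x : 'rV[R]_n) : x != 0 -> 0 < sqn x.
Proof. by move=> x0; rewrite lt_neqAle sqn_ge0 andbT eq_sym sqn_eq0. Qed.

Lemma enorm_sqn n (x : 'rV[R]_n) : enorm x ^+ 2 = sqn x.
Proof. by rewrite sqr_sqrtr// sqn_ge0. Qed.

Lemma enorm_ge0 n (x : 'rV[R]_n) : 0 <= enorm x.
Proof. exact: sqrtr_ge0. Qed.

Lemma enorm_gt0 n (x : 'rV[R]_n) : x != 0 -> 0 < enorm x.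
Proof. by move=> x0; rewrite sqrtr_gt0; exact: sqn_gt0. Qed.

(** At the origin both sides are [0], since [powR 0 a = 0] for [a != 0]. *)
Lemma enorm_powR n (x : 'rV[R]_n) a : a != 0 -> enorm x `^ (2 * a) = tpow a (sqn x).
Proof.
move=> a0; rewrite powRrM powR_mulrn ?enorm_ge0// enorm_sqn /tpow.
case: ifPn => //; rewrite -leNgt => q0.
have -> : sqn x = 0 by apply/eqP; rewrite eq_le q0 sqn_ge0.
by rewrite powR0.
Qed.

Lemma measurable_sqn n : measurable_fun setT (@sqn n).
Proof.
apply: measurable_sum => i; apply: measurable_funX; exact: measurable_coord.
Qed.

Lemma sqn_cons n (a : R) (v : 'rV[R]_n) : sqn (cons_rV (a, v)) = a ^+ 2 + sqn v.
Proof.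
rewrite /sqn big_ord_recl cons_rV0; congr (_ + _).
by apply: eq_bigr => i _; rewrite cons_rVS.
Qed.

Lemma dot_cons n (x : 'rV[R]_n.+1) (a : R) (v : 'rV[R]_n) :
  dot x (cons_rV (a, v)) = x ord0 ord0 * a + dot (uncons_rV x).2 v.
Proof.
rewrite /dot big_ord_recl cons_rV0; congr (_ + _).
by apply: eq_bigr => i _; rewrite cons_rVS mxE.
Qed.

Lemma sqn_uncons n (x : 'rV[R]_n.+1) : sqn x = x ord0 ord0 ^+ 2 + sqn (uncons_rV x).2.
Proof.
rewrite /sqn big_ord_recl; congr (_ + _).
by apply: eq_bigr => i _; rewrite mxE.
Qed.

End squared_norm.

Section integral_rV.
Context {R : realType}.
Local Notation mu := (@lebesgue_measure R).
Local Open Scope ereal_scope.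

Let mcons n : {measure set 'rV[R]_n.+1 -> \bar R} :=
  measure_function_pushforward__canonical__measure_function_Measure
    (lebesgue_measure \x @lebesgue_rV R n) (@measurable_cons_rV R n).

Let integral_mcons n (f : 'rV[R]_n.+1 -> \bar R) :
  \int[lebesgue_rV]_x f x = \int[@mcons n]_x f x.
Proof. exact: eq_measure_integral. Qed.

Lemma ge0_integral_rVS n (f : 'rV[R]_n.+1 -> R) : measurable_fun setT f ->
  (forall x, 0 <= f x)%R ->
  \int[lebesgue_rV]_x (f x)%:E =
  \int[mu]_a \int[lebesgue_rV]_(v in [set: 'rV[R]_n]) (f (cons_rV (a, v)))%:E.
Proof.
move=> mf f0; have mfE : measurable_fun setT (EFin \o f) by exact/measurable_EFinP.
transitivity (\int[lebesgue_measure \x @lebesgue_rV R n]_z (f (cons_rV z))%:E).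
  rewrite integral_mcons ge0_integral_pushforward//; first exact: measurable_cons_rV.
  by move=> y _; rewrite lee_fin.
rewrite fubini_tonelli1//.
  by apply: (measurableT_comp mfE); exact: measurable_cons_rV.
by move=> x; rewrite lee_fin.
Qed.

Lemma integral_rVS n (f : 'rV[R]_n.+1 -> R) : lebesgue_rV.-integrable setT (EFin \o f) ->
  \int[lebesgue_rV]_x (f x)%:E =
  \int[mu]_a \int[lebesgue_rV]_(v in [set: 'rV[R]_n]) (f (cons_rV (a, v)))%:E.
Proof.
move=> /integrableP[mf foo].
pose m2 := (lebesgue_measure \x @lebesgue_rV R n).
have ifc : m2.-integrable setT ((EFin \o f) \o @cons_rV R n).
  apply/integrableP; split.
    by apply: (measurableT_comp mf); exact: measurable_cons_rV.
  apply: le_lt_trans foo.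
  rewrite [leRHS](_ : _ = \int[m2]_z `|f (cons_rV z)|%:E)//.
  rewrite integral_mcons ge0_integral_pushforward//; first exact: measurable_cons_rV.
  exact: (measurableT_comp _ mf).
transitivity (\int[m2]_z (f (cons_rV z))%:E).
  by rewrite integral_mcons integral_pushforward//; exact: measurable_cons_rV.
by rewrite -(integral12_prod_meas1 ifc).
Qed.

Lemma measurable_shift_rV n (w : 'rV[R]_n) : measurable_fun setT (fun v : 'rV[R]_n => (v + w)%R).
Proof.
apply: measurable_fun_rVP => i.
rewrite (_ : (fun _ => _) = (fun v : 'rV[R]_n => (v ord0 i + w ord0 i)%R)); last first.
  by apply/funext => v; rewrite mxE.
by apply: measurable_funD => //; exact: measurable_coord.
Qed.

Lemma ge0_integral_shift_rV n (w : 'rV[R]_n) (f : 'rV[R]_n -> R) :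
  measurable_fun setT f -> (forall x, 0 <= f x)%R ->
  \int[lebesgue_rV]_x (f (x + w)%R)%:E = \int[lebesgue_rV]_x (f x)%:E.
Proof.
elim: n => [|n IH] in w f *.
  move=> mf f0; apply: eq_integral => x _; congr (f _)%:E.
  by apply/rowP => -[].
move=> mf f0.
have mfw : measurable_fun setT (fun x : 'rV[R]_n.+1 => f (x + w)%R).
  by apply: (measurableT_comp mf); exact: measurable_shift_rV.
rewrite (ge0_integral_rVS mfw (fun x => f0 _)) (ge0_integral_rVS mf f0).
pose h (a : R) := \int[lebesgue_rV]_(v in [set: 'rV[R]_n]) (f (cons_rV (a, v)))%:E.
have mh : measurable_fun setT h.
  apply: (measurable_fun_fubini_tonelli_F (fun z => (f (cons_rV z))%:E)).
    apply/measurable_EFinP; apply: (measurableT_comp mf).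
    exact: measurable_cons_rV.
  by move=> z; rewrite lee_fin.
rewrite -[RHS](integral_shift (w ord0 ord0) mh).
apply: eq_integral => a _; rewrite /h.
rewrite -[RHS](IH (uncons_rV w).2); last 2 first.
- apply: (measurableT_comp mf).
  apply: (measurableT_comp (f := @cons_rV R n) (g := fun v => (a + w ord0 ord0, v))%R).
    exact: measurable_cons_rV.
  exact: measurable_pair1.
- by move=> x.
apply: eq_integral => v _; congr (f _)%:E.
apply/rowP => i; rewrite mxE; case: (unliftP ord0 i) => [j|] ->.
  by rewrite !cons_rVS !mxE.
by rewrite !cons_rV0.
Qed.

Lemma integral_shift_rV n (w : 'rV[R]_n) (f : 'rV[R]_n -> R) :
  measurable_fun setT f ->
  \int[lebesgue_rV]_x (f (x + w)%R)%:E = \int[lebesgue_rV]_x (f x)%:E.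
Proof.
move=> mf; rewrite [LHS]integralE [RHS]integralE; congr (_ - _).
- under [RHS]eq_integral do rewrite funeposE -EFin_max.
  rewrite -[RHS](ge0_integral_shift_rV w); last 2 first.
  + exact: measurable_maxr.
  + by move=> x; rewrite le_max lexx orbT.
  by apply: eq_integral => x _; rewrite funeposE -EFin_max.
- under [RHS]eq_integral do rewrite funenegE -EFinN -EFin_max.
  rewrite -[RHS](ge0_integral_shift_rV w); last 2 first.
  + by apply: measurable_maxr => //; exact: measurable_funN.
  + by move=> x; rewrite le_max lexx orbT.
  by apply: eq_integral => x _; rewrite funenegE -EFinN -EFin_max.
Qed.

Lemma lebesgue_rV_set0 n : (0 < n)%N -> lebesgue_rV [set 0%R : 'rV[R]_n] = 0.
Proof.
move=> n0.
rewrite (_ : [set 0%R] = [set v : 'rV[R]_n | forall i, [set 0%R] (v ord0 i)]); last first.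
  apply/seteqP; split => v /=; first by move=> -> i; rewrite mxE.
  by move=> h; apply/rowP => i; rewrite mxE h.
rewrite (lebesgue_rV_box (A := fun=> [set 0%R]))//.
case: n n0 => // n _; rewrite big_ord_recl.
by rewrite [X in X * _](@lebesgue_measure_set1 R 0%R) mul0e.
Qed.

(** The origin is a null set in positive dimension; kernels are compared off the
    origin only. *)
Lemma eq_integral_rV n (f g : 'rV[R]_n -> \bar R) : (0 < n)%N ->
  measurable_fun setT f -> measurable_fun setT g ->
  (forall x, x != 0%R -> f x = g x) ->
  \int[lebesgue_rV]_x f x = \int[lebesgue_rV]_x g x.
Proof.
move=> n0 mf mg fg; apply: ae_eq_integral => //.
exists [set 0%R]; split.
- rewrite -[X in measurable X]setCK; apply: measurableC; apply: open_measurable_rV.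
  apply: closed_openC; apply: compact_closed; first exact: norm_hausdorff.
  exact: compact_set1.
- exact: lebesgue_rV_set0.
- move=> x /= h; apply/eqP; apply: contrapT => /negP x0; apply: h => _.
  by rewrite fg.
Qed.

Local Close Scope ereal_scope.

Let measurable_expsqn n s :
  measurable_fun setT (fun x : 'rV[R]_n => expR (- (s * sqn x))).
Proof.
apply: measurableT_comp => //; apply: measurableT_comp => //.
by apply: measurable_funM => //; exact: measurable_sqn.
Qed.

Lemma integral_gauss_rV n s : 0 < s ->
  (\int[@lebesgue_rV R n]_x (expR (- (s * sqn x)))%:E = (Num.sqrt (pi / s) ^+ n)%:E)%E.
Proof.
move=> s0; elim: n => [|n IH].
  rewrite integral_dirac//; last by apply/measurable_EFinP; exact: measurable_expsqn.
  by rewrite diracE mem_set// mul1e /sqn big_ord0 mulr0 oppr0 expR0 expr0.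
rewrite ge0_integral_rVS; [|exact: measurable_expsqn|by move=> x; exact: expR_ge0].
transitivity (\int[mu]_a (Num.sqrt (pi / s) ^+ n * expR (- (s * a ^+ 2)))%:E)%E.
  apply: eq_integral => a _.
  under eq_integral do rewrite sqn_cons mulrDr opprD expRD.
  rewrite (ge0_integralZlR _ (expR_ge0 _) (@measurable_expsqn n s) (fun x => expR_ge0 _)).
  by rewrite IH -EFinM mulrC.
rewrite ge0_integralZlR.
- by rewrite integral_gauss_scale// -EFinM exprSr.
- by rewrite exprn_ge0.
- apply: measurableT_comp => //; apply: measurableT_comp => //.
  by apply: measurable_funM => //; exact: measurable_funX.
- by move=> x; exact: expR_ge0.
Qed.

Lemma integrable_gauss_rV n s : 0 < s ->
  (@lebesgue_rV R n).-integrable setT (EFin \o (fun x => expR (- (s * sqn x)))).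
Proof.
move=> s0; apply: ge0_integrable; first exact: measurable_expsqn.
  by move=> x; exact: expR_ge0.
by rewrite integral_gauss_rV// ltry.
Qed.

Lemma measurable_dot n (y : 'rV[R]_n) : measurable_fun setT (dot y).
Proof.
by apply: measurable_sum => i; apply: measurable_funM => //; exact: measurable_coord.
Qed.

Lemma measurable_cos_dot n (y : 'rV[R]_n) b :
  measurable_fun setT (fun x : 'rV[R]_n => cos (dot y x + b)).
Proof.
apply: (measurableT_comp (f := @cos R)).
  by apply: continuous_measurable_fun; exact: continuous_cos.
by apply: measurable_funD => //; exact: measurable_dot.
Qed.

Lemma integrable_gauss_cos_rV n s (y : 'rV[R]_n) b : 0 < s ->
  (@lebesgue_rV R n).-integrable setT
    (EFin \o (fun x => expR (- (s * sqn x)) * cos (dot y x + b))).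
Proof.
move=> s0; apply: le_integrableR (integrable_gauss_rV n s0).
  by apply: measurable_funM; [exact: measurable_expsqn|exact: measurable_cos_dot].
by move=> u; rewrite normrM (ger0_norm (expR_ge0 _)) ler_piMr ?expR_ge0 ?cos_max.
Qed.

(** The phase [b] absorbs the coordinates that are frozen when the integral is
    computed one coordinate at a time. *)
Lemma integral_gauss_cos_rV n s (y : 'rV[R]_n) b : 0 < s ->
  (\int[@lebesgue_rV R n]_x (expR (- (s * sqn x)) * cos (dot y x + b))%:E =
   (cos b * (Num.sqrt (pi / s) ^+ n * expR (- (sqn y / (4 * s)))))%:E)%E.
Proof.
move=> s0; elim: n => [|n IH] in y b *.
  rewrite integral_dirac//; last first.
    apply/measurable_EFinP; apply: measurable_funM; first exact: measurable_expsqn.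
    exact: measurable_cos_dot.
  rewrite diracE mem_set// mul1e /sqn /dot !big_ord0 mulr0 mul0r !oppr0 expR0 expr0.
  by rewrite add0r !mul1r !mulr1.
rewrite integral_rVS; last exact: integrable_gauss_cos_rV.
pose k := Num.sqrt (pi / s) ^+ n * expR (- (sqn (uncons_rV y).2 / (4 * s))).
transitivity (\int[mu]_a (k%:E *
    (expR (- (s * a ^+ 2)) * cos (y ord0 ord0 * a + b))%:E))%E.
  apply: eq_integral => a _.
  transitivity (\int[lebesgue_rV]_(v in [set: 'rV[R]_n]) ((expR (- (s * a ^+ 2)))%:E *
     (expR (- (s * sqn v)) * cos (dot (uncons_rV y).2 v + (y ord0 ord0 * a + b)))%:E))%E.
    apply: eq_integral => v _; rewrite -EFinM sqn_cons dot_cons mulrDr opprD expRD.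
    by rewrite -mulrA; congr (_ * (_ * cos _))%:E; ring.
  rewrite integralZl//; last exact: integrable_gauss_cos_rV.
  by rewrite IH -!EFinM /k; congr EFin; ring.
rewrite integralZl//; last exact: integrable_gauss_cos.
rewrite integral_gauss_cos// -EFinM /k sqn_uncons; congr EFin.
set A := y ord0 ord0 ^+ 2; set B := sqn _.
rewrite (_ : - ((A + B) / (4 * s)) = - (A / (4 * s)) + - (B / (4 * s))).
  by rewrite expRD exprS; ring.
by rewrite mulrDl opprD.
Qed.

(** ** Radial integrals, computed by writing powers as Laplace transforms *)

Section radial.
Context (n : nat).
Local Notation leb := (@lebesgue_rV R n).
Local Notation h := (n%:R / 2 : R).
Implicit Types (a b c s : R).

Lemma integral_gauss_rV_powR s : 0 < s ->
  (\int[leb]_x (expR (- (s * sqn x)))%:E = (pi `^ h * s `^ (- h))%:E)%E.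
Proof.
move=> s0; rewrite integral_gauss_rV//; congr EFin.
rewrite -powR_mulrn ?sqrtr_ge0// -powR12_sqrt ?divr_ge0 ?pi_ge0 ?ltW//.
rewrite -powRrM powRM ?pi_ge0 ?invr_ge0 ?ltW// (mulrC 2^-1).
by rewrite -(powR_inv1 (ltW s0)) -powRrM mulN1r.
Qed.

(** A radial function which is a superposition of Gaussians of exponents [w s] with
    weights [k s] is integrated Gaussian by Gaussian. *)
Let tonelli_gauss (k w : R -> R) : measurable_fun setT k -> measurable_fun setT w ->
  (forall s, 0 <= k s) -> (forall s, k s != 0 -> 0 < w s) ->
  (\int[leb]_x \int[mu]_s (k s * expR (- (w s * sqn x)))%:E =
   \int[mu]_s (pi `^ h * (k s * w s `^ (- h)))%:E)%E.
Proof.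
move=> mk mw k0 kw.
pose f (x : 'rV[R]_n) (s : R) := k s * expR (- (w s * sqn x)).
have mf : measurable_fun setT (fun z : 'rV[R]_n * measurableTypeR R => f z.1 z.2).
  apply: measurable_funM; first exact: (measurableT_comp mk).
  apply: measurableT_comp => //; apply: measurableT_comp => //.
  apply: measurable_funM; first exact: (measurableT_comp mw).
  exact: (measurableT_comp (@measurable_sqn R n)).
rewrite (tonelliR leb mu mf); last by move=> x s; rewrite mulr_ge0 ?expR_ge0.
apply: eq_integral => s _; rewrite /f; have [ks|/kw ws] := eqVneq (k s) 0.
  by rewrite ks mul0r mulr0 integral0_eq// => x _; rewrite mul0r.
rewrite (ge0_integralZlR _ (k0 s) (@measurable_expsqn n (w s)) (fun x => expR_ge0 _)).
by rewrite integral_gauss_rV_powR// -EFinM mulrCA.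
Qed.

Lemma measurable_tpow_sqn a : measurable_fun setT (fun x : 'rV[R]_n => tpow a (sqn x)).
Proof. exact: (measurableT_comp (measurable_tpow a) (@measurable_sqn R n)). Qed.

(** Writing [|x|^(-2a)] as a Laplace transform turns a radial integral into an
    integral of Gaussians; the origin has to be discarded. *)
Let integral_tpow_laplace a (c : R) : (0 < n)%N -> 0 < a ->
  (forall s, 0 < s -> 0 < s + c) ->
  ((Gamma a)%:E * \int[leb]_x (tpow (- a) (sqn x) * expR (- (c * sqn x)))%:E =
   \int[mu]_s (pi `^ h * (tpow (a - 1) s * (s + c) `^ (- h)))%:E)%E.
Proof.
move=> n0 a0 c0; have Ga0 := Gamma_gt0 a0.
have mF : measurable_fun setT
    (fun x : 'rV[R]_n => tpow (- a) (sqn x) * expR (- (c * sqn x))).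
  by apply: measurable_funM; [exact: measurable_tpow_sqn|exact: measurable_expsqn].
have F0 (x : 'rV[R]_n) : 0 <= tpow (- a) (sqn x) * expR (- (c * sqn x)).
  by rewrite mulr_ge0 ?tpow_ge0 ?expR_ge0.
have mw : measurable_fun setT (fun s : R => s + c) by exact: measurable_funD.
rewrite -(@tonelli_gauss (tpow (a - 1)) (fun s => s + c) (measurable_tpow _) mw); last 2 first.
- by move=> s; exact: tpow_ge0.
- by move=> s; have [s0|s0 _] := leP s 0; [rewrite tpow_le0 ?eqxx|exact: c0].
rewrite -(ge0_integralZlR _ (ltW Ga0) mF F0).
apply: eq_integral_rV => //.
- by apply/measurable_EFinP; exact: measurable_funM.
- apply: (measurable_fun_fubini_tonelli_F
    (fun z : 'rV[R]_n * measurableTypeR R =>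
      (tpow (a - 1) z.2 * expR (- ((z.2 + c) * sqn z.1)))%:E)).
    apply/measurable_EFinP; apply: measurable_funM.
      exact: (measurableT_comp (measurable_tpow _)).
    apply: measurableT_comp => //; apply: measurableT_comp => //.
    apply: measurable_funM; first exact: (measurableT_comp mw).
    exact: (measurableT_comp (@measurable_sqn R n)).
  by move=> z; rewrite lee_fin mulr_ge0 ?tpow_ge0 ?expR_ge0.
move=> x x0; have q0 := sqn_gt0 x0.
transitivity (\int[mu]_s (expR (- (c * sqn x)) *
    (tpow (a - 1) s * expR (- (sqn x * s))))%:E)%E; last first.
  apply: eq_integral => s _; congr EFin.
  by rewrite mulrDl opprD expRD (mulrC s); ring.
rewrite ge0_integralZlR.
- by rewrite integral_tpow_expR_Gamma// -EFinM tpowE//; congr EFin; ring.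
- exact: expR_ge0.
- apply: measurable_funM; first exact: measurable_tpow.
  by apply: measurableT_comp => //; apply: measurableT_comp => //; exact: measurable_funM.
- by move=> s; rewrite mulr_ge0 ?tpow_ge0 ?expR_ge0.
Qed.

Let mule_inv (k c : R) (I : \bar R) : k != 0 -> (k%:E * I = c%:E -> I = (k^-1 * c)%:E)%E.
Proof.
move=> k0 /(congr1 (fun z : \bar R => k^-1%:E * z)%E).
by rewrite muleA -!EFinM mulVf// mul1e.
Qed.

Lemma integral_tpow_gauss_rV a : (0 < n)%N -> 0 < a < h ->
  (\int[leb]_x (tpow (- a) (sqn x) * expR (- sqn x))%:E =
   (pi `^ h * Gamma (h - a) / Gamma h)%:E)%E.
Proof.
move=> n0 /andP[a0 ah]; have h0 : 0 < h by exact: lt_trans ah.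
have Ga0 := Gamma_gt0 a0; have Gh0 := Gamma_gt0 h0.
have c0 (s : R) : 0 < s -> 0 < s + 1 by move=> s0; exact: ltr_wpDr.
have mB : measurable_fun setT (fun s : R => tpow (a - 1) s * (s + 1) `^ (- h)).
  apply: measurable_funM; first exact: measurable_tpow.
  apply: (measurableT_comp (f := fun s : R => s `^ (- h)) (g := fun s : R => s + 1)).
    exact: measurable_powR.
  exact: measurable_funD.
have B0 (s : R) : 0 <= tpow (a - 1) s * (s + 1) `^ (- h).
  by rewrite mulr_ge0 ?tpow_ge0 ?powR_ge0.
have := integral_tpow_laplace n0 a0 c0.
under eq_integral do rewrite mul1r.
rewrite (ge0_integralZlR mu (powR_ge0 pi h) mB B0).
have -> : (\int[mu]_s (tpow (a - 1) s * (s + 1) `^ (- h))%:E =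
    ((Gamma h)^-1 * (Gamma a * Gamma (h - a)))%:E)%E.
  apply: mule_inv; rewrite ?(gt_eqF Gh0)//.
  have ahI : 0 < a < h by rewrite a0.
  rewrite -(ge0_integralZlR mu (ltW Gh0) mB B0) -(beta_integral ahI).
  by apply: eq_integral => s _; rewrite (addrC s).
rewrite -EFinM => /(mule_inv (lt0r_neq0 Ga0)) ->; congr EFin.
have alg (x y z p : R) : x != 0 -> y != 0 ->
    x^-1 * (p * (y^-1 * (x * z))) = p * z / y by move=> x0 y0; field; rewrite x0 y0.
exact: alg (lt0r_neq0 Ga0) (lt0r_neq0 Gh0).
Qed.

(** The dilation by [2] multiplies this integral by [2^(-b)], and it is not [0]. *)
Let integral_tpow_line b : 0 < b -> (\int[mu]_s (tpow (- b - 1) s)%:E = +oo)%E.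
Proof.
move=> b0; set I := (LHS).
have m1 : measurable_fun setT (fun s : R => (tpow (- b - 1) s)%:E).
  by apply/measurable_EFinP; exact: measurable_tpow.
have p1 s : (0 <= (tpow (- b - 1) s)%:E)%E by rewrite lee_fin tpow_ge0.
have I0 : (0 < I)%E.
  apply: (@lt_le_trans _ _ (Gamma b * 1 `^ (- b))%:E).
    by rewrite lte_fin powR1 mulr1 Gamma_gt0.
  rewrite -integral_tpow_expR_inv//; apply: ge0_le_integral => //.
  - by move=> s _; rewrite lee_fin mulr_ge0 ?tpow_ge0 ?expR_ge0.
  - apply/measurable_EFinP; apply: measurable_funM; first exact: measurable_tpow.
    apply: measurableT_comp => //; apply: measurableT_comp => //.
    by apply: measurable_funM => //; exact: measurable_tpow.
  - move=> s _; rewrite lee_fin ler_piMr ?tpow_ge0// -[leRHS]expR0 ler_expR oppr_le0.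
    by rewrite mul1r tpow_ge0.
have : (I = (2 `^ (- b))%:E * I)%E.
  rewrite {1}/I (ge0_integral_affine 0 (ltr0Sn R 1) m1 p1).
  under eq_integral do rewrite addr0 tpowM//.
  rewrite (ge0_integralZlR mu (powR_ge0 2 _) (measurable_tpow (- b - 1)) (tpow_ge0 (- b - 1))).
  rewrite muleA -EFinM; congr (_%:E * _)%E.
  rewrite -[X in X * _](@powRr1 _ 2)// -powRD ?pnatr_eq0 ?implybT//.
  by congr (_ `^ _); lra.
case: I I0 => [r| |]//; rewrite lte_fin -EFinM => r0 [] E.
have : 2 `^ (- b) = 1.
  by apply: (mulIf (lt0r_neq0 r0)); rewrite -E mul1r.
rewrite powRN => /eqP; rewrite invr_eq1 => /eqP E2.
have : 1 `^ b < 2 `^ b :> R by rewrite gt0_ltr_powR ?nnegrE// ltr1n.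
by rewrite powR1 E2 ltxx.
Qed.

Lemma integral_tpow_rV a : (0 < n)%N -> 0 < a < h ->
  (\int[leb]_x (tpow (- a) (sqn x))%:E = +oo)%E.
Proof.
move=> n0 /andP[a0 ah]; have Ga0 := Gamma_gt0 a0.
have c0 (s : R) : 0 < s -> 0 < s + 0 by rewrite addr0.
have := integral_tpow_laplace n0 a0 c0.
under eq_integral do rewrite mul0r oppr0 expR0 mulr1.
rewrite (_ : (\int[mu]_s _)%E = +oo%E).
  set I := (\int[leb]_x _)%E.
  have : (0 <= I)%E by apply: integral_ge0 => x _; rewrite lee_fin tpow_ge0.
  by case: I.
have mB : measurable_fun setT (fun s : R => tpow (a - 1) s * (s + 0) `^ (- h)).
  apply: measurable_funM; first exact: measurable_tpow.
  by under eq_fun do rewrite addr0; exact: measurable_powR.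
have B0 (s : R) : 0 <= tpow (a - 1) s * (s + 0) `^ (- h).
  by rewrite mulr_ge0 ?tpow_ge0 ?powR_ge0.
rewrite (ge0_integralZlR mu (powR_ge0 pi h) mB B0).
have E s : tpow (a - 1) s * (s + 0) `^ (- h) = tpow (- (h - a) - 1) s.
  rewrite addr0; have [s0|s0] := leP s 0; first by rewrite !tpow_le0 ?mul0r.
  by rewrite -(tpowE _ s0) -tpowD; congr (tpow _ _); lra.
under eq_integral do rewrite E.
by rewrite integral_tpow_line ?subr_gt0// gt0_muley// lte_fin powR_gt0 ?pi_gt0.
Qed.

(** Here [(1 + |x|^2)^(-c)] is the superposition of [e^(-s(1 + |x|^2))] with weight
    [s^(c-1) / Gamma c]. *)
Let integral_japanese c : 0 < h < c ->
  (\int[leb]_x (Gamma c * (1 + sqn x) `^ (- c))%:E = (pi `^ h * Gamma (c - h))%:E)%E.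
Proof.
move=> /andP[h0 hc]; have c0 : 0 < c by exact: lt_trans hc.
pose k (s : R) := tpow (c - 1) s * expR (- s).
have k0 s : 0 <= k s by rewrite mulr_ge0 ?tpow_ge0 ?expR_ge0.
have mk : measurable_fun setT k by exact: measurable_gamma_integrand.
have kw s : k s != 0 -> 0 < s.
  by have [s0|//] := leP s 0; rewrite /k tpow_le0// mul0r eqxx.
transitivity (\int[leb]_x \int[mu]_s (k s * expR (- (s * sqn x)))%:E)%E.
  apply: eq_integral => x _.
  have q0 : 0 < 1 + sqn x by rewrite ltr_wpDr ?sqn_ge0.
  rewrite -(integral_tpow_expR_Gamma c0 q0).
  by apply: eq_integral => s _; rewrite /k mulrDl opprD expRD mul1r mulrA (mulrC s).
rewrite (@tonelli_gauss k id mk (@measurable_id _ _ _) k0 kw).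
rewrite ge0_integralZlR.
- have E s : k s * s `^ (- h) = tpow (c - h - 1) s * expR (- s).
    rewrite /k; have [s0|s0] := leP s 0; first by rewrite !tpow_le0 ?mul0r.
    by rewrite -(tpowE _ s0) mulrAC -tpowD; congr (tpow _ _ * _); lra.
  under eq_integral do rewrite E.
  by rewrite -[X in (_ * X)%E]/(gammaE (c - h)) gammaE_Gamma ?subr_gt0.
- exact: powR_ge0.
- by apply: measurable_funM => //; exact: measurable_powR.
- by move=> s; rewrite mulr_ge0 ?powR_ge0.
Qed.

Lemma measurable_japanese : measurable_fun setT (fun x : 'rV[R]_n => (1 + sqn x) ^- n).
Proof.
apply: (eq_measurable_fun (fun x : 'rV[R]_n => (1 + sqn x) `^ (- n%:R))).
  by move=> x _; rewrite powR_invn// addr_ge0// sqn_ge0.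
apply: (measurableT_comp (f := fun s : R => s `^ (- n%:R)) (g := fun x : 'rV[R]_n => 1 + sqn x)).
  exact: measurable_powR.
by apply: measurable_funD => //; exact: measurable_sqn.
Qed.

Let japanese_ge0 (x : 'rV[R]_n) : 0 <= (1 + sqn x) ^- n.
Proof. by rewrite invr_ge0 exprn_ge0// addr_ge0// sqn_ge0. Qed.

Lemma integrable_japanese : (0 < n)%N ->
  leb.-integrable setT (EFin \o (fun x => (1 + sqn x) ^- n)).
Proof.
move=> n0; have h0 : 0 < h by rewrite divr_gt0// ltr0n.
have hn : h < n%:R by rewrite ltr_pdivrMr// ltr_pMr ?ltr0n// ltr1n.
have Gn0 : 0 < Gamma (n%:R : R) by rewrite Gamma_gt0// ltr0n.
apply: ge0_integrable; [exact: measurable_japanese|exact: japanese_ge0|].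
have hnI : 0 < h < n%:R by rewrite h0.
have : (\int[leb]_x (Gamma (n%:R : R) * (1 + sqn x) ^- n)%:E =
    (pi `^ h * Gamma (n%:R - h))%:E)%E.
  rewrite -integral_japanese//; apply: eq_integral => x _.
  by rewrite powR_invn// addr_ge0// sqn_ge0.
rewrite (ge0_integralZlR leb (ltW Gn0) measurable_japanese japanese_ge0).
by move=> /(mule_inv (lt0r_neq0 Gn0)) ->; rewrite ltry.
Qed.

Lemma integrable_tpow_gauss a : (0 < n)%N -> 0 < a < h ->
  leb.-integrable setT (EFin \o (fun x => tpow (- a) (sqn x) * expR (- sqn x))).
Proof.
move=> n0 ah; apply: ge0_integrable.
- apply: measurable_funM; first exact: measurable_tpow_sqn.
  by under eq_fun do rewrite -[sqn _]mul1r; exact: measurable_expsqn.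
- by move=> x; rewrite mulr_ge0 ?tpow_ge0 ?expR_ge0.
- by rewrite integral_tpow_gauss_rV// ltry.
Qed.

(** Near the origin the power decides, and is integrable with a Gaussian cut-off;
    at infinity it is at most [1]. *)
Lemma integrable_tpow_japanese a : (0 < n)%N -> 0 < a < h ->
  leb.-integrable setT (EFin \o (fun x => tpow (- a) (sqn x) * (1 + sqn x) ^- n)).
Proof.
move=> n0 /andP[a0 ah]; have aI : 0 < a < h by rewrite a0.
apply: (le_integrableR _ _ (integrableRD (integrableRZl (expR 1) (integrable_tpow_gauss n0 aI))
  (integrable_japanese n0))).
  by apply: measurable_funM; [exact: measurable_tpow_sqn|exact: measurable_japanese].
move=> x; rewrite ger0_norm; last by rewrite mulr_ge0 ?tpow_ge0.
have t0 := tpow_ge0 (- a) (sqn x).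
have [q1|q1] := leP (sqn x) 1.
- rewrite -[leLHS]addr0 lerD// mulrCA ler_wpM2l// -expRD.
  apply: (@le_trans _ _ 1); last by rewrite -[leLHS]expR0 ler_expR subr_ge0.
  by rewrite invf_le1 ?exprn_gt0 ?ltr_wpDr ?sqn_ge0// exprn_ege1// lerDl sqn_ge0.
- rewrite -[leLHS]add0r lerD ?mulr_ge0 ?expR_ge0// ler_piMl//.
  rewrite tpowE ?(lt_trans _ q1)// powRN invf_le1 ?powR_gt0 ?(lt_trans _ q1)//.
  by rewrite -[leLHS](powRr0 (sqn x)) ler_powR ?ltW.
Qed.

End radial.

(** The ball lies in the cube of side [2r]. *)
Lemma lebesgue_rV_ball_le n (r : R) : 0 <= r ->
  (lebesgue_rV [set x : 'rV[R]_n | (sqn x < r ^+ 2)%R] <= ((2 * r) ^+ n)%:E)%E.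
Proof.
move=> r0.
pose B := [set v : 'rV[R]_n | forall i, `[- r, r]%classic (v ord0 i)].
have mI : measurable (`[- r, r]%classic : set R) by exact: measurable_itv.
have mB : measurable B.
  rewrite (_ : B = \bigcap_(i in [set: 'I_n]) (fun v : 'rV[R]_n => v ord0 i) @^-1` `[- r, r]).
    apply: fin_bigcap_measurable; first exact: finite_finset.
    by move=> i _; rewrite -[X in measurable X]setTI; exact: measurable_coord.
  by apply/seteqP; split => v /= h i; [move=> _|]; exact: h.
have mA : measurable [set x : 'rV[R]_n | sqn x < r ^+ 2].
  rewrite (_ : [set _ | _] = (@sqn R n) @^-1` `]-oo, r ^+ 2[); last first.
    by apply/seteqP; split => x /=; rewrite in_itv.
  by rewrite -[X in measurable X]setTI; apply: measurable_sqn.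
apply: (@le_trans _ _ (lebesgue_rV B)).
  apply: le_measure; rewrite ?inE//.
  move=> x /= xr i; rewrite /= in_itv/= -ler_norml -(@ler_pXn2r _ 2)// ?nnegrE//.
  rewrite real_normK ?num_real// ltW//; apply: le_lt_trans xr.
  by rewrite /sqn (bigD1 i)//= lerDl sumr_ge0// => j _; exact: sqr_ge0.
rewrite (lebesgue_rV_box (A := fun=> `[- r, r]%classic))//.
rewrite (eq_bigr (fun=> (2 * r)%:E)); last first.
  move=> i _; rewrite lebesgue_measure_itv/= lte_fin.
  case: ifPn => [_|]; first by rewrite opprK -EFinD; congr EFin; ring.
  rewrite -leNgt => r1; have -> : r = 0 by lra.
  by rewrite mulr0.
elim: n {B mB mA} => [|n IH]; first by rewrite big_ord0 expr0.
by rewrite big_ord_recl exprS [leRHS]EFinM lee_wpmul2l// lee_fin mulr_ge0.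
Qed.

End integral_rV.

(** * Schwartz functions and the decay of their Fourier transform *)

Section finite_differences.
Context {R : realType} {n : nat}.
Local Notation V := 'rV[R]_n.
Implicit Types (f : V -> R) (x a e : V) (h c M : R).

Lemma sqnD_le x a : sqn (x + a) <= 2 * sqn x + 2 * sqn a.
Proof.
rewrite /sqn !mulr_sumr -big_split; apply: ler_sum => i _; rewrite mxE.
have h (u v : R) : (u + v) ^+ 2 <= 2 * u ^+ 2 + 2 * v ^+ 2.
  have : 0 <= (u - v) ^+ 2 by exact: sqr_ge0.
  by nra.
exact: h.
Qed.

Lemma sqnZ h x : sqn (h *: x) = h ^+ 2 * sqn x.
Proof. by rewrite /sqn mulr_sumr; apply: eq_bigr => i _; rewrite mxE exprMn. Qed.

Lemma sqn_delta i : sqn ('e_i : V) = 1.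
Proof.
rewrite /sqn (bigD1 i)//= big1 ?addr0; last first.
  by move=> j ji; rewrite mxE (negbTE ji) andbF expr0n.
by rewrite mxE !eqxx expr1n.
Qed.

(** Finite differences stand for derivatives in the Fourier integral: this replaces
    integration by parts over [R^n] by the invariance under translations. *)
Definition diffh h e f x := f (x + h *: e) - f x.

Lemma is_derive_line f x e t : derivable f (x + t *: e) e ->
  is_derive t 1 (fun t : R => f (x + t *: e)) ('D_e f (x + t *: e)).
Proof.
move=> df.
have E : (fun h : R => h^-1 *: (f (x + (h *: (1 : R) + t) *: e) - f (x + t *: e))) =
    (fun h : R => h^-1 *: (f (h *: e + (x + t *: e)) - f (x + t *: e))).
  apply/funext => h; congr (_ *: (f _ - _)).
  by rewrite (_ : h *: (1 : R) = h) ?scalerDl 1?addrCA// /GRing.scale/= mulr1.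
by split; rewrite /derivable /derive E.
Qed.

Lemma diffh_MVT f x e h : (forall y, derivable f y e) -> 0 <= h ->
  exists2 c, 0 <= c <= h & diffh h e f x = h * 'D_e f (x + c *: e).
Proof.
move=> df h0.
pose g t := f (x + t *: e).
have dg (t : R) : is_derive t 1 g ('D_e f (x + t *: e)) by exact: is_derive_line.
have cg : {within `[0, h], continuous g}.
  by apply: derivable_within_continuous => t _; have [] := dg t.
have [c] := @MVT_segment R g (fun t => 'D_e f (x + t *: e)) 0 h h0 (fun t _ => dg t) cg.
rewrite in_itv/= => ch; rewrite /g scale0r addr0 subr0 => E.
by exists c => //; rewrite /diffh E mulrC.
Qed.

Let is_derive_shift f a x e :
  derivable f (x + a) e -> is_derive x e (fun y => f (y + a)) ('D_e f (x + a)).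
Proof.
move=> df.
have E : (fun h : R => h^-1 *: (f (h *: e + x + a) - f (x + a))) =
    (fun h : R => h^-1 *: (f (h *: e + (x + a)) - f (x + a))).
  by apply/funext => h; rewrite addrA.
by split; rewrite /derivable /derive E.
Qed.

Definition dsmooth e f := forall m x, derivable (iter m (fun g => 'D_e g) f) x e.

Let derive_diffh h e f : (forall y, derivable f y e) ->
  (forall y, derivable (diffh h e f) y e) /\ 'D_e (diffh h e f) = diffh h e ('D_e f).
Proof.
move=> df.
have d y : is_derive y e (diffh h e f) (diffh h e ('D_e f) y).
  have d1 := is_derive_shift (df (y + h *: e)).
  exact: (is_deriveB d1 (derivableP (df y))).
split; first by move=> y; have [] := d y.
by apply/funext => y; have [] := d y.
Qed.

Let iter_derive_diffh h e f m : dsmooth e f ->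
  iter m (fun g => 'D_e g) (diffh h e f) = diffh h e (iter m (fun g => 'D_e g) f).
Proof.
move=> sf; elim: m => //= m ->.
by have [_ ->] := derive_diffh h (sf m).
Qed.

Let dsmooth_diffh h e f : dsmooth e f -> dsmooth e (diffh h e f).
Proof.
move=> sf m x; rewrite iter_derive_diffh//.
by have [+ _] := derive_diffh h (sf m).
Qed.

(** The [k]-th difference is bounded by [h^k] times the [k]-th derivative, by
    the mean value theorem applied once for each difference. *)
Lemma diffh_iter_le h e (w : V -> R) K k f M : 0 <= h -> 0 <= K -> 0 <= M ->
  (forall x c, 0 <= c <= h -> w (x + c *: e) <= K * w x) ->
  dsmooth e f -> (forall x, `|iter k (fun g => 'D_e g) f x| <= M * w x) ->
  forall x, `|iter k (diffh h e) f x| <= (h * K) ^+ k * (M * w x).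
Proof.
move=> h0 K0 + wK; elim: k f M => [|k IH] f M M0 sf fM x.
  by rewrite expr0 mul1r; exact: fM.
rewrite iterSr.
have M'0 : 0 <= h * K * M by rewrite !mulr_ge0.
rewrite exprSr -(mulrA (_ ^+ k)) (mulrA (h * K)).
apply: (IH (diffh h e f) (h * K * M) M'0 (@dsmooth_diffh h e f sf)) => {}x.
rewrite iter_derive_diffh//.
have [c ch ->] := diffh_MVT x (sf k) h0.
rewrite normrM (ger0_norm h0) -!mulrA ler_wpM2l//.
rewrite (le_trans (fM _))// mulrCA ler_wpM2l//.
exact: wK.
Qed.

End finite_differences.

Section fourier_decay.
Context {R : realType} {n : nat}.
Local Notation V := 'rV[R]_n.
Local Notation leb := (@lebesgue_rV R n).
Local Notation integrableR f := (leb.-integrable setT (EFin \o f)).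
Implicit Types (f : V -> R) (x y a e : V) (b h c M : R).

(** [fcos b f] is the real part of [e^(ib)] times the Fourier integral of [f];
    for [b = - pi / 2] it is the sine transform. *)
Definition fcos b f y := \int[leb]_x (cos (dot y x + b) * f x).

Lemma integrable_shift f a : integrableR f -> integrableR (fun x => f (x + a)).
Proof.
move=> fi; have mf := integrableR_measurable fi.
have mfa : measurable_fun setT (fun x : V => f (x + a)).
  by apply: (measurableT_comp mf); exact: measurable_shift_rV.
apply/integrableP; split; first exact/measurable_EFinP.
have /integrableP[_] := fi; apply: le_lt_trans.
rewrite -[leRHS](ge0_integral_shift_rV a (f := fun x => `|f x|))//.
exact: measurableT_comp.
Qed.

Lemma integrable_cos_mul f b y : integrableR f ->
  integrableR (fun x => cos (dot y x + b) * f x).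
Proof.
move=> fi.
apply: (le_integrableR (g := fun x => `|f x|)); last exact: integrable_norm.
  apply: measurable_funM; first exact: measurable_cos_dot.
  exact: integrableR_measurable fi.
by move=> x; rewrite normrM ler_piMl// cos_max.
Qed.

Lemma dotDr y x a : dot y (x + a) = dot y x + dot y a.
Proof. by rewrite /dot -big_split; apply: eq_bigr => i _; rewrite mxE mulrDr. Qed.

Lemma dotZr y h x : dot y (h *: x) = h * dot y x.
Proof. by rewrite /dot mulr_sumr; apply: eq_bigr => i _; rewrite mxE; ring. Qed.

Lemma dot_delta y i : dot y 'e_i = y ord0 i.
Proof.
rewrite /dot (bigD1 i)//= big1 ?addr0; last first.
  by move=> j ji; rewrite mxE (negbTE ji) andbF mulr0.
by rewrite mxE !eqxx mulr1.
Qed.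

Let fcos_shift f a b y : integrableR f ->
  fcos b (fun x => f (x + a)) y = fcos (b - dot y a) f y.
Proof.
move=> fi; rewrite /fcos /Rintegral; congr fine.
rewrite -(integral_shift_rV a (f := fun x => cos (dot y x + (b - dot y a)) * f x)).
  by apply: eq_integral => x _; rewrite dotDr; congr (cos _ * _)%:E; ring.
apply: measurable_funM; first exact: measurable_cos_dot.
exact: integrableR_measurable fi.
Qed.

(** The step [h] is half a period of [x |-> cos (y.x)] in the direction [e_i], and
    the translation by [h] changes the sign of the Fourier integral. *)
Lemma fcos_diffh f b y i : integrableR f -> y ord0 i != 0 ->
  let h := pi / `|y ord0 i| in
  integrableR (diffh h 'e_i f) /\ fcos b (diffh h 'e_i f) y = - 2 * fcos b f y.
Proof.
move=> fi yi h.
have sfi := integrable_shift (h *: 'e_i) fi.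
split; first exact: integrableRB.
have -> : fcos b (diffh h 'e_i f) y = fcos b (fun x => f (x + h *: 'e_i)) y - fcos b f y.
  rewrite /fcos -RintegralB//; try exact: integrable_cos_mul.
  by apply: eq_Rintegral => x _; rewrite mulrBr.
rewrite fcos_shift// dotZr dot_delta.
suff -> : fcos (b - h * y ord0 i) f y = - fcos b f y by ring.
rewrite -[RHS]mulN1r /fcos -RintegralZl//; last exact: integrable_cos_mul.
apply: eq_Rintegral => x _; rewrite mulrA mulN1r; congr (_ * _).
have [e [e1 ->]] : exists e : R, (e = 1 \/ e = - 1) /\ h * y ord0 i = e * pi.
  rewrite /h; have [y0|y0] := leP 0 (y ord0 i).
    by exists 1; split; [left|rewrite ger0_norm// divfK// mul1r].
  exists (- 1); split; first by right.
  by rewrite ltr0_norm// invrN mulrN mulNr divfK// mulN1r.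
rewrite addrA cosB; case: e1 => ->.
  by rewrite mul1r cospi sinpi; ring.
by rewrite mulN1r cosN sinN cospi sinpi; ring.
Qed.

Let partials_nseq m i f : partials (nseq m i) f = iter m (fun g => 'D_('e_i) g) f.
Proof. by elim: m => //= m ->. Qed.

Lemma schwartz_dsmooth f i : schwartzR f -> dsmooth 'e_i f.
Proof. by move=> [sf _] m x; rewrite -partials_nseq; have [_] := sf (nseq m i); apply. Qed.

Lemma enorm_le x : enorm x <= 1 + sqn x.
Proof.
rewrite -enorm_sqn; have := enorm_ge0 x; set u := enorm x => u0.
have : 0 <= (u - 1) ^+ 2 by exact: sqr_ge0.
by nra.
Qed.

Lemma sqn1_gt0 x : 0 < 1 + sqn x.
Proof. by rewrite ltr_wpDr ?sqn_ge0. Qed.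

(** The bounds for the exponents [0] and [2k] of the norm are combined. *)
Lemma schwartz_bound f (s : seq 'I_n) k : schwartzR f ->
  exists2 C, 0 <= C & forall x, `|partials s f x| <= C * (1 + sqn x) ^- k.
Proof.
move=> [_ sf]; have [C0 hC0] := sf s 0; have [C1 hC1] := sf s (2 * k)%N.
have C00 : 0 <= C0 by apply: le_trans (hC0 0); rewrite expr0 mul1r.
have C10 : 0 <= C1 by apply: le_trans (hC1 0); rewrite mulr_ge0 ?exprn_ge0 ?enorm_ge0.
exists (2 ^+ k * (C0 + C1)); first by rewrite mulr_ge0 ?exprn_ge0 ?addr_ge0.
move=> x; rewrite ler_pdivlMr ?exprn_gt0 ?sqn1_gt0//.
have := hC0 x; rewrite expr0 mul1r => h0.
have := hC1 x; rewrite exprM enorm_sqn => h1.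
have q0 := sqn_ge0 x; set q := sqn x in q0 h1 *.
have p0 := normr_ge0 (partials s f x); set p := `|_| in p0 h0 h1 *.
have qk : (1 + q) ^+ k <= 2 ^+ k * (1 + q ^+ k).
  have [q1|q1] := leP q 1.
    apply: (@le_trans _ _ (2 ^+ k)); first by rewrite lerXn2r ?nnegrE ?addr_ge0//; lra.
    by rewrite ler_peMr ?exprn_ge0// lerDl exprn_ge0.
  apply: (@le_trans _ _ ((2 * q) ^+ k)); first by rewrite lerXn2r ?nnegrE ?addr_ge0 ?mulr_ge0//; lra.
  by rewrite exprMn ler_wpM2l ?exprn_ge0// lerDr.
apply: (le_trans (ler_wpM2l p0 qk)).
by rewrite mulrCA ler_wpM2l ?exprn_ge0// mulrDr mulr1 lerD// mulrC.
Qed.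

Lemma schwartz_measurable f (s : seq 'I_n) : schwartzR f -> measurable_fun setT (partials s f).
Proof. by move=> [sf _]; apply: continuous_measurable_rV; have [] := sf s. Qed.

Lemma schwartz_integrable f : (0 < n)%N -> schwartzR f -> integrableR f.
Proof.
move=> n0 sf; have [C C0 fC] := schwartz_bound [::] n sf.
apply: (le_integrableR _ fC); first exact: (schwartz_measurable [::]).
by apply: integrableRZl; exact: integrable_japanese.
Qed.

(** The weight changes by a bounded factor under translations of length at most
    [1], as needed to iterate the mean value theorem. *)
Let w_shift x c i : 0 <= c <= 1 ->
  (1 + sqn (x + c *: 'e_i)) ^- n <= 3 ^+ n * (1 + sqn x) ^- n.
Proof.
move=> /andP[c0 c1].
rewrite ler_pdivlMr ?exprn_gt0 ?sqn1_gt0// mulrC ler_pdivrMr ?exprn_gt0 ?sqn1_gt0//.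
have p0 (z : V) : 0 <= 1 + sqn z by apply/ltW/sqn1_gt0.
rewrite -exprMn lerXn2r ?nnegrE ?mulr_ge0//.
have := sqnD_le (x + c *: 'e_i) (- (c *: 'e_i)).
rewrite addrK -scaleNr sqnZ sqrrN sqn_delta mulr1.
set u := sqn x; set v := sqn _ => uv.
have := sqn_ge0 (x + c *: 'e_i); rewrite -/v => v0.
have : c ^+ 2 <= 1 by nra.
by lra.
Qed.

Let fcos_le b f y : integrableR f -> `|fcos b f y| <= \int[leb]_x `|f x|.
Proof.
move=> fi; have ci := integrable_cos_mul b y fi.
apply: le_trans (le_normr_Rintegral measurableT ci) _.
apply: le_Rintegral => //; first exact: integrable_norm.
  exact: integrable_norm.
by move=> x _; rewrite normrM ler_piMl// cos_max.
Qed.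

Let fcos_diffh_iter k b f y i : integrableR f -> y ord0 i != 0 ->
  let h := pi / `|y ord0 i| in
  integrableR (iter k (diffh h 'e_i) f) /\
  `|fcos b f y| <= `|fcos b (iter k (diffh h 'e_i) f) y|.
Proof.
move=> fi yi h; elim: k => //= k [ki kle].
have [gi gE] := fcos_diffh b ki yi; split => //.
by rewrite gE (le_trans kle)// normrM normrN (ger0_norm (ler0n _ 2)) ler_peMl// ler1n.
Qed.

Let fcos_decay_coord f i : (0 < n)%N -> schwartzR f ->
  exists2 C, 0 <= C & forall b y, pi <= `|y ord0 i| ->
    `|fcos b f y| <= C * (pi / `|y ord0 i|) ^+ (2 * n).
Proof.
move=> n0 sf; have fi := schwartz_integrable n0 sf.
have [M M0 fM] := schwartz_bound (nseq (2 * n) i) n sf.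
have wi := integrable_japanese (R := R) n0.
pose W := \int[leb]_x (1 + sqn x) ^- n.
have W0 : 0 <= W.
  by apply: Rintegral_ge0 => x _; rewrite invr_ge0 exprn_ge0 ?ltW ?sqn1_gt0.
exists ((3 ^+ n) ^+ (2 * n) * (M * W)).
  by rewrite mulr_ge0 ?exprn_ge0 ?mulr_ge0.
move=> b y piy.
have y0 : 0 < `|y ord0 i| by exact: lt_le_trans (pi_gt0 R) piy.
have yi : y ord0 i != 0 by rewrite -normr_gt0.
set h := pi / _; have h0 : 0 <= h by rewrite divr_ge0 ?pi_ge0.
have h1 : h <= 1 by rewrite ler_pdivrMr// mul1r.
have [ki kle] := fcos_diffh_iter (2 * n) b fi yi; rewrite -/h in ki kle.
apply: (le_trans kle); apply: (le_trans (fcos_le _ _ ki)).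
have wK x c : 0 <= c <= h -> (1 + sqn (x + c *: 'e_i)) ^- n <= 3 ^+ n * (1 + sqn x) ^- n.
  by move=> /andP[c0 ch]; apply: w_shift; rewrite c0 (le_trans ch).
have fM' x : `|iter (2 * n) (fun g => 'D_('e_i) g) f x| <= M * (1 + sqn x) ^- n.
  by rewrite -partials_nseq.
have K0 : 0 <= 3 ^+ n :> R by rewrite exprn_ge0.
have := diffh_iter_le h0 K0 M0 wK (schwartz_dsmooth (i := i) sf) fM'.
set g := iter _ _ f in ki *; move=> gle.
apply: (@le_trans _ _ (\int[leb]_x ((h * 3 ^+ n) ^+ (2 * n) * M * (1 + sqn x) ^- n))).
  apply: le_Rintegral => //; first exact: integrable_norm.
    exact: integrableRZl.
  by move=> x _; rewrite -mulrA.
rewrite RintegralZl// exprMn -/W.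
by rewrite [leLHS](_ : _ = (3 ^+ n) ^+ (2 * n) * (M * W) * h ^+ (2 * n))//; ring.
Qed.

(** Take [2n] differences in the direction of the largest coordinate of [y]: its
    square is at least [|y|^2 / n], so their common step [pi / |y_i|] is at most
    of order [1 / |y|]. When [y] is too small for the step to be below [1], the
    integral of [|f|] is a bound. *)
Lemma fcos_decay f : (0 < n)%N -> schwartzR f ->
  exists2 C, 0 <= C & forall b y, `|fcos b f y| <= C * (1 + sqn y) ^- n.
Proof.
move=> n0 sf; have fi := schwartz_integrable n0 sf.
have /choice[C hC] : forall i, exists C, 0 <= C /\ forall b y, pi <= `|y ord0 i| ->
    `|fcos b f y| <= C * (pi / `|y ord0 i|) ^+ (2 * n).
  by move=> i; have [C C0 hC] := fcos_decay_coord i n0 sf; exists C.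
pose F := \int[leb]_x `|f x|.
have F0 : 0 <= F by apply: Rintegral_ge0.
(* if [|y|^2 > a], the largest coordinate of [y] exceeds [pi] *)
pose a : R := n%:R * pi ^+ 2.
have n1 : 1 <= n%:R :> R by rewrite ler1n.
have pi1 : 1 <= pi :> R by rewrite (le_trans _ (pi_ge2 R))// ler1n.
have a1 : 1 <= a by rewrite /a -[leLHS]mulr1 ler_pM// exprn_ege1.
have a0 : 0 <= a by exact: le_trans a1.
have C0 i : 0 <= C i by have [] := hC i.
have S0 : 0 <= \sum_i C i by apply: sumr_ge0.
have b0 : 0 <= (2 * a) ^+ n by rewrite exprn_ge0// mulr_ge0.
exists (F * (1 + a) ^+ n + (\sum_i C i) * (2 * a) ^+ n).
  by rewrite addr_ge0// mulr_ge0// exprn_ge0// addr_ge0.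
move=> b y; have q1 := sqn1_gt0 y; have q0 := sqn_ge0 y.
have w0 : 0 <= (1 + sqn y) ^- n by rewrite invr_ge0 exprn_ge0 ?addr_ge0.
rewrite mulrDl; have [ya|ya] := leP (sqn y) a.
  rewrite -[leLHS]addr0 lerD//; last by rewrite !mulr_ge0.
  apply: le_trans (fcos_le _ _ fi) _; rewrite -/F -mulrA ler_peMr//.
  rewrite ler_pdivlMr ?exprn_gt0// mul1r lerXn2r ?nnegrE ?addr_ge0//.
  by rewrite lerD2l.
rewrite -[leLHS]add0r lerD//; first by rewrite !mulr_ge0 ?exprn_ge0 ?addr_ge0.
have [i yi] : exists i, sqn y <= n%:R * (y ord0 i) ^+ 2.
  apply: contrapT => /forallNP h.
  have : \sum_(i < n) n%:R * (y ord0 i) ^+ 2 < \sum_(i < n) sqn y.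
    apply: ltr_sum => [|i _]; first by apply/hasP; exists (Ordinal n0) => //; rewrite mem_index_enum.
    by rewrite ltNge; apply/negP/h.
  by rewrite sumr_const card_ord -mulr_sumr -/(sqn y) mulr_natl ltxx.
have yi2 : (y ord0 i) ^+ 2 = `|y ord0 i| ^+ 2 by rewrite real_normK ?num_real.
have n00 : 0 < n%:R :> R by rewrite ltr0n.
have piy2 : pi ^+ 2 < `|y ord0 i| ^+ 2.
  by rewrite -(ltr_pM2l n00) -yi2; exact: lt_le_trans yi.
have piy : pi <= `|y ord0 i|.
  by rewrite -(@ler_pXn2r _ 2)// ?nnegrE ?pi_ge0// ltW.
have [_ /(_ b y piy)] := hC i; move/le_trans; apply.
apply: (@le_trans _ _ (C i * ((2 * a) ^+ n * (1 + sqn y) ^- n))); last first.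
  by rewrite mulrA ler_wpM2r// ler_wpM2r// (bigD1 i)//= lerDl sumr_ge0.
rewrite ler_wpM2l// -exprVn -exprMn exprM lerXn2r ?nnegrE ?sqr_ge0 ?mulr_ge0 ?invr_ge0 ?pi_ge0 ?addr_ge0//.
rewrite expr_div_n ler_pdivrMr; last by rewrite (le_lt_trans _ piy2) ?sqr_ge0.
rewrite mulrAC ler_pdivlMr// -yi2.
have : n%:R * pi ^+ 2 * (1 + sqn y) <= 2 * a * (n%:R * (y ord0 i) ^+ 2).
  rewrite -/a; apply: (@le_trans _ _ (a * (2 * sqn y))).
    by rewrite ler_wpM2l//; lra.
  by rewrite mulrA (mulrC a 2); apply: ler_wpM2l => //; exact: mulr_ge0.
by rewrite -mulrA (mulrCA (2 * a)) ler_pM2l.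
Qed.

End fourier_decay.

(** * Gaussians are Schwartz functions *)

Section gaussian_schwartz.
Context {R : realType} {n : nat}.
Local Notation V := 'rV[R]_n.
Variables (s : R) (a : V).
Hypothesis s0 : 0 < s.

(** Polynomials in the coordinates, with their formal derivatives, describe all
    the partial derivatives of a Gaussian. *)
Inductive cpoly : Type :=
| CConst of R
| CCoord of 'I_n
| CAdd of cpoly & cpoly
| CMul of cpoly & cpoly.

Fixpoint ceval (p : cpoly) (x : V) : R :=
  match p with
  | CConst c => c
  | CCoord j => x ord0 j
  | CAdd p1 p2 => ceval p1 x + ceval p2 x
  | CMul p1 p2 => ceval p1 x * ceval p2 x
  end.

Fixpoint cderiv (i : 'I_n) (p : cpoly) : cpoly :=
  match p with
  | CConst _ => CConst 0
  | CCoord j => CConst (i == j)%:R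
  | CAdd p1 p2 => CAdd (cderiv i p1) (cderiv i p2)
  | CMul p1 p2 => CAdd (CMul p1 (cderiv i p2)) (CMul p2 (cderiv i p1))
  end.

Let is_derive_coord (x : V) i j : is_derive x 'e_i (fun x : V => x ord0 j) (i == j)%:R.
Proof.
have E : (fun h : R => h^-1 *: ((h *: 'e_i + x) ord0 j - x ord0 j)) @ 0^' --> ((i == j)%:R : R).
  apply: cvg_near_cst; near=> h.
  have h0 : h != 0 by near: h; exact: nbhs_dnbhs_neq.
  by rewrite !mxE eqxx addrK /GRing.scale/= mulKf// eq_sym.
by split; [apply/cvg_ex; exists (i == j)%:R|exact/cvg_lim].
Unshelve. all: by end_near. Qed.

Let is_derive_ceval (x : V) i p : is_derive x 'e_i (ceval p) (ceval (cderiv i p) x).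
Proof.
elim: p => [c|j|p1 h1 p2 h2|p1 h1 p2 h2] /=.
- exact: is_derive_cst.
- exact: is_derive_coord.
- exact: is_deriveD.
- exact: is_deriveM.
Qed.

Let continuous_ceval p : continuous (ceval p).
Proof.
elim: p => [c|j|p1 h1 p2 h2|p1 h1 p2 h2] /= x.
- exact: cst_continuous.
- exact: coord_continuous.
- exact: (cvgD (h1 x) (h2 x)).
- exact: (cvgM (h1 x) (h2 x)).
Qed.

Definition gaussian (x : V) : R := expR (- (s * sqn (x - a))).

Let dpoly i : cpoly := CMul (CConst (- (2 * s))) (CAdd (CCoord i) (CConst (- a ord0 i))).

Let expo : cpoly :=
  CMul (CConst (- s)) (\big[CAdd/CConst 0]_j
    CMul (CAdd (CCoord j) (CConst (- a ord0 j))) (CAdd (CCoord j) (CConst (- a ord0 j)))).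

Let expoE x : ceval expo x = - (s * sqn (x - a)).
Proof.
rewrite /expo /= mulNr; congr (- (_ * _)); rewrite /sqn.
rewrite (big_morph (ceval^~ x) (id1 := 0) (op1 := +%R))//=.
by apply: eq_bigr => j _; rewrite !mxE.
Qed.

Let expo_deriv x i : ceval (cderiv i expo) x = ceval (dpoly i) x.
Proof.
rewrite /expo /= mulr0 addr0.
rewrite (big_morph (cderiv i) (id1 := CConst 0) (op1 := CAdd))//.
rewrite (big_morph (ceval^~ x) (id1 := 0) (op1 := +%R))//=.
rewrite (bigD1 i)//= big1 ?addr0 ?eqxx; last first.
  by move=> j ji; rewrite eq_sym (negbTE ji) addr0 mulr0 addr0.
by rewrite mulr1n; ring.
Qed.

(** The chain rule along a line: the directional derivative is a one-variable
    derivative at [0]. *)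
Let is_derive_gaussian x i : is_derive x 'e_i gaussian (ceval (dpoly i) x * gaussian x).
Proof.
have E : gaussian = expR \o ceval expo.
  by apply/funext => y; rewrite /gaussian -expoE.
have d0 : is_derive x 'e_i (ceval expo) (ceval (dpoly i) x).
  by rewrite -expo_deriv; exact: is_derive_ceval.
have d1 : is_derive (0 : R) 1 (fun t => ceval expo (x + t *: 'e_i)) (ceval (dpoly i) x).
  have -> : ceval (dpoly i) x = 'D_('e_i) (ceval expo) (x + 0 *: 'e_i).
    by rewrite scale0r addr0 derive_val.
  by apply: is_derive_line; rewrite scale0r addr0; have [] := d0.
have d2 := @is_derive1_comp R expR (fun t => ceval expo (x + t *: 'e_i)) 0 _ _ (is_derive_expR _) d1.
rewrite [X in is_derive _ _ _ X](_ : _ = ceval (dpoly i) x * gaussian x) in d2; last first.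
  by rewrite scale0r addr0 E mulrC.
have F : (fun h : R => h^-1 *: (((expR \o (fun t => ceval expo (x + t *: 'e_i))) \o shift 0) (h *: 1)
      - (expR \o (fun t => ceval expo (x + t *: 'e_i))) 0)) =
    (fun h : R => h^-1 *: ((gaussian \o shift x) (h *: 'e_i) - gaussian x)).
  apply/funext => h; rewrite E; congr (_ *: (expR (ceval _ _) - expR (ceval _ _))).
    by rewrite [LHS]addrC; congr (_ *: _ + _); rewrite /= addr0; exact: mulr1.
  by rewrite scale0r addr0.
case: d2 => d2 d2E.
split; first by rewrite /derivable -F.
by rewrite /derive -F.
Qed.

(** The polynomial factor of the iterated partial derivatives. *)
Let gpoly : seq 'I_n -> cpoly :=
  foldr (fun i p => CAdd (CMul p (dpoly i)) (cderiv i p)) (CConst 1).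

Let is_derive_gpoly p x i : is_derive x 'e_i (fun x => ceval p x * gaussian x)
  (ceval (CAdd (CMul p (dpoly i)) (cderiv i p)) x * gaussian x).
Proof.
have h := is_deriveM (is_derive_ceval x i p) (is_derive_gaussian x i).
by apply: (is_derive_eq h) => /=; rewrite /GRing.scale/=; ring.
Qed.

Let partials_gaussian l : partials l gaussian = fun x => ceval (gpoly l) x * gaussian x.
Proof.
elim: l => [|i l /= ->]; first by apply/funext => x /=; rewrite mul1r.
by apply/funext => x; have [] := is_derive_gpoly (gpoly l) x i.
Qed.

Lemma continuous_sqn : continuous (@sqn R n).
Proof.
have -> : @sqn R n = ceval (\big[CAdd/CConst 0]_j CMul (CCoord j) (CCoord j)).
  apply/funext => y; rewrite (big_morph (ceval^~ y) (id1 := 0) (op1 := +%R))//.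
exact: continuous_ceval.
Qed.

Lemma continuous_gaussian : continuous gaussian.
Proof.
have -> : gaussian = expR \o ceval expo by apply/funext => y; rewrite /gaussian -expoE.
by move=> x; apply: continuous_comp; [exact: continuous_ceval|exact: continuous_expR].
Qed.

Let smooth_gaussian : smooth gaussian.
Proof.
move=> l; rewrite partials_gaussian; split; last first.
  by move=> x i; have [] := is_derive_gpoly (gpoly l) x i.
move=> x; exact: (cvgM (@continuous_ceval _ x) (@continuous_gaussian x)).
Qed.

Let ceval_le p : exists k, exists2 C, 0 <= C & forall x, `|ceval p x| <= C * (1 + sqn x) ^+ k.
Proof.
have p0 (z : V) : 0 <= 1 + sqn z by apply/ltW/sqn1_gt0.
have p1 (z : V) : 1 <= 1 + sqn z by rewrite lerDl sqn_ge0.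
have up k l (z : V) : (1 + sqn z) ^+ k <= (1 + sqn z) ^+ (k + l).
  by rewrite exprD ler_peMr ?exprn_ge0// exprn_ege1.
elim: p => [c|j|p1' [k1 [C1 C10 h1]] p2' [k2 [C2 C20 h2]]|p1' [k1 [C1 C10 h1]] p2' [k2 [C2 C20 h2]]] /=.
- by exists 0, `|c| => // x; rewrite expr0 mulr1.
- exists 1, 1 => // x; rewrite expr1 mul1r; apply: le_trans (enorm_le x).
  rewrite -sqrtr_sqr; apply: ler_wsqrtr; rewrite (bigD1 j)//= lerDl.
  by apply: sumr_ge0 => i _; exact: sqr_ge0.
- exists (k1 + k2)%N, (C1 + C2); first exact: addr_ge0.
  move=> x; apply: (le_trans (ler_normD _ _)); rewrite mulrDl lerD//.
    by apply: (le_trans (h1 x)); rewrite ler_wpM2l.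
  by apply: (le_trans (h2 x)); rewrite ler_wpM2l// addnC.
- exists (k1 + k2)%N, (C1 * C2); first exact: mulr_ge0.
  by move=> x; rewrite normrM exprD mulrACA ler_pM.
Qed.

(** With [c = (k+1)/s], the left-hand side is at most the power [k+1] of
    [(1 + q) e^(-q/c)], which is at most [1 + c]. *)
Lemma expR_decay k : exists2 C, 0 <= C & forall q, 0 <= q -> (1 + q) ^+ k * expR (- (s * q)) <= C.
Proof.
have k0 : 0 < k.+1%:R :> R by [].
pose c := k.+1%:R / s; have c0 : 0 < c by rewrite divr_gt0.
exists ((1 + c) ^+ k.+1); first by rewrite exprn_ge0// addr_ge0// ltW.
move=> q q0.
apply: (@le_trans _ _ ((1 + q) ^+ k.+1 * expR (- (s * q)))).
  by rewrite ler_wpM2r ?expR_ge0// ler_weXn2l// lerDl.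
have -> : expR (- (s * q)) = expR (- (q / c)) ^+ k.+1.
  rewrite -expRM_natl mulrN; congr (expR (- _)); rewrite /c; field.
  by rewrite gt_eqF//= gt_eqF.
have c1 := addr_ge0 (@ler01 R) (ltW c0); have q1 := addr_ge0 (@ler01 R) q0.
have e0 : 0 <= expR (- (q / c)) by exact: expR_ge0.
rewrite -exprMn lerXn2r ?nnegrE ?mulr_ge0//.
rewrite expRN ler_pdivrMr ?expR_gt0//.
apply: (@le_trans _ _ ((1 + c) * (1 + q / c))); last first.
  by rewrite ler_wpM2l// expR_ge1Dx.
rewrite mulrDr mulr1 mulrDl mul1r mulrCA divff ?gt_eqF// mulr1.
by have := divr_ge0 q0 (ltW c0); lra.
Qed.

(** Polynomial growth, compared with the decay of the Gaussian at its centre [a]: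
    [1 + |x|^2] is at most a multiple of [1 + |x - a|^2]. *)
Lemma schwartz_gaussian : schwartzR gaussian.
Proof.
split; first exact: smooth_gaussian.
move=> l k; rewrite partials_gaussian.
have [m [C C0 hC]] := ceval_le (gpoly l).
have [D D0 hD] := expR_decay (k + m).
pose c := 2 + 2 * sqn a; have c0 : 0 <= c by rewrite addr_ge0// mulr_ge0// sqn_ge0.
exists (C * c ^+ (k + m) * D) => x.
have q0 (z : V) := sqn_ge0 z.
have p0 (z : V) : 0 <= 1 + sqn z by rewrite addr_ge0.
rewrite normrM (ger0_norm (expR_ge0 _)) mulrA.
apply: (@le_trans _ _ (C * (1 + sqn x) ^+ (k + m) * gaussian x)).
  rewrite ler_wpM2r ?expR_ge0// exprD mulrCA ler_pM ?exprn_ge0 ?enorm_ge0//.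
  by rewrite lerXn2r ?nnegrE ?enorm_ge0// enorm_le.
rewrite -!mulrA ler_wpM2l//.
apply: (@le_trans _ _ ((c * (1 + sqn (x - a))) ^+ (k + m) * gaussian x)).
  rewrite ler_wpM2r ?expR_ge0// lerXn2r ?nnegrE ?mulr_ge0//.
  have := sqnD_le (x - a) a; rewrite subrK /c.
  have := q0 a; have := q0 (x - a); set u := sqn a; set v := sqn (x - a).
  by move=> v0 u0; have := mulr_ge0 u0 v0; lra.
rewrite exprMn -mulrA ler_wpM2l ?exprn_ge0//.
exact: hD.
Qed.

End gaussian_schwartz.

(** * The Fourier transform of a power of the norm *)

(** Tonelli's theorem, for the positive and negative parts of the inner integrand. *)
Lemma measurable_integralR d1 d2 (T1 : measurableType d1) (T2 : measurableType d2)
    (R : realType) (m2 : {sigma_finite_measure set T2 -> \bar R}) (f : T1 -> T2 -> R) :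
  measurable_fun setT (fun z : T1 * T2 => f z.1 z.2) ->
  measurable_fun setT (fun x => \int[m2]_y (f x y)%:E)%E.
Proof.
move=> mf.
have mfE : measurable_fun setT (fun z : T1 * T2 => (f z.1 z.2)%:E).
  exact/measurable_EFinP.
under eq_fun => x do rewrite integralE.
apply: emeasurable_funB.
- under eq_fun do under eq_integral do rewrite funeposE.
  apply: (measurable_fun_fubini_tonelli_F (fun z : T1 * T2 => maxe (f z.1 z.2)%:E 0%E)).
    by apply: measurable_maxe => //; exact: measurable_cst.
  by move=> z; rewrite le_max lexx orbT.
- under eq_fun do under eq_integral do rewrite funenegE.
  apply: (measurable_fun_fubini_tonelli_F (fun z : T1 * T2 => maxe (- (f z.1 z.2)%:E)%E 0%E)).
    apply: measurable_maxe; last exact: measurable_cst.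
    exact: measurableT_comp.
  by move=> z; rewrite le_max lexx orbT.
Qed.

Section power_transform.
Context {R : realType} {n : nat}.
Local Notation V := 'rV[R]_n.
Local Notation leb := (@lebesgue_rV R n).
Local Notation mu := (@lebesgue_measure R).
Local Notation integrableR f := (leb.-integrable setT (EFin \o f)).
Local Notation h := (n%:R / 2 : R).
Hypothesis n0 : (0 < n)%N.
Implicit Types (f g : V -> R) (x y : V) (b s t : R).

(** The measure of the origin being zero, a superposition [G] of kernels only has
    to be computed elsewhere. *)
Let fubini_superposition (K : V -> R -> R) (G g : V -> R) :
  measurable_fun setT (fun z : V * measurableTypeR R => K z.1 z.2) ->
  (forall x s, 0 <= K x s) -> measurable_fun setT g ->
  (forall x, x != 0%R -> \int[mu]_s (K x s)%:E = (G x)%:E)%E ->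
  integrableR (fun x => G x * g x) ->
  (\int[leb]_x (G x * g x)%:E = \int[mu]_s \int[leb]_x (K x s * g x)%:E)%E.
Proof.
move=> mK K0 mg KG Ggi; have mGg := integrableR_measurable Ggi.
have mKg : measurable_fun setT (fun z : V * measurableTypeR R => K z.1 z.2 * g z.1).
  by apply: measurable_funM => //; exact: (measurableT_comp mg).
have mKx x : measurable_fun setT (K x : measurableTypeR R -> R).
  exact: (measurable_fun_pair2 x mK).
have KgE x : x != 0%R -> (\int[mu]_s (K x s * g x)%:E = (G x * g x)%:E)%E.
  move=> x0.
  have Ki : mu.-integrable setT (EFin \o K x).
    have Koo : (\int[mu]_s (K x s)%:E < +oo)%E by rewrite KG// ltry.
    exact: (ge0_integrable (mKx x) (K0 x) Koo).
  transitivity (\int[mu]_s ((g x)%:E * (K x s)%:E))%E.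
    by apply: eq_integral => s _; rewrite -EFinM mulrC.
  by rewrite integralZl// KG// -EFinM mulrC.
have KgnE x : x != 0%R -> (\int[mu]_s `|K x s * g x|%:E = `|G x * g x|%:E)%E.
  move=> x0.
  have G0 : 0 <= G x by rewrite -lee_fin -KG//; apply: integral_ge0 => s _; rewrite lee_fin.
  transitivity (\int[mu]_s (`|g x| * K x s)%:E)%E.
    by apply: eq_integral => s _; rewrite normrM mulrC (ger0_norm (K0 x s)).
  by rewrite (ge0_integralZlR mu (normr_ge0 (g x)) (mKx x) (K0 x)) KG// -EFinM normrM mulrC (ger0_norm G0).
rewrite -(fubiniR (m1 := leb) (m2 := mu) mKg); last first.
  have /integrableP[_] := Ggi; apply: le_lt_trans; rewrite le_eqVlt; apply/orP; left; apply/eqP.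
  apply: eq_integral_rV => //.
  - by apply: (measurable_integralR mu (f := fun x s => `|K x s * g x|)); exact: measurableT_comp.
  - by apply: measurableT_comp => //; exact: measurable_int Ggi.
apply: eq_integral_rV => //.
- exact/measurable_EFinP.
- exact: (measurable_integralR mu (f := fun x s => K x s * g x)).
- by move=> x x0; rewrite KgE.
Qed.

Let measurable_dot2 : measurable_fun setT (fun z : V * V => dot z.1 z.2).
Proof.
apply: measurable_sum => i; apply: measurable_funM.
- exact: (measurableT_comp (@measurable_coord R n i)).
- exact: (measurableT_comp (@measurable_coord R n i)).
Qed.

Let measurable_fcos_integrand b f : measurable_fun setT f ->
  measurable_fun setT (fun z : V * V => cos (dot z.1 z.2 + b) * f z.2).
Proof.
move=> mf; apply: measurable_funM; last exact: (measurableT_comp mf).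
apply: (measurableT_comp (f := @cos R)).
  by apply: continuous_measurable_fun; exact: continuous_cos.
exact: measurable_funD.
Qed.

Lemma measurable_fcos b f : measurable_fun setT f -> measurable_fun setT (fcos b f).
Proof.
move=> mf; apply: (measurableT_comp (f := @fine R)); first exact: fine_measurable.
exact: (measurable_integralR leb (measurable_fcos_integrand b mf)).
Qed.

Let fcosE b f y : integrableR f ->
  (\int[leb]_x (cos (dot y x + b) * f x)%:E = (fcos b f y)%:E)%E.
Proof.
move=> fi; rewrite /fcos /Rintegral fineK//.
exact: (integrable_fin_num measurableT (integrable_cos_mul b y fi)).
Qed.

(** The exchange formula for Fourier integrals, applied to a Gaussian, whose Fourier
    integral is explicit. *)
Let integral_gauss_fcos b f s : integrableR f -> 0 < s ->
  (\int[leb]_y (expR (- (s * sqn y)) * fcos b f y)%:E =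
   \int[leb]_x (cos b * (pi `^ h * s `^ (- h)) * expR (- (sqn x / (4 * s))) * f x)%:E)%E.
Proof.
move=> fi s0; have mf := integrableR_measurable fi.
have mE : measurable_fun setT (fun x : V => expR (- (s * sqn x))).
  exact: integrableR_measurable (integrable_gauss_rV n s0).
pose L x y := expR (- (s * sqn y)) * (cos (dot y x + b) * f x).
have mL : measurable_fun setT (fun z : V * V => L z.2 z.1).
  apply: measurable_funM; last exact: measurable_fcos_integrand.
  exact: (measurableT_comp mE).
transitivity (\int[leb]_y \int[leb]_x (L x y)%:E)%E.
  apply: eq_integral => y _; rewrite EFinM -fcosE// -integralZl//.
  exact: integrable_cos_mul.
rewrite (@fubiniR _ _ _ _ R leb leb (fun y x => L x y) mL)//; last first.
  have /integrableP[_ foo] := fi.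
  have F0 : (0 <= \int[leb]_x `|(f x)%:E|)%E by apply: integral_ge0.
  have mF : measurable_fun setT (fun x => `|f x|) by exact: measurableT_comp.
  apply: (@le_lt_trans _ _ (\int[leb]_y ((expR (- (s * sqn y)))%:E * \int[leb]_x `|(f x)%:E|))%E).
    apply: ge0_le_integral => //.
    - by move=> y _; apply: integral_ge0.
    - apply: (measurable_integralR leb (f := fun y x => `|L x y|)); exact: measurableT_comp.
    - by apply: emeasurable_funM => //; exact/measurable_EFinP.
    move=> y _; rewrite -ge0_integralZl//; last exact/measurable_EFinP.
    apply: ge0_le_integral => //.
    - apply/measurable_EFinP; apply: measurableT_comp => //.
      exact: (measurable_fun_pair2 y mL).
    - by apply/measurable_EFinP; exact: measurable_funM.
    move=> x _; rewrite -EFinM lee_fin /L normrM (ger0_norm (expR_ge0 _)) ler_wpM2l ?expR_ge0//.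
    by rewrite normrM ler_piMl// cos_max.
  rewrite ge0_integralZr//; last exact/measurable_EFinP.
  by rewrite integral_gauss_rV_powR// lte_mul_pinfty ?lee_fin ?mulr_ge0 ?powR_ge0.
apply: eq_integral => x _.
transitivity (\int[leb]_y ((f x)%:E * (expR (- (s * sqn y)) * cos (dot x y + b))%:E))%E.
  apply: eq_integral => y _; rewrite -EFinM /L.
  have -> : dot y x = dot x y by apply: eq_bigr => i _; rewrite mulrC.
  by congr EFin; ring.
rewrite integralZl//; last exact: integrable_gauss_cos_rV.
rewrite integral_gauss_cos_rV// -EFinM.
have -> : Num.sqrt (pi / s) ^+ n = pi `^ h * s `^ (- h) :> R.
  by apply: EFin_inj; rewrite -integral_gauss_rV// integral_gauss_rV_powR.
by congr EFin; rewrite mulrC !mulrA.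
Qed.

Lemma schwartz_fcos_tpow_integrable b f t : schwartzR f -> 0 < t < h ->
  integrableR (fun y => tpow (- t) (sqn y) * fcos b f y).
Proof.
move=> sf th; have mf := schwartz_measurable [::] sf.
have [C C0 hC] := fcos_decay n0 sf.
apply: (le_integrableR _ _ (integrableRZl C (integrable_tpow_japanese n0 th))).
  by apply: measurable_funM; [exact: measurable_tpow_sqn|exact: measurable_fcos].
move=> y; rewrite normrM (ger0_norm (tpow_ge0 _ _)) mulrCA ler_wpM2l ?tpow_ge0//.
Qed.

Lemma schwartz_tpow_integrable f t : schwartzR f -> 0 < t < h ->
  integrableR (fun y => tpow (- t) (sqn y) * f y).
Proof.
move=> sf th; have mf := schwartz_measurable [::] sf.
have [C C0 hC] := schwartz_bound [::] n sf.
apply: (le_integrableR _ _ (integrableRZl C (integrable_tpow_japanese n0 th))).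
  by apply: measurable_funM; [exact: measurable_tpow_sqn|exact: mf].
move=> y; rewrite normrM (ger0_norm (tpow_ge0 _ _)) mulrCA ler_wpM2l ?tpow_ge0//.
Qed.

(** Both sides are superpositions of Gaussians, since [|y|^(-2t)] is the Laplace
    transform of [s^(t-1) / Gamma t] at [|y|^2] and [|x|^(2t-n)] is the one of
    [s^(-(n/2-t)-1)], up to a factor, after the inversion of [s]. *)
Lemma integral_tpow_fcos b f t : schwartzR f -> 0 < t < h ->
  \int[leb]_y (tpow (- t) (sqn y) * fcos b f y) =
  cos b * (pi `^ h * 4 `^ (h - t) * (Gamma (h - t) / Gamma t)) *
  \int[leb]_x (tpow (- (h - t)) (sqn x) * f x).
Proof.
move=> sf th; have /andP[t0 t1] := th; have Gt0 := Gamma_gt0 t0.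
have fi := schwartz_integrable n0 sf; have mf := integrableR_measurable fi.
have th' : 0 < h - t < h by apply/andP; split; lra.
have /andP[b0 _] := th'.
have i1 := schwartz_fcos_tpow_integrable b sf th.
have i2 := schwartz_tpow_integrable sf th'.
have alg5 (k1 k2 k3 k4 k5 : R) : k1 * (k2 * k3) * (k4 * k5) = k1 * k2 * k4 * (k3 * k5).
  by ring.
have mtp a : measurable_fun setT (tpow a : measurableTypeR R -> R) := measurable_tpow a.
have e1 : (\int[leb]_y (Gamma t * tpow (- t) (sqn y) * fcos b f y)%:E =
   \int[mu]_s \int[leb]_y (tpow (t - 1) s * expR (- (sqn y * s)) * fcos b f y)%:E)%E.
  apply: (@fubini_superposition (fun y s => tpow (t - 1) s * expR (- (sqn y * s)))).
  - apply: measurable_funM; first exact: (measurableT_comp (mtp _)).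
    apply: measurableT_comp => //; apply: measurableT_comp => //.
    apply: measurable_funM => //; exact: (measurableT_comp (@measurable_sqn R n)).
  - by move=> y s; rewrite mulr_ge0 ?tpow_ge0 ?expR_ge0.
  - exact: measurable_fcos.
  - by move=> y y0; have q0 := sqn_gt0 y0; rewrite integral_tpow_expR_Gamma// tpowE.
  - by have := integrableRZl (Gamma t) i1; under eq_fun do rewrite mulrA.
have e2 : (\int[leb]_x (Gamma (h - t) * (4 `^ (h - t) * tpow (- (h - t)) (sqn x)) *
      (cos b * pi `^ h * f x))%:E =
   \int[mu]_s \int[leb]_x (tpow (- (h - t) - 1) s * expR (- (sqn x / 4 * tpow (- 1) s)) *
      (cos b * pi `^ h * f x))%:E)%E.
  apply: (@fubini_superposition (fun x s => tpow (- (h - t) - 1) s * expR (- (sqn x / 4 * tpow (- 1) s)))).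
  - apply: measurable_funM; first exact: (measurableT_comp (mtp _)).
    apply: measurableT_comp => //; apply: measurableT_comp => //.
    apply: measurable_funM; last exact: (measurableT_comp (mtp _)).
    by apply: measurable_funM => //; exact: (measurableT_comp (@measurable_sqn R n)).
  - by move=> y s; rewrite mulr_ge0 ?tpow_ge0 ?expR_ge0.
  - exact: measurable_funM.
  - move=> x x0; have q0 := sqn_gt0 x0; rewrite integral_tpow_expR_inv ?divr_gt0// tpowE//.
    congr (_ * _)%:E; rewrite powRM ?invr_ge0 ?ltW// mulrC; congr (_ * _).
    by rewrite -powR_inv1// -powRrM mulN1r opprK.
  - have := integrableRZl (Gamma (h - t) * 4 `^ (h - t) * (cos b * pi `^ h)) i2.
    rewrite (_ : (EFin \o _) = (EFin \o (fun x => Gamma (h - t) *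
      (4 `^ (h - t) * tpow (- (h - t)) (sqn x)) * (cos b * pi `^ h * f x))))//.
    apply/funext => x /=; congr EFin.
    exact/esym/alg5.
have e3 : (\int[leb]_y (Gamma t * tpow (- t) (sqn y) * fcos b f y)%:E =
   \int[leb]_x (Gamma (h - t) * (4 `^ (h - t) * tpow (- (h - t)) (sqn x)) *
      (cos b * pi `^ h * f x))%:E)%E.
  rewrite e1 e2; apply: eq_integral => s _; have [s0|s0] := leP s 0.
    by rewrite !integral0_eq// => x _; rewrite (tpow_le0 _ s0) !mul0r.
  rewrite !(tpowE _ s0).
  transitivity ((s `^ (t - 1))%:E * \int[leb]_y (expR (- (s * sqn y)) * fcos b f y)%:E)%E.
    rewrite -integralZl//; last first.
      have mg : measurable_fun setT (fun y : V => expR (- (s * sqn y)) * fcos b f y).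
        apply: measurable_funM; last exact: measurable_fcos.
        exact: integrableR_measurable (integrable_gauss_rV n s0).
      have [C C0 hC] := fcos_decay n0 sf.
      apply: (le_integrableR mg _ (integrableRZl C (integrable_japanese n0))) => y.
      rewrite normrM (ger0_norm (expR_ge0 _)); apply: le_trans (hC b y).
      by rewrite ler_piMl// expR_le1 oppr_le0 mulr_ge0 ?sqn_ge0// ltW.
    by apply: eq_integral => y _; rewrite -EFinM mulrA (mulrC s).
  rewrite integral_gauss_fcos// -integralZl//; last first.
    have mg : measurable_fun setT (fun x : V =>
        cos b * (pi `^ h * s `^ (- h)) * expR (- (sqn x / (4 * s))) * f x).
      apply: measurable_funM => //; apply: measurable_funM => //.
      apply: measurableT_comp => //; apply: measurableT_comp => //.
      by apply: measurable_funM => //; exact: measurable_sqn.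
    have fn : integrableR (fun x => `|f x|) by exact: integrable_norm.
    apply: (le_integrableR mg _ (integrableRZl (`|cos b * (pi `^ h * s `^ (- h))|) fn)) => x.
    rewrite normrM ler_wpM2r// normrM ler_piMr//.
    by rewrite (ger0_norm (expR_ge0 _)) expR_le1 oppr_le0 divr_ge0 ?sqn_ge0 ?mulr_ge0 ?ltW.
  apply: eq_integral => x _; rewrite -EFinM; congr EFin.
  have -> : s `^ (- (h - t) - 1) = s `^ (t - 1) * s `^ (- h).
    by rewrite -powRD; [congr (_ `^ _); lra|rewrite (gt_eqF s0) implybT].
  have -> : sqn x / 4 * s `^ (- 1) = sqn x / (4 * s).
    by rewrite powR_inv1 ?ltW// invfM mulrA.
  by ring.
have := congr1 fine e3; rewrite -!/(Rintegral _ _ _).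
set I := Rintegral _ _ _; set J := Rintegral _ _ _ => IJ.
have IE : I = Gamma t * \int[leb]_y (tpow (- t) (sqn y) * fcos b f y).
  by rewrite -RintegralZl//; apply: eq_Rintegral => y _; rewrite mulrA.
have JE : J = Gamma (h - t) * 4 `^ (h - t) * (cos b * pi `^ h) *
    \int[leb]_x (tpow (- (h - t)) (sqn x) * f x).
  rewrite -RintegralZl//; apply: eq_Rintegral => x _.
  exact: alg5.
apply: (mulfI (lt0r_neq0 Gt0)); rewrite -IE IJ JE.
have alg (a c d e g k : R) : a != 0 -> c * d * (e * g) * k = a * (e * (g * d * (c / a)) * k).
  by move=> a0; field.
exact: alg (lt0r_neq0 Gt0).
Qed.

End power_transform.

(** * Limits of complex-valued functions *)

Section complex_limits.
Context {R : realType}.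
Implicit Types (z w : R[i]).

Lemma complexReM z w : complex.Re (z * w) = complex.Re z * complex.Re w - complex.Im z * complex.Im w.
Proof. by case: z; case: w. Qed.

Lemma complexImM z w : complex.Im (z * w) = complex.Re z * complex.Im w + complex.Im z * complex.Re w.
Proof. by case: z; case: w. Qed.

Lemma complexReB z w : complex.Re (z - w) = complex.Re z - complex.Re w.
Proof. by case: z; case: w. Qed.

Lemma complexImB z w : complex.Im (z - w) = complex.Im z - complex.Im w.
Proof. by case: z; case: w. Qed.

Lemma complex_normE z : `|z| = (Normc.normc z)%:C.
Proof. by []. Qed.

Lemma normRe_le z : `|complex.Re z| <= Normc.normc z.
Proof.
case: z => a b /=; rewrite -sqrtr_sqr; apply: ler_wsqrtr.
by rewrite lerDl sqr_ge0.
Qed.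

Lemma normIm_le z : `|complex.Im z| <= Normc.normc z.
Proof.
case: z => a b /=; rewrite -sqrtr_sqr; apply: ler_wsqrtr.
by rewrite lerDr sqr_ge0.
Qed.

Lemma normc_le z : Normc.normc z <= `|complex.Re z| + `|complex.Im z|.
Proof.
case: z => a b /=; rewrite -[leRHS]ger0_norm ?addr_ge0// -sqrtr_sqr ler_wsqrtr//.
rewrite sqrrD !real_normK ?num_real// -addrA lerD2l lerDr mulrn_wge0// mulr_ge0//.
Qed.

Lemma cvg_complexP (T : Type) (F : set_system T) (FF : ProperFilter F) (f : T -> R[i]) (l : R[i]) :
  (f x : R[i]^o) @[x --> F] --> (l : R[i]^o) <->
  complex.Re (f x) @[x --> F] --> complex.Re l /\
  complex.Im (f x) @[x --> F] --> complex.Im l.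
Proof.
split=> [/cvgrPdist_lt h|[/cvgrPdist_lt hr /cvgrPdist_lt hi]].
  have h' (e : R) : 0 < e -> \forall x \near F, Normc.normc (l - f x) < e.
    move=> e0; have e0' : 0 < e%:C by rewrite ltcR.
    near=> x; rewrite -ltcR -complex_normE.
    by near: x; exact: h.
  split; apply/cvgrPdist_lt => e e0; near=> x.
    by rewrite -complexReB (le_lt_trans (normRe_le _))//; near: x; exact: h'.
  by rewrite -complexImB (le_lt_trans (normIm_le _))//; near: x; exact: h'.
apply/cvgrPdist_lt => e e0.
have [r -> {e0}r0] : exists2 r : R, e = r%:C & 0 < r.
  case: e e0 => a b; rewrite ltcE/= => /andP[/eqP -> a0].
  by exists a.
near=> x; rewrite complex_normE ltcR (le_lt_trans (normc_le _))// complexReB complexImB (splitr r) ltrD//.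
  by near: x; apply: hr; rewrite divr_gt0.
by near: x; apply: hi; rewrite divr_gt0.
Unshelve. all: by end_near. Qed.

End complex_limits.

(** * The inverse Fourier transform of a power of the norm *)

Section inverse_fourier_power.
Context {R : realType} {n : nat}.
Local Notation V := 'rV[R]_n.
Local Notation leb := (@lebesgue_rV R n).
Local Notation integrableR f := (leb.-integrable setT (EFin \o f)).
Local Notation h := (n%:R / 2 : R).
Hypothesis n0 : (0 < n)%N.
Implicit Types (x y : V) (b s t : R).

Let sinE (u : R) : sin u = cos (u - pi / 2).
Proof. by rewrite cosBpihalf. Qed.

Lemma Re_inverse_fourier (phi : V -> R[i]) x : schwartz phi ->
  complex.Re (inverse_fourier phi x) =
  (2 * pi) ^- n * (fcos 0 (fun y => complex.Re (phi y)) x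
                 - fcos (- (pi / 2)) (fun y => complex.Im (phi y)) x).
Proof.
move=> [sr si]; have ri := schwartz_integrable n0 sr; have ii := schwartz_integrable n0 si.
rewrite /inverse_fourier complexReM /= mul0r subr0; congr (_ * _).
rewrite /fcos -RintegralB//; try exact: integrable_cos_mul.
by apply: eq_Rintegral => y _; rewrite complexReM /= addr0 sinE.
Qed.

Lemma Im_inverse_fourier (phi : V -> R[i]) x : schwartz phi ->
  complex.Im (inverse_fourier phi x) =
  (2 * pi) ^- n * (fcos 0 (fun y => complex.Im (phi y)) x
                 + fcos (- (pi / 2)) (fun y => complex.Re (phi y)) x).
Proof.
move=> [sr si]; have ri := schwartz_integrable n0 sr; have ii := schwartz_integrable n0 si.
rewrite /inverse_fourier complexImM /= mul0r addr0; congr (_ * _).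
rewrite /fcos -RintegralD//; try exact: integrable_cos_mul.
by apply: eq_Rintegral => y _; rewrite complexImM /= addr0 sinE.
Qed.

(** The constant of [integral_tpow_fcos], normalised by [(2 pi)^(-n)]. *)
Lemma P0E t : 0 < t < h ->
  P0 n t = (2 * pi) ^- n * (pi `^ h * 4 `^ (h - t) * (Gamma (h - t) / Gamma t)).
Proof.
move=> /andP[t0 th]; rewrite /P0 (_ : (n%:R - 2 * t) / 2 = h - t); last by lra.
rewrite !mulrA; congr (_ * _ * _).
have p0 : 0 < pi :> R := pi_gt0 R; have p00 := lt0r_neq0 p0.
have -> : (2 * pi) ^- n = 4 `^ (- h) * pi `^ (- n%:R) :> R.
  rewrite exprMn invfM; congr (_ * _); last by rewrite powR_invn// ltW.
  have -> : 4 = 2 `^ 2 :> R by rewrite powR_mulrn//; lra.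
  by rewrite -powRrM mulrN mulrCA divff// mulr1 powR_invn.
have powD (a b c : R) : 0 < a -> a `^ b * a `^ c = a `^ (b + c).
  by move=> a0; rewrite powRD// (gt_eqF a0) implybT.
rewrite -(mulrA (4 `^ _)) powD// mulrAC powD// mulrC.
by congr (_ `^ _ * _ `^ _); lra.
Qed.

Lemma measurable_enorm : measurable_fun setT (@enorm R n).
Proof.
have -> : @enorm R n = fun x => sqn x `^ 2^-1.
  by apply/funext => x; rewrite powR12_sqrt// sqn_ge0.
by apply: (measurableT_comp (f := fun s : R => s `^ 2^-1)) => //; exact: measurable_sqn.
Qed.

(** The weight [(1 + |x|)^(-2n)] is integrable at infinity. *)
Lemma tempered_power a : 0 < a < h ->
  tempered_function (fun x : V => (enorm x `^ (2 * - a))%:C).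
Proof.
move=> ah; have /andP[a0 _] := ah.
have na0 : - a != 0 by rewrite oppr_eq0 gt_eqF.
exists (2 * n)%N; split; last first.
  by under eq_fun do rewrite complexImM /= mul0r mulr0 addr0; exact: integrable0.
under eq_fun do rewrite complexReM /= mul0r subr0 enorm_powR//.
apply: (le_integrableR _ _ (integrable_tpow_japanese n0 ah)).
  apply: measurable_funM; last exact: measurable_tpow_sqn.
  apply: (eq_measurable_fun (fun x : V => (1 + enorm x) `^ (- (2 * n)%:R))).
    by move=> x _; rewrite powR_invn// addr_ge0// enorm_ge0.
  apply: (measurableT_comp (f := fun s : R => s `^ (- (2 * n)%:R)) (g := fun x : V => 1 + enorm x)).
    exact: measurable_powR.
  by apply: measurable_funD => //; exact: measurable_enorm.
move=> x; have e0 := enorm_ge0 x; have q0 := sqn_ge0 x.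
rewrite ger0_norm ?mulr_ge0 ?tpow_ge0 ?invr_ge0 ?exprn_ge0 ?addr_ge0//.
rewrite mulrC ler_wpM2l ?tpow_ge0// lef_pV2 ?posrE ?exprn_gt0 ?ltr_wpDr//.
rewrite exprM lerXn2r ?nnegrE ?exprn_ge0 ?addr_ge0// -enorm_sqn.
by nra.
Qed.

Lemma tempered_functionZ (k : R) (f : V -> R[i]) :
  tempered_function f -> tempered_function (fun x => k%:C * f x).
Proof.
move=> [m [fr fi]]; exists m; split.
  have := integrableRZl k fr; congr (leb.-integrable setT _).
  by apply/funext => x /=; congr EFin; rewrite !complexReM/=; ring.
have := integrableRZl k fi; congr (leb.-integrable setT _).
by apply/funext => x /=; congr EFin; rewrite !complexImM !complexReM/=; ring.
Qed.

(** In the real and imaginary parts of the Fourier integral, the sine transform is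
    [fcos (- pi / 2)]; the factor [cos b] in [integral_tpow_fcos] makes it vanish
    against the even function [|y|^(-2t)]. *)
Lemma is_inverse_fourier_power t : 0 < t < h ->
  is_inverse_fourier (fun x : V => (enorm x `^ (- (2 * t)))%:C)
    (fun x => (P0 n t * enorm x `^ (2 * t - n%:R))%:C).
Proof.
move=> th; have /andP[t0 t1] := th.
have th' : 0 < h - t < h by apply/andP; split; lra.
have /andP[t0' _] := th'.
have e1 : - (2 * t) = 2 * - t by rewrite mulrN.
have e2 : 2 * t - n%:R = 2 * - (h - t) by lra.
have nt0 : - t != 0 by rewrite oppr_eq0 gt_eqF.
have nt0' : - (h - t) != 0 by rewrite oppr_eq0 gt_eqF.
split.
- by rewrite e1; exact: tempered_power.
- rewrite e2 (_ : (fun x => _) = fun x => (P0 n t)%:C * (enorm x `^ (2 * - (h - t)))%:C).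
    by apply: tempered_functionZ; exact: tempered_power.
  by apply/funext => x; rewrite rmorphM.
move=> phi sphi; have [sr si] := sphi.
have i1 := schwartz_tpow_integrable n0 sr th'; have i2 := schwartz_tpow_integrable n0 si th'.
rewrite /inverse_fourier_distribution /regular_distribution /integralC e1 e2.
have c0 : cos (- (pi / 2)) = 0 :> R by rewrite cosN cos_pihalf.
have j b f (sf : schwartzR f) := schwartz_fcos_tpow_integrable n0 b sf th.
congr (_ +i* _).
- transitivity (P0 n t * \int[leb]_x (tpow (- (h - t)) (sqn x) * complex.Re (phi x))).
    rewrite -RintegralZl//; apply: eq_Rintegral => x _.
    by rewrite complexReM /= mul0r subr0 enorm_powR// mulrA.
  transitivity ((2 * pi) ^- n * (\int[leb]_x (tpow (- t) (sqn x) * fcos 0 (fun y => complex.Re (phi y)) x) -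
      \int[leb]_x (tpow (- t) (sqn x) * fcos (- (pi / 2)) (fun y => complex.Im (phi y)) x))).
    by rewrite !integral_tpow_fcos// c0 cos0 !mul0r subr0 mul1r P0E// [RHS]mulrA.
  rewrite -RintegralB//; try exact: j.
  rewrite -RintegralZl//; last by apply: integrableRB; exact: j.
  apply: eq_Rintegral => x _.
  by rewrite complexReM (Re_inverse_fourier x sphi) /= mul0r subr0 enorm_powR//; ring.
- transitivity (P0 n t * \int[leb]_x (tpow (- (h - t)) (sqn x) * complex.Im (phi x))).
    rewrite -RintegralZl//; apply: eq_Rintegral => x _.
    by rewrite complexImM /= mul0r addr0 enorm_powR// mulrA.
  transitivity ((2 * pi) ^- n * (\int[leb]_x (tpow (- t) (sqn x) * fcos 0 (fun y => complex.Im (phi y)) x) +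
      \int[leb]_x (tpow (- t) (sqn x) * fcos (- (pi / 2)) (fun y => complex.Re (phi y)) x))).
    by rewrite !integral_tpow_fcos// c0 cos0 !mul0r addr0 mul1r P0E// [RHS]mulrA.
  rewrite -RintegralD//; try exact: j.
  rewrite -RintegralZl//; last by apply: integrableRD; exact: j.
  apply: eq_Rintegral => x _.
  by rewrite complexImM (Im_inverse_fourier x sphi) /= mul0r addr0 enorm_powR//; ring.
Qed.

Lemma continuous_enorm_powR a x : x != 0 -> {for x, continuous (fun x : V => enorm x `^ a)}.
Proof.
move=> x0; have e0 := enorm_gt0 x0.
have -> : (fun x : V => enorm x `^ a) = (fun s : R => s `^ (2^-1 * a)) \o @sqn R n.
  by apply/funext => y /=; rewrite powRrM powR12_sqrt// sqn_ge0.
apply: continuous_comp; first exact: continuous_sqn.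
have [d _] := is_derive1_powR (2^-1 * a) (sqn_gt0 x0).
by apply: differentiable_continuous; apply/derivable1_diffP.
Qed.

Lemma log_diffusion_kernel_power :
  log_diffusion_kernel (fun t (x : V) => (P0 n t * enorm x `^ (2 * t - n%:R))%:C).
Proof.
move=> t th; split; first exact: is_inverse_fourier_power.
move=> x x0; apply/(@cvg_complexP _ _ (nbhs x)); split => /=.
  by apply: cvgM; [exact: cvg_cst|exact: continuous_enorm_powR].
exact: cvg_cst.
Qed.

End inverse_fourier_power.

(** * A continuous function is determined by its integrals against Gaussians *)

Section gaussian_test.
Context {R : realType} {n : nat}.
Local Notation V := 'rV[R]_n.
Local Notation leb := (@lebesgue_rV R n).
Local Notation integrableR f := (leb.-integrable setT (EFin \o f)).
Local Notation h := (n%:R / 2 : R).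
Implicit Types (x y a : V) (s : R).

Lemma measurable_gaussian s a : measurable_fun setT (gaussian s a).
Proof. by apply: continuous_measurable_rV; exact: continuous_gaussian. Qed.

Lemma integrable_gaussian s a : 0 < s -> integrableR (gaussian s a).
Proof. by move=> s0; exact: (integrable_shift (- a) (integrable_gauss_rV n s0)). Qed.

Lemma Rintegral_gaussian s a : 0 < s -> \int[leb]_x gaussian s a x = pi `^ h * s `^ (- h).
Proof.
move=> s0; apply: EFin_inj; rewrite -integral_gauss_rV_powR// /Rintegral fineK; last first.
  exact: (integrable_fin_num measurableT (integrable_gaussian a s0)).
rewrite -(integral_shift_rV (- a) (f := fun x => expR (- (s * sqn x))))//.
exact: integrableR_measurable (integrable_gauss_rV n s0).
Qed.

Lemma ball_sqn a x (r : R) : 0 < r -> sqn (x - a) < r ^+ 2 -> ball a r x.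
Proof.
move=> r0 xr; split=> // i j; rewrite (ord1 i) /ball /= distrC.
rewrite -(@ltr_pXn2r _ 2)// ?nnegrE ?(ltW r0)// real_normK ?num_real//.
apply: le_lt_trans xr; rewrite /sqn (bigD1 j)//= !mxE lerDl.
by apply: sumr_ge0 => k _; exact: sqr_ge0.
Qed.

(** As [s] grows, the mass of [gaussian s a] concentrates at [a]: at distance at
    least [r] from [a] it is below [e^(-(s-1)r^2)] times [gaussian 1 a], against
    which [d] is integrable, while its integral decreases like [s^(-n/2)] only. *)
Lemma gaussian_test (d : V -> R) a :
  (forall s, 0 < s -> integrableR (fun x => d x * gaussian s a x)) ->
  (forall s, 0 < s -> \int[leb]_x (d x * gaussian s a x) = 0) ->
  {for a, continuous d} -> d a = 0.
Proof.
move=> di d0 dc; apply/eqP; rewrite -normr_le0; apply/ler_addgt0Pr => e e0; rewrite add0r.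
have e20 : 0 < e / 2 by rewrite divr_gt0.
have [r r0 hr] : exists2 r, 0 < r & forall x, sqn (x - a) < r ^+ 2 -> `|d a - d x| <= e / 2.
  move/cvgrPdist_le : dc => /(_ _ e20) /nbhs_ballP[r /= r0 hr].
  exists r => // x xr; apply: hr.
  exact: ball_sqn.
pose D x := d a - d x.
have Di s : 0 < s -> integrableR (fun x => D x * gaussian s a x).
  move=> s0; have := integrableRB (integrableRZl (d a) (integrable_gaussian a s0)) (di s s0).
  by under eq_fun do rewrite -mulrBl.
have DGn s x : `|D x * gaussian s a x| = `|D x| * gaussian s a x.
  by rewrite normrM (ger0_norm (expR_ge0 _)).
have Dni s : 0 < s -> integrableR (fun x => `|D x| * gaussian s a x).
  move=> s0; have DGi : integrableR (fun x => `|D x * gaussian s a x|).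
    exact: integrable_norm (Di s s0).
  by move: DGi; under eq_fun do rewrite DGn.
pose M := \int[leb]_x (`|D x| * gaussian 1 a x).
have M0 : 0 <= M by apply: Rintegral_ge0 => x _; rewrite mulr_ge0 ?expR_ge0.
have r20 : 0 < r ^+ 2 by rewrite exprn_gt0.
have key s : 1 <= s -> `|d a| * (pi `^ h * s `^ (- h)) <=
    e / 2 * (pi `^ h * s `^ (- h)) + expR (- ((s - 1) * r ^+ 2)) * M.
  move=> s1; have s0 : 0 < s by exact: lt_le_trans s1.
  have Gi := integrable_gaussian a s0.
  have -> : `|d a| * (pi `^ h * s `^ (- h)) = `|\int[leb]_x (D x * gaussian s a x)|.
    rewrite -(Rintegral_gaussian a s0) -[X in `|_| * X]ger0_norm; last first.
      by apply: Rintegral_ge0 => x _; exact: expR_ge0.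
    rewrite -normrM -RintegralZl// -[X in `|X| = _]subr0 -(d0 _ s0) -RintegralB//; last 2 first.
    - exact: integrableRZl.
    - exact: di.
    by congr `|_|; apply: eq_Rintegral => x _; rewrite mulrBl.
  apply: le_trans (le_normr_Rintegral measurableT (Di s s0)) _.
  rewrite -(Rintegral_gaussian a s0) /M -!RintegralZl//; last exact: Dni.
  rewrite -RintegralD//; last 2 first.
  - exact: integrableRZl.
  - by apply: integrableRZl; exact: Dni.
  apply: le_Rintegral => //.
  - exact: integrable_norm (Di s s0).
  - by apply: integrableRD; apply: integrableRZl => //; exact: Dni.
  move=> x _; rewrite normrM (ger0_norm (expR_ge0 _)).
  have g0 (z : R) : 0 <= gaussian z a x by exact: expR_ge0.
  have [xr|xr] := ltP (sqn (x - a)) (r ^+ 2).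
    rewrite -[leLHS]addr0 lerD ?mulr_ge0 ?expR_ge0// ler_wpM2r//.
    exact: hr.
  rewrite -[leLHS]add0r lerD ?mulr_ge0 ?(ltW e0)//.
  rewrite mulrCA ler_wpM2l// /gaussian -expRD ler_expR.
  have : (s - 1) * r ^+ 2 <= (s - 1) * sqn (x - a) by rewrite ler_wpM2l// subr_ge0.
  by lra.
have [C C0 hC] := expR_decay r20 n.+1.
(* [K / (1 + s)] will bound the contribution of the points far from [a], relative
   to the mass of [gaussian s a] *)
pose K := expR (r ^+ 2) * M * C / pi `^ h.
have K0 : 0 <= K by rewrite !mulr_ge0 ?expR_ge0 ?invr_ge0 ?powR_ge0.
pose s := 1 + K / (e / 2); have Ke0 : 0 <= K / (e / 2) by exact: (divr_ge0 K0 (ltW e20)).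
have s1 : 1 <= s by rewrite lerDl.
have s0 : 0 < s by exact: lt_le_trans s1.
have s00 := ltW s0.
have sp1 : 0 < 1 + s by exact: addr_gt0.
have sp10 := ltW sp1.
have p0 : 0 < pi `^ h * s `^ (- h) by rewrite mulr_gt0 ?powR_gt0 ?pi_gt0.
rewrite -(ler_pM2r p0); apply: (le_trans (key s s1)).
rewrite [X in _ <= X * _](splitr e) [leRHS]mulrDl lerD2l.
rewrite -ler_pdivrMr//.
have shn : s `^ h <= (1 + s) ^+ n.
  apply: (@le_trans _ _ (s `^ n%:R)).
    rewrite ler_powR// ler_pdivrMr// ler_peMr//; lra.
  by rewrite powR_mulrn// lerXn2r ?nnegrE ?addr_ge0// lerDr.
have E : expR (- ((s - 1) * r ^+ 2)) * M / (pi `^ h * s `^ (- h)) =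
    expR (r ^+ 2) * M / pi `^ h * (s `^ h * expR (- (r ^+ 2 * s))).
  rewrite (_ : - ((s - 1) * r ^+ 2) = r ^+ 2 + - (r ^+ 2 * s)); last by ring.
  by rewrite expRD powRN invfM invrK; ring.
rewrite E.
have sC : s `^ h * expR (- (r ^+ 2 * s)) <= C / (1 + s).
  rewrite (ler_pdivlMr _ _ sp1); apply: (le_trans _ (hC s s00)).
  by rewrite mulrAC ler_wpM2r ?expR_ge0// exprSr ler_wpM2r.
apply: (@le_trans _ _ (expR (r ^+ 2) * M / pi `^ h * (C / (1 + s)))).
  by rewrite ler_wpM2l// !mulr_ge0 ?expR_ge0 ?invr_ge0 ?powR_ge0.
rewrite (_ : _ * (C / _) = K / (1 + s)); last by rewrite /K; ring.
rewrite (ler_pdivrMr _ _ sp1).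
have : e / 2 * (K / (e / 2)) = K by rewrite mulrCA divff ?gt_eqF// mulr1.
rewrite -/(s); move: Ke0; rewrite /s; set z := K / (e / 2) => z0 <-.
by rewrite ler_wpM2l ?ltW//; lra.
Qed.

End gaussian_test.

Section tempered_uniqueness.
Context {R : realType} {n : nat}.
Local Notation V := 'rV[R]_n.
Local Notation leb := (@lebesgue_rV R n).
Local Notation integrableR f := (leb.-integrable setT (EFin \o f)).
Implicit Types (x y a : V) (s : R).

Let tempered_measurable (w : V -> R) m :
  integrableR (fun x => (1 + enorm x) ^- m * w x) -> measurable_fun setT w.
Proof.
move=> wi; have mp : measurable_fun setT (fun x : V => (1 + enorm x) ^+ m).
  by apply: measurable_funX; apply: measurable_funD => //; exact: measurable_enorm.
have := measurable_funM mp (integrableR_measurable wi); congr (measurable_fun setT _).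
apply/funext => x /=; rewrite mulrA mulfV ?mul1r//.
by rewrite expf_neq0// gt_eqF// ltr_wpDr ?enorm_ge0.
Qed.

Let tempered_ReIm (f : V -> R[i]) : tempered_function f -> exists m,
  integrableR (fun x => (1 + enorm x) ^- m * complex.Re (f x)) /\
  integrableR (fun x => (1 + enorm x) ^- m * complex.Im (f x)).
Proof.
move=> [m [fr fi]]; exists m; split.
  by move: fr; under eq_fun do rewrite complexReM /= mul0r subr0.
by move: fi; under eq_fun do rewrite complexImM /= mul0r addr0.
Qed.

Lemma tempered_function_measurable (f : V -> R[i]) : tempered_function f ->
  measurable_fun setT (fun x => complex.Re (f x)) /\
  measurable_fun setT (fun x => complex.Im (f x)).
Proof. by move=> /tempered_ReIm[m [fr fi]]; split; [move: fr|move: fi] => /tempered_measurable. Qed.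

(** A tempered function is integrable against a Gaussian, which decays faster than
    any power of the norm. *)
Let tempered_gaussian (w : V -> R) m s a : 0 < s ->
  integrableR (fun x => (1 + enorm x) ^- m * w x) ->
  integrableR (fun x => w x * gaussian s a x).
Proof.
move=> s0 wi; have p0 x : 0 < 1 + enorm x by rewrite ltr_wpDr ?enorm_ge0.
have mw := tempered_measurable wi.
have [_ sG] := schwartz_gaussian a s0.
have [C0 hC0] := sG [::] 0%N; have [C1 hC1] := sG [::] m.
have mwG : measurable_fun setT (fun x => w x * gaussian s a x).
  by apply: measurable_funM => //; exact: measurable_gaussian.
have wn : integrableR (fun x => `|(1 + enorm x) ^- m * w x|) by exact: integrable_norm.
apply: (le_integrableR mwG _ (integrableRZl (2 ^+ m * (C0 + C1)) wn)) => x.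
have G0 : 0 <= gaussian s a x by exact: expR_ge0.
have := hC0 x; rewrite expr0 mul1r /= (ger0_norm G0) => h0.
have := hC1 x; rewrite /= (ger0_norm G0) => h1.
have e0 := enorm_ge0 x; have pm0 : 0 < (1 + enorm x) ^+ m by rewrite exprn_gt0.
have pV0 : 0 <= (1 + enorm x) ^- m by rewrite invr_ge0 ltW.
rewrite normrM (ger0_norm G0) normrM (ger0_norm pV0).
rewrite [leRHS]mulrA [leRHS]mulrC ler_wpM2l// ler_pdivlMr// mulrC.
have pe : (1 + enorm x) ^+ m <= 2 ^+ m * (1 + enorm x ^+ m).
  have [u1|u1] := leP (enorm x) 1.
    apply: (@le_trans _ _ (2 ^+ m)); first by rewrite lerXn2r ?nnegrE ?addr_ge0//; lra.
    by rewrite ler_peMr ?exprn_ge0// lerDl exprn_ge0.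
  apply: (@le_trans _ _ ((2 * enorm x) ^+ m)).
    by rewrite lerXn2r ?nnegrE ?addr_ge0 ?mulr_ge0//; lra.
  by rewrite exprMn ler_wpM2l ?exprn_ge0// lerDr.
apply: (le_trans (ler_wpM2r G0 pe)).
by rewrite -mulrA ler_wpM2l ?exprn_ge0// mulrDl mul1r lerD.
Qed.

Let schwartz_gaussianC s a : 0 < s -> schwartz (fun x => (gaussian s a x)%:C).
Proof.
move=> s0; split => /=; first exact: schwartz_gaussian.
have p0 (l : seq 'I_n) : partials l (fun _ : V => 0 : R) = (fun _ => 0).
  by elim: l => //= i l ->; apply/funext => x; exact: derive_cst.
split=> [l|l k]; rewrite p0.
  by split; [exact: cst_continuous|move=> x i; exact: derivable_cst].
by exists 0 => x; rewrite normr0 mulr0.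
Qed.

Let tempered_gaussianC (f : V -> R[i]) s a : 0 < s -> tempered_function f ->
  [/\ integrableR (fun x => complex.Re (f x) * gaussian s a x),
      integrableR (fun x => complex.Im (f x) * gaussian s a x) &
      regular_distribution f (fun x => (gaussian s a x)%:C) =
      (\int[leb]_x (complex.Re (f x) * gaussian s a x)) +i*
      (\int[leb]_x (complex.Im (f x) * gaussian s a x))].
Proof.
move=> s0 /tempered_ReIm[m [fr fi]]; split; try exact: (tempered_gaussian a s0 (m := m)).
rewrite /regular_distribution /integralC; congr (_ +i* _); apply: eq_Rintegral => x _.
  by rewrite complexReM /= mulr0 subr0.
by rewrite complexImM /= mulr0 add0r.
Qed.

Lemma tempered_eq (f g : V -> R[i]) a : tempered_function f -> tempered_function g ->
  (forall phi, schwartz phi -> regular_distribution f phi = regular_distribution g phi) ->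
  {for a, continuous (f : V -> R[i]^o)} -> {for a, continuous (g : V -> R[i]^o)} ->
  f a = g a.
Proof.
move=> tf tg fg /(@cvg_complexP _ _ (nbhs a))[cfr cfi] /(@cvg_complexP _ _ (nbhs a))[cgr cgi].
have [dr di] : (forall s, 0 < s ->
     integrableR (fun x => (complex.Re (f x) - complex.Re (g x)) * gaussian s a x) /\
     \int[leb]_x ((complex.Re (f x) - complex.Re (g x)) * gaussian s a x) = 0) /\
   (forall s, 0 < s ->
     integrableR (fun x => (complex.Im (f x) - complex.Im (g x)) * gaussian s a x) /\
     \int[leb]_x ((complex.Im (f x) - complex.Im (g x)) * gaussian s a x) = 0).
  split=> s s0; have [fr fi fE] := tempered_gaussianC a s0 tf;
    have [gr gi gE] := tempered_gaussianC a s0 tg;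
    have := fg _ (schwartz_gaussianC a s0); rewrite fE gE => -[Er Ei].
    split; first by have := integrableRB fr gr; under eq_fun do rewrite -mulrBl.
    by under eq_Rintegral do rewrite mulrBl; rewrite RintegralB// Er subrr.
  split; first by have := integrableRB fi gi; under eq_fun do rewrite -mulrBl.
  by under eq_Rintegral do rewrite mulrBl; rewrite RintegralB// Ei subrr.
have r0 : complex.Re (f a) - complex.Re (g a) = 0.
  apply: (gaussian_test (d := fun x => complex.Re (f x) - complex.Re (g x))).
  - by move=> s /dr[].
  - by move=> s /dr[].
  - exact: (cvgB cfr cgr).
have i0 : complex.Im (f a) - complex.Im (g a) = 0.
  apply: (gaussian_test (d := fun x => complex.Im (f x) - complex.Im (g x))).
  - by move=> s /di[].
  - by move=> s /di[].
  - exact: (cvgB cfi cgi).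
move: r0 i0 => /eqP; rewrite subr_eq0 => /eqP r0 /eqP; rewrite subr_eq0 => /eqP i0.
by move: r0 i0; case: (f a) => ? ?; case: (g a) => ? ? /= -> ->.
Qed.

End tempered_uniqueness.

(** * The constant as a function of time *)

Section constant.
Context {R : realType} {n : nat}.
Local Notation h := (n%:R / 2 : R).
Hypothesis n0 : (0 < n)%N.
Implicit Types (t : R).

Let h0 : 0 < h. Proof. by rewrite divr_gt0// ltr0n. Qed.

Let P0_half t : P0 n t = pi `^ (- h) * 4 `^ (- t) * (Gamma (h - t) / Gamma t).
Proof. by rewrite /P0 (_ : (n%:R - 2 * t) / 2 = h - t)//; lra. Qed.

Lemma P0_gt0 t : 0 < t < h -> 0 < P0 n t.
Proof.
move=> /andP[t0 th]; have ht0 : 0 < h - t by rewrite subr_gt0.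
by rewrite P0_half !mulr_gt0 ?invr_gt0 ?powR_gt0 ?pi_gt0 ?Gamma_gt0.
Qed.

Lemma continuous_powR_exponent (a : R) : 0 < a -> continuous (fun u : R => a `^ u).
Proof.
move=> a0 u; have -> : (fun u => a `^ u) = fun u => expR (u * ln a).
  by apply/funext => v; rewrite /powR gt_eqF.
apply: (@continuous_comp _ _ _ (fun u : R => u * ln a) expR); last exact: continuous_expR.
by apply: cvgM; [exact: cvg_id|exact: cvg_cst].
Qed.

Let cvg_affine (c k t : R) : c + k * u @[u --> t] --> c + k * t.
Proof. by apply: cvgD; [exact: cvg_cst|apply: cvgM; [exact: cvg_cst|exact: cvg_id]]. Qed.

Lemma cvg_Gamma_affine (c k t : R) : 0 < c + k * t ->
  Gamma (c + k * u) @[u --> t] --> Gamma (c + k * t).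
Proof.
move=> c0; apply: (@continuous_comp _ _ _ (fun u => c + k * u) Gamma).
  exact: cvg_affine.
exact: continuous_Gamma.
Qed.

Lemma cvg_powR_affine (a c k t : R) : 0 < a ->
  a `^ (c + k * u) @[u --> t] --> a `^ (c + k * t).
Proof.
move=> a0; apply: (@continuous_comp _ _ _ (fun u => c + k * u) (powR a)).
  exact: cvg_affine.
exact: continuous_powR_exponent.
Qed.

Lemma near_at_left_half : \forall t \near h^'-, 0 < t < h.
Proof.
near=> t; apply/andP; split; first by near: t; exact: nbhs_left_gt.
by near: t; exact: nbhs_left_lt.
Unshelve. all: by end_near. Qed.

Lemma near_at_right_0 (e : R) : 0 < e -> \forall t \near (0 : R)^'+, 0 < t < e.
Proof.
move=> e0; near=> t; apply/andP; split; first by near: t; exact: nbhs_right_gt.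
by near: t; exact: nbhs_right_lt.
Unshelve. all: by end_near. Qed.

(** The factor [n - 2t] cancels the simple pole of [Gamma ((n - 2t) / 2)] at
    [t = n/2], by the functional equation. *)
Lemma P0_cvg_half :
  (n%:R - 2 * t) * P0 n t @[t --> h^'-] --> 2 / ((4 * pi) `^ h * Gamma h).
Proof.
pose G t := pi `^ (- h) * 4 `^ (0 + -1 * t) * (2 * (Gamma (h + 1 + -1 * t) * (Gamma (0 + 1 * t))^-1)).
have GE t : 0 < t < h -> (n%:R - 2 * t) * P0 n t = G t.
  move=> /andP[t0 th]; have ht0 : 0 < h - t by rewrite subr_gt0.
  rewrite P0_half /G mul1r !add0r mulN1r addrAC GammaS//.
  have -> : n%:R - 2 * t = 2 * (h - t) by lra.
  have alg (a b c d e : R) : 2 * a * (b * c * (d / e)) = b * c * (2 * (a * d * e^-1)).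
    by rewrite !mulrA; ring.
  exact: alg.
have Gh : G h = 2 / ((4 * pi) `^ h * Gamma h).
  rewrite /G mul1r !add0r mulN1r addrAC subrr add0r Gamma1 mul1r.
  rewrite powRM ?pi_ge0// !powRN mulrCA; congr (_ * _).
  by rewrite !invfM; congr (_ * _); rewrite mulrC.
rewrite -Gh; apply: (@cvg_trans _ (G t @[t --> h^'-])).
  apply: near_eq_cvg; near=> t; rewrite GE//.
  by near: t; exact: near_at_left_half.
apply: cvg_at_left_filter; apply: cvgM.
  by apply: cvgM; [exact: cvg_cst|exact: cvg_powR_affine].
apply: cvgM; first exact: cvg_cst.
apply: cvgM; first by apply: cvg_Gamma_affine; lra.
apply: cvgV; first by rewrite add0r mul1r gt_eqF// Gamma_gt0.
by apply: cvg_Gamma_affine; rewrite add0r mul1r.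
Unshelve. all: by end_near. Qed.

(** Here the pole of [Gamma] at [0] is in the denominator. *)
Lemma P0_cvg_0 : P0 n t @[t --> (0 : R)^'+] --> (0 : R).
Proof.
pose G t := pi `^ (- h) * 4 `^ (0 + -1 * t) * (Gamma (h + -1 * t) * (t * (Gamma (1 + 1 * t))^-1)).
have GE t : 0 < t -> P0 n t = G t.
  move=> t0; have Gt0 := Gamma_gt0 t0.
  rewrite P0_half /G mul1r !add0r mulN1r (addrC 1) GammaS//.
  by congr (_ * (_ * _)); rewrite invfM mulrA mulfV ?mul1r// gt_eqF.
have G0 : G 0 = 0 by rewrite /G mul0r !mulr0.
rewrite -[X in _ --> X]G0; apply: (@cvg_trans _ (G t @[t --> (0 : R)^'+])).
  by apply: near_eq_cvg; near=> t; rewrite GE//.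
apply: cvg_at_right_filter; apply: cvgM.
  by apply: cvgM; [exact: cvg_cst|exact: cvg_powR_affine].
apply: cvgM; first by apply: cvg_Gamma_affine; rewrite mulr0 addr0.
apply: cvgM; first exact: cvg_id.
have e1 : 1 + 1 * 0 = 1 :> R by rewrite mulr0 addr0.
apply: cvgV; first by rewrite e1 Gamma1 oner_eq0.
by apply: cvg_Gamma_affine; rewrite e1.
Unshelve. all: by end_near. Qed.

End constant.

(** * The delta function as a limit of powers *)

Section approximate_identity.
Context {R : realType} {n : nat}.
Local Notation V := 'rV[R]_n.
Local Notation leb := (@lebesgue_rV R n).
Local Notation integrableR f := (leb.-integrable setT (EFin \o f)).
Local Notation h := (n%:R / 2 : R).
Hypothesis n0 : (0 < n)%N.
Implicit Types (t : R) (x : V) (f : V -> R).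

Let h0 : 0 < h. Proof. by rewrite divr_gt0// ltr0n. Qed.

Let Rintegral_tpow_gauss a : 0 < a < h ->
  \int[leb]_x (tpow (- a) (sqn x) * expR (- sqn x)) = pi `^ h * Gamma (h - a) / Gamma h.
Proof. by move=> ah; rewrite /Rintegral integral_tpow_gauss_rV. Qed.

(** The Gaussian mean of the kernel, which tends to [1] as [t] tends to [0]. *)
Let A t := 4 `^ (0 + -1 * t) * (Gamma (h + -1 * t) / Gamma h).

Let cvgA : A t @[t --> (0 : R)^'+] --> (1 : R).
Proof.
have <- : A 0 = 1.
  by rewrite /A mulr0 !addr0 powRr0 mul1r divff// gt_eqF// Gamma_gt0.
apply: cvg_at_right_filter; apply: cvgM; first exact: cvg_powR_affine.
apply: cvgM; last exact: cvg_cst.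
by apply: cvg_Gamma_affine; rewrite mulr0 addr0.
Qed.

Let integral_A t : 0 < t < h ->
  P0 n t * \int[leb]_x (tpow (- (h - t)) (sqn x) * expR (- sqn x)) = A t.
Proof.
move=> /andP[t0 th]; rewrite Rintegral_tpow_gauss; last by apply/andP; split; lra.
rewrite (_ : h - (h - t) = t); last by lra.
rewrite /A add0r mulN1r /P0 (_ : (n%:R - 2 * t) / 2 = h - t); last by lra.
have Gt0 := lt0r_neq0 (Gamma_gt0 t0).
have p0 : pi `^ h != 0 :> R by rewrite gt_eqF// powR_gt0// pi_gt0.
rewrite (powRN pi).
have alg (p q a b c : R) : p != 0 -> b != 0 -> p^-1 * q * (a / b) * (p * b * c) = q * (a * c).
  by move=> ? ?; field; apply/andP.
exact: alg.
Qed.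

(** The mean of [|x|^(1/2)] with respect to the kernel with a Gaussian cut-off. *)
Let B t := P0 n t * (pi `^ h * Gamma (4^-1 + 1 * t) / Gamma h).

Let cvgB : B t @[t --> (0 : R)^'+] --> (0 : R).
Proof.
rewrite -[X in _ --> X](mul0r (pi `^ h * Gamma (4^-1 + 1 * 0) / Gamma h)).
apply: cvgM; first exact: P0_cvg_0.
apply: cvg_at_right_filter; apply: cvgM; last exact: cvg_cst.
apply: cvgM; first exact: cvg_cst.
by apply: cvg_Gamma_affine; rewrite mulr0 addr0 invr_gt0.
Qed.

Let integral_B t : 0 < t < 4^-1 ->
  integrableR (fun x => tpow (- (h - t)) (sqn x) * (tpow 4^-1 (sqn x) * expR (- sqn x))) /\
  P0 n t * \int[leb]_x (tpow (- (h - t)) (sqn x) * (tpow 4^-1 (sqn x) * expR (- sqn x))) = B t.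
Proof.
move=> /andP[t0 t4].
have h1 : 2^-1 <= h by rewrite -[leLHS]mul1r ler_pM2r ?invr_gt0// ler1n.
have ab : 0 < h - t - 4^-1 < h by apply/andP; split; lra.
have E : (fun x => tpow (- (h - t)) (sqn x) * (tpow 4^-1 (sqn x) * expR (- sqn x))) =
    (fun x => tpow (- (h - t - 4^-1)) (sqn x) * expR (- sqn x)).
  apply/funext => x; rewrite mulrA -tpowD; congr (tpow _ _ * _); lra.
rewrite E; split; first exact: integrable_tpow_gauss.
have Ea : h - (h - t - 4^-1) = 4^-1 + t by lra.
by rewrite (Rintegral_tpow_gauss ab) Ea /B mul1r.
Qed.

Let continuous_expsqn f : continuous f -> continuous (fun x => f x * expR (sqn x)).
Proof.
move=> cf x.
exact: (cvgM (cf x) (continuous_comp (@continuous_sqn R n x) (@continuous_expR R (sqn x)))).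
Qed.

(** Near the origin [f e^(|x|^2)] is close to its value [f 0] there; elsewhere
    [|x|^(1/2)] is bounded below. *)
Let local_bound f W (e : R) : continuous f -> (forall x, `|f x * expR (sqn x)| <= W) -> 0 < e ->
  exists2 C, 0 <= C & forall x, `|f x * expR (sqn x) - f 0| <= e + C * tpow 4^-1 (sqn x).
Proof.
move=> cf fW e0.
have q00 : sqn (0 : V) = 0 by apply/eqP; rewrite sqn_eq0.
move: (@continuous_expsqn f cf 0) => /cvgrPdist_le /(_ _ e0) /nbhs_ballP[r /= r0 hr].
have W0 : 0 <= W by apply: le_trans (fW 0); exact: normr_ge0.
have r2 : 0 < r ^+ 2 by rewrite exprn_gt0.
have p0 : 0 < tpow 4^-1 (r ^+ 2) by rewrite tpowE// powR_gt0.
have C0 : 0 <= (W + `|f 0|) / tpow 4^-1 (r ^+ 2) by rewrite divr_ge0 ?addr_ge0// ltW.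
exists ((W + `|f 0|) / tpow 4^-1 (r ^+ 2)) => // x.
have [xr|xr] := ltP (sqn x) (r ^+ 2).
  have := hr x; rewrite q00 expR0 mulr1 distrC => hx.
  have Cx := mulr_ge0 C0 (tpow_ge0 4^-1 (sqn x)).
  rewrite -[leLHS]addr0; apply: lerD Cx; apply: hx.
  by apply: ball_sqn => //; rewrite subr0.
rewrite -[leLHS]add0r lerD ?(ltW e0)//.
apply: (le_trans (ler_normB _ _)); apply: (@le_trans _ _ (W + `|f 0|)); first by rewrite lerD2r.
rewrite mulrAC ler_pdivlMr// ler_wpM2l ?addr_ge0//.
rewrite !tpowE ?(lt_le_trans r2 xr)//.
by rewrite ge0_ler_powR ?nnegrE ?invr_ge0 ?sqn_ge0 ?sqr_ge0.
Qed.

(** Write [f = f 0 e^(-q) + w e^(-q)] with [q = |x|^2]. The first term contributes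
    [f 0 * A t], and the second one at most [e / 4 * A t + C * B t] by
    [local_bound]. *)
Lemma power_approximate_identity f W : continuous f ->
  (forall x, `|f x * expR (sqn x)| <= W) ->
  \int[leb]_x (P0 n t * tpow (- (h - t)) (sqn x) * f x) @[t --> (0 : R)^'+] --> f 0.
Proof.
move=> cf fW.
have le2 (b : R) : `|1 - b| <= 1 -> b <= 2 by rewrite ler_norml; lra.
have quarters (e b c : R) : 0 <= e -> b <= 2 -> c <= e / 4 -> e / 4 + (e / 4 * b + c) <= e.
  by move=> e0 b2 ce; have : e / 4 * b <= e / 4 * 2; [rewrite ler_wpM2l// divr_ge0|lra].
apply/cvgrPdist_le => e e0; have e40 : 0 < e / 4 by rewrite divr_gt0.
have [C C0 hC] := local_bound cf fW e40.
have mf : measurable_fun setT f by exact: continuous_measurable_rV.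
have mexp : measurable_fun setT (fun x : V => expR (- sqn x)).
  by apply: measurableT_comp => //; apply: measurableT_comp => //; exact: measurable_sqn.
have W0 : 0 <= W by apply: le_trans (fW 0); exact: normr_ge0.
have fexp x : f x = f x * expR (sqn x) * expR (- sqn x).
  by rewrite -mulrA -expRD subrr expR0 mulr1.
have normM_le (b c : R) : 0 <= c -> c * b <= `|b| * (1 + c).
  by move=> c0; have := ler_norm b; have := normr_ge0 b; nra.
have d1 : 0 < e / 4 / (1 + `|f 0|) by rewrite divr_gt0// ltr_wpDr.
have d2 : 0 < e / 4 / (1 + C) by rewrite divr_gt0// ltr_wpDr.
near=> t.
have th : 0 < t < h by near: t; exact: near_at_right_0.
have t4 : 0 < t < 4^-1 by near: t; apply: near_at_right_0; rewrite invr_gt0.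
have /andP[t0 t1] := th.
have th' : 0 < h - t < h by apply/andP; split; lra.
have P00 := P0_gt0 th; have P0n0 := ltW P00.
have [Bi BE] := integral_B t4; have AE := integral_A th.
have Ai := integrable_tpow_gauss n0 th'.
have k0 x : 0 <= tpow (- (h - t)) (sqn x) by exact: tpow_ge0.
have fi : integrableR (fun x => tpow (- (h - t)) (sqn x) * f x).
  have mkf : measurable_fun setT (fun x => tpow (- (h - t)) (sqn x) * f x).
    by apply: measurable_funM => //; exact: measurable_tpow_sqn.
  apply: (le_integrableR mkf _ (integrableRZl W Ai)) => x.
  rewrite normrM (ger0_norm (k0 x)) mulrCA ler_wpM2l// {1}fexp normrM.
  by rewrite (ger0_norm (expR_ge0 _)) ler_wpM2r ?expR_ge0.
have -> : \int[leb]_x (P0 n t * tpow (- (h - t)) (sqn x) * f x) =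
    P0 n t * \int[leb]_x (tpow (- (h - t)) (sqn x) * f x).
  by rewrite -RintegralZl//; apply: eq_Rintegral => x _; rewrite mulrA.
have key : `|P0 n t * \int[leb]_x (tpow (- (h - t)) (sqn x) * f x) - f 0 * A t| <=
    e / 4 * A t + C * B t.
  rewrite -AE -BE mulrCA -mulrBr normrM (ger0_norm P0n0).
  rewrite [leRHS](_ : _ = P0 n t *
    (e / 4 * \int[leb]_x (tpow (- (h - t)) (sqn x) * expR (- sqn x)) +
     C * \int[leb]_x (tpow (- (h - t)) (sqn x) * (tpow 4^-1 (sqn x) * expR (- sqn x))))); last by ring.
  rewrite ler_wpM2l// -!RintegralZl// -RintegralB//; last exact: integrableRZl.
  rewrite -RintegralD//; try exact: integrableRZl.
  have di : integrableR (fun x => tpow (- (h - t)) (sqn x) * f x -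
      f 0 * (tpow (- (h - t)) (sqn x) * expR (- sqn x))).
    by apply: integrableRB => //; exact: integrableRZl.
  apply: le_trans (le_normr_Rintegral measurableT di) _.
  apply: le_Rintegral => //.
  - exact: integrable_norm di.
  - by apply: integrableRD; exact: integrableRZl.
  move=> x _.
  have -> : tpow (- (h - t)) (sqn x) * f x - f 0 * (tpow (- (h - t)) (sqn x) * expR (- sqn x)) =
      tpow (- (h - t)) (sqn x) * expR (- sqn x) * (f x * expR (sqn x) - f 0).
    by rewrite {1}(fexp x); ring.
  have kx0 : 0 <= tpow (- (h - t)) (sqn x) * expR (- sqn x) by rewrite mulr_ge0// expR_ge0.
  rewrite normrM (ger0_norm kx0).
  apply: le_trans (ler_wpM2l kx0 (hC x)) _.
  by rewrite le_eqVlt; apply/orP; left; apply/eqP; ring.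
have A2 : A t <= 2.
  by apply: le2; near: t; move/cvgrPdist_le : cvgA; apply.
have A1 : `|f 0| * `|1 - A t| <= e / 4.
  have : `|1 - A t| <= e / 4 / (1 + `|f 0|) by near: t; move/cvgrPdist_le : cvgA; apply.
  rewrite ler_pdivlMr ?ltr_wpDr//; apply: le_trans.
  by rewrite mulrC ler_wpM2l// lerDr.
have B1 : C * B t <= e / 4.
  have : `|0 - B t| <= e / 4 / (1 + C) by near: t; move/cvgrPdist_le : cvgB; apply.
  rewrite sub0r normrN ler_pdivlMr ?ltr_wpDr//; apply: le_trans.
  exact: normM_le.
move: key; set I := P0 n t * _ => key.
have -> : f 0 - I = f 0 * (1 - A t) - (I - f 0 * A t) by ring.
apply: (le_trans (ler_normB _ _)); rewrite normrM.
apply: (le_trans (lerD A1 key)).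
exact: quarters (ltW e0) A2 B1.
Unshelve. all: by end_near. Qed.

Lemma compact_support_bound f (K : set V) : continuous f -> compact K ->
  (forall x, ~ K x -> f x = 0) -> exists W, forall x, `|f x * expR (sqn x)| <= W.
Proof.
move=> cf cK fK; pose u x := f x * expR (sqn x).
have cu : continuous u by exact: continuous_expsqn.
have : compact (u @` K) by apply: continuous_compact => //; exact: continuous_subspaceT.
move=> /compact_bounded/pinfty_ex_gt0[M M0 hM].
exists M => x; have [Kx|nKx] := pselect (K x); first by apply: hM; exists x.
by rewrite fK// mul0r normr0 ltW.
Qed.

End approximate_identity.

(** * The logarithmic diffusion kernel *)

Section kernel_properties.
Context {R : realType} {n : nat}.
Local Notation V := 'rV[R]_n.
Local Notation leb := (@lebesgue_rV R n).
Local Notation integrableR f := (leb.-integrable setT (EFin \o f)).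
Local Notation h := (n%:R / 2 : R).
Hypothesis n0 : (0 < n)%N.
Variable P : R -> V -> R[i].
Hypothesis kP : log_diffusion_kernel P.
Implicit Types (t : R) (x : V).

Let h0 : 0 < h. Proof. by rewrite divr_gt0// ltr0n. Qed.

Lemma kernelE t x : 0 < t < h -> x != 0 ->
  P t x = (P0 n t * enorm x `^ (2 * t - n%:R))%:C.
Proof.
move=> th x0; have [[tf tg fg] cP] := kP th.
have [[_ tg' fg'] cP'] := log_diffusion_kernel_power n0 th.
apply: (tempered_eq tg tg' _ (cP x x0) (cP' x x0)) => phi sphi.
by rewrite fg// fg'.
Qed.

(** The form in which the kernel enters the integrals. *)
Let kernel_ReIm t x : 0 < t < h -> x != 0 ->
  complex.Re (P t x) = P0 n t * tpow (- (h - t)) (sqn x) /\ complex.Im (P t x) = 0.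
Proof.
move=> th x0; have /andP[t0 t1] := th; rewrite kernelE//= -enorm_powR; last first.
  by rewrite oppr_eq0 gt_eqF// subr_gt0.
by split=> //; congr (_ * _ `^ _); lra.
Qed.

Let kernel_measurable t : 0 < t < h ->
  measurable_fun setT (fun x => complex.Re (P t x)) /\
  measurable_fun setT (fun x => complex.Im (P t x)).
Proof. by move=> th; have [[_ tg _] _] := kP th; exact: tempered_function_measurable. Qed.

Lemma kernel_not_integrable t : 0 < t < h -> ~ integrableC (P t).
Proof.
move=> th [/integrableP[_ +] _]; have /andP[t0 t1] := th.
have [mr mi] := kernel_measurable th; have Pt0 := P0_gt0 th.
have th' : 0 < h - t < h by apply/andP; split; lra.
rewrite (@eq_integral_rV _ _ _ (fun x => (P0 n t * tpow (- (h - t)) (sqn x))%:E))//.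
- rewrite ge0_integralZlR//; last 3 first.
  + exact: ltW.
  + exact: measurable_tpow_sqn.
  + by move=> x; exact: tpow_ge0.
  by rewrite integral_tpow_rV// mulry gtr0_sg// mul1e ltxx.
- by apply: measurableT_comp => //; exact/measurable_EFinP.
- by apply/measurable_EFinP; apply: measurable_funM => //; exact: measurable_tpow_sqn.
- move=> x x0; have [-> _] := kernel_ReIm th x0.
  by rewrite abse_EFin ger0_norm// mulr_ge0 ?tpow_ge0 ?ltW.
Qed.

(** Off the origin, the kernel exceeds [l] exactly where [|x| < r], with
    [r = (P0 / l)^(1/(n-2t))], and [l^p r^n] does not depend on [l]. *)
Lemma kernel_weakLp t : 0 < t < h -> weakLp (n%:R / (n%:R - 2 * t)) (P t).
Proof.
move=> th; have /andP[t0 t1] := th; have [mr mi] := kernel_measurable th.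
have Pt0 := P0_gt0 th; have c0 : 0 < n%:R - 2 * t by lra.
set c := n%:R - 2 * t in c0 *; have cn0 := lt0r_neq0 c0.
split=> //; exists (2 ^+ n * P0 n t `^ (n%:R / c)) => l l0.
pose r := (P0 n t / l) `^ c^-1.
have Pl0 : 0 < P0 n t / l by rewrite divr_gt0.
have r0 : 0 < r by rewrite powR_gt0.
have sub : [set x | (l < Normc.normc (P t x))%R] `<=` [set x | (sqn x < r ^+ 2)%R].
  move=> x /=; have [->|x0] := eqVneq x 0.
    have -> : sqn (0 : V) = 0 by apply/eqP; rewrite sqn_eq0.
    by rewrite exprn_gt0.
  have e0 := enorm_gt0 x0.
  rewrite kernelE//= expr0n addr0 sqrtr_sqr ger0_norm; last by rewrite mulr_ge0 ?powR_ge0 ?ltW.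
  rewrite (_ : 2 * t - n%:R = - c); last by rewrite /c; lra.
  rewrite powRN -ltr_pdivrMl// -ltf_pV2 ?posrE ?mulr_gt0 ?invr_gt0 ?powR_gt0//.
  rewrite invrK invfM invrK => ec.
  rewrite -enorm_sqn ltr_pXn2r ?nnegrE ?(ltW e0) ?(ltW r0)//.
  have -> : enorm x = (enorm x `^ c) `^ c^-1.
    by rewrite -powRrM mulfV// powRr1// ltW.
  by rewrite gt0_ltr_powR ?invr_gt0 ?nnegrE ?powR_ge0 ?(ltW Pl0).
have mB : measurable [set x : V | (sqn x < r ^+ 2)%R].
  have := @measurable_sqn R n measurableT _ (measurable_itv `]-oo, (r ^+ 2)[).
  by rewrite setTI; congr measurable; apply/seteqP; split => x /=; rewrite in_itv.
have mA : measurable [set x | (l < Normc.normc (P t x))%R].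
  have mN : measurable_fun setT (fun x => (complex.Re (P t x) ^+ 2 + complex.Im (P t x) ^+ 2) `^ 2^-1).
    apply: (measurableT_comp (f := fun s : R => s `^ 2^-1)) => //.
    by apply: measurable_funD; exact: measurable_funX.
  have := mN measurableT _ (measurable_itv `]l, +oo[).
  rewrite setTI; congr measurable; apply/seteqP; split => x /=; rewrite in_itv/= andbT powR12_sqrt ?addr_ge0 ?sqr_ge0//;
    by case: (P t x).
apply: (@le_trans _ _ ((l `^ (n%:R / c))%:E * ((2 * r) ^+ n)%:E)%E).
  rewrite lee_wpmul2l ?lee_fin ?powR_ge0//.
  apply: le_trans (lebesgue_rV_ball_le n (ltW r0)).
  exact: le_measure (mem_set mA) (mem_set mB) sub.
rewrite -EFinM lee_fin exprMn mulrCA ler_wpM2l ?exprn_ge0//.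
rewrite -powR_mulrn ?(ltW r0)// /r -powRrM (mulrC c^-1) -powRM ?(ltW l0) ?(ltW Pl0)//.
by rewrite mulrCA mulfV ?mulr1// gt_eqF.
Qed.

(** On [K] the norm is bounded by some [B >= 1], so the kernel is at least
    [P0 B^(-n)]; and [P0] tends to infinity, because [(n - 2t) P0] has a positive
    limit. *)
Lemma kernel_blowup (K : set V) (M : R) : compact K ->
  \forall t \near h^'-, forall x, K x -> x != 0 -> M%:C <= P t x.
Proof.
move=> cK.
have [B B1 hB] : exists2 B : R, 1 <= B & forall x, K x -> enorm x <= B.
  have : compact (@sqn R n @` K).
    by apply: continuous_compact => //; apply: continuous_subspaceT; exact: continuous_sqn.
  move=> /compact_bounded/pinfty_ex_gt0[B B0 KB].
  exists (1 + B); first by rewrite lerDl ltW.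
  move=> x Kx; apply: (le_trans (enorm_le x)); rewrite lerD2l.
  by apply: le_trans (ler_norm _) _; apply: KB; exists x.
have B0 : 0 < B by exact: lt_le_trans B1.
pose L := 2 / ((4 * pi) `^ h * Gamma h) : R.
have L0 : 0 < L.
  by rewrite divr_gt0// mulr_gt0 ?Gamma_gt0// powR_gt0// mulr_gt0// pi_gt0.
(* [M <= D B^(-n)], and [D <= P0 n t] for [t] close to [n / 2] *)
pose D := (1 + `|M|) * B `^ n%:R.
have D0 : 0 < D by rewrite mulr_gt0 ?powR_gt0// ltr_wpDr.
have D20 : 0 < 2 * D by exact: mulr_gt0.
have L20 : 0 < L / 2 by rewrite divr_gt0.
near=> t.
have th : 0 < t < h by near: t; exact: near_at_left_half.
have /andP[t0 t1] := th; have c0 : 0 < n%:R - 2 * t by lra.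
have Pt : L / 2 < (n%:R - 2 * t) * P0 n t.
  have : `|L - (n%:R - 2 * t) * P0 n t| < L / 2.
    by near: t; move/cvgrPdist_lt : (P0_cvg_half (R := R) n0); apply.
  by rewrite ltr_norml; lra.
have tD : (n%:R - 2 * t) * D <= L / 2.
  have : h - t < L / 2 / (2 * D).
    by near: t; apply: nbhs_left_ltBl; exact: divr_gt0.
  rewrite (ltr_pdivlMr _ _ D20) => /ltW; apply: le_trans.
  by rewrite (_ : n%:R - 2 * t = (h - t) * 2) ?(mulrA (h - t))//; lra.
have DP : D <= P0 n t.
  by rewrite -(ler_pM2l c0) (le_trans tD)// ltW.
move=> x Kx x0; rewrite kernelE// lecR.
have e0 := enorm_gt0 x0.
have eB : B `^ (- n%:R) <= enorm x `^ (2 * t - n%:R).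
  rewrite (_ : 2 * t - n%:R = - (n%:R - 2 * t)); last by lra.
  rewrite !powRN lef_pV2 ?posrE ?powR_gt0//.
  apply: (@le_trans _ _ (B `^ (n%:R - 2 * t))).
    by rewrite ge0_ler_powR ?nnegrE ?(ltW e0) ?(ltW c0) ?(ltW B0) ?hB.
  by rewrite ler_powR//; lra.
have MD : M <= D * B `^ (- n%:R).
  rewrite /D -mulrA -powRD ?(gt_eqF B0) ?implybT// subrr powRr0 mulr1.
  by rewrite (le_trans (ler_norm M))// lerDr.
by rewrite (le_trans MD)// ler_pM ?powR_ge0 ?(ltW D0).
Unshelve. all: by end_near. Qed.

Lemma kernel_cvg_half x : x != 0 ->
  ((n%:R - 2 * t)%:C * P t x : R[i]^o) @[t --> h^'-] -->
  ((2 / ((4 * pi) `^ h * Gamma h))%:C : R[i]^o).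
Proof.
move=> x0; have e0 := enorm_gt0 x0.
have cr : (n%:R - 2 * t) * P0 n t * enorm x `^ (- n%:R + 2 * t) @[t --> h^'-] -->
    (2 / ((4 * pi) `^ h * Gamma h) * enorm x `^ (- n%:R + 2 * h)).
  apply: cvgM; first exact: P0_cvg_half.
  by apply: cvg_at_left_filter; exact: cvg_powR_affine.
have hE : - n%:R + 2 * h = 0 by lra.
rewrite hE powRr0 mulr1 in cr.
apply/(@cvg_complexP _ _ (h^'-)); split.
  apply: cvg_trans cr; apply: near_eq_cvg; near=> t.
  have th : 0 < t < h by near: t; exact: near_at_left_half.
  by rewrite kernelE// complexReM /= mul0r subr0 mulrA (addrC (- _)).
apply: (@cvg_trans _ ((fun _ : R => 0 : R) @ h^'-)); last exact: cvg_cst.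
apply: near_eq_cvg; near=> t.
have th : 0 < t < h by near: t; exact: near_at_left_half.
by rewrite kernelE// complexImM /= mul0r mulr0 addr0.
Unshelve. all: by end_near. Qed.

Lemma kernel_cvg_0 x : x != 0 -> (P t x : R[i]^o) @[t --> 0^'+] --> (0 : R[i]^o).
Proof.
move=> x0; have e0 := enorm_gt0 x0.
have cr : P0 n t * enorm x `^ (- n%:R + 2 * t) @[t --> (0 : R)^'+] --> (0 : R).
  rewrite -[X in _ --> X](mul0r (enorm x `^ (- n%:R + 2 * 0))).
  apply: cvgM; first exact: P0_cvg_0.
  by apply: cvg_at_right_filter; exact: cvg_powR_affine.
apply/(@cvg_complexP _ _ ((0 : R)^'+)); split.
  apply: cvg_trans cr; apply: near_eq_cvg; near=> t.
  have th : 0 < t < h by near: t; exact: near_at_right_0.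
  by rewrite kernelE//= (addrC (- _)).
apply: (@cvg_trans _ ((fun _ : R => 0 : R) @ (0 : R)^'+)); last exact: cvg_cst.
apply: near_eq_cvg; near=> t.
have th : 0 < t < h by near: t; exact: near_at_right_0.
by rewrite kernelE.
Unshelve. all: by end_near. Qed.

Let kernel_integral t (phi : V -> R[i]) : 0 < t < h ->
  measurable_fun setT (fun x => complex.Re (phi x)) ->
  measurable_fun setT (fun x => complex.Im (phi x)) ->
  integralC (fun x => P t x * phi x) =
  (\int[leb]_x (P0 n t * tpow (- (h - t)) (sqn x) * complex.Re (phi x))) +i*
  (\int[leb]_x (P0 n t * tpow (- (h - t)) (sqn x) * complex.Im (phi x))).
Proof.
move=> th mr mi; have [kr ki] := kernel_measurable th.
have mt : measurable_fun setT (fun x : V => tpow (- (h - t)) (sqn x)) by exact: measurable_tpow_sqn.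
rewrite /integralC /Rintegral; congr (fine _ +i* fine _).
- apply: eq_integral_rV => //.
  + apply/measurable_EFinP.
    under eq_fun do rewrite complexReM.
    by apply: measurable_funB; apply: measurable_funM.
  + by apply/measurable_EFinP; apply: measurable_funM => //; exact: measurable_funM.
  by move=> x x0; have [E1 E2] := kernel_ReIm th x0; rewrite complexReM E1 E2 mul0r subr0.
- apply: eq_integral_rV => //.
  + apply/measurable_EFinP.
    under eq_fun do rewrite complexImM.
    by apply: measurable_funD; apply: measurable_funM.
  + by apply/measurable_EFinP; apply: measurable_funM => //; exact: measurable_funM.
  by move=> x x0; have [E1 E2] := kernel_ReIm th x0; rewrite complexImM E1 E2 mul0r addr0.
Qed.

Lemma kernel_cvg_delta (phi : V -> R[i]) : Cc phi ->
  (integralC (fun x => P t x * phi x) : R[i]^o) @[t --> 0^'+] --> (phi 0 : R[i]^o).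
Proof.
move=> [cphi cK].
have cphi' x : complex.Re (phi y) @[y --> x] --> complex.Re (phi x) /\
    complex.Im (phi y) @[y --> x] --> complex.Im (phi x).
  by apply/(@cvg_complexP _ _ (nbhs x)); exact: cphi.
have cr : continuous (fun x => complex.Re (phi x)) by move=> x; have [] := cphi' x.
have ci : continuous (fun x => complex.Im (phi x)) by move=> x; have [] := cphi' x.
have K0 x : ~ closure [set x | phi x != 0] x -> phi x = 0.
  move=> nK; apply/eqP; apply: contrapT => /negP px; apply: nK.
  exact: subset_closure.
have [W hW] := compact_support_bound cr cK (fun x nK => congr1 (@complex.Re R) (K0 x nK)).
have [W' hW'] := compact_support_bound ci cK (fun x nK => congr1 (@complex.Im R) (K0 x nK)).
have mr := continuous_measurable_rV cr; have mi := continuous_measurable_rV ci.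
apply/(@cvg_complexP _ _ ((0 : R)^'+)); split.
  apply: cvg_trans (power_approximate_identity n0 cr hW); apply: near_eq_cvg; near=> t.
  have th : 0 < t < h by near: t; exact: near_at_right_0.
  by rewrite kernel_integral.
apply: cvg_trans (power_approximate_identity n0 ci hW'); apply: near_eq_cvg; near=> t.
have th : 0 < t < h by near: t; exact: near_at_right_0.
by rewrite kernel_integral.
Unshelve. all: by end_near. Qed.

End kernel_properties.

Theorem proposition1p1 (R : realType) (N : nat) (N_gt0 : (0 < N)%N) :
  (exists P : R -> 'rV[R]_N -> R[i], log_diffusion_kernel P) /\
  forall P : R -> 'rV[R]_N -> R[i], log_diffusion_kernel P ->
  [/\ forall (t : R) (x : 'rV[R]_N), 0 < t < N%:R / 2 -> x != 0 ->
        P t x = (P0 N t * enorm x `^ (2 * t - N%:R))%:C,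
      forall t : R, 0 < t < N%:R / 2 ->
        ~ integrableC (P t) /\ weakLp (N%:R / (N%:R - 2 * t)) (P t),
      (forall (K : set 'rV[R]_N) (M : R), compact K ->
         \forall t \near (N%:R / 2)^'-,
           forall x : 'rV[R]_N, K x -> x != 0 -> M%:C <= P t x) /\
      (forall x : 'rV[R]_N, x != 0 ->
         ((N%:R - 2 * t)%:C * P t x : R[i]^o) @[t --> (N%:R / 2)^'-] -->
         ((2 / ((4 * pi) `^ (N%:R / 2) * Gamma (N%:R / 2)))%:C : R[i]^o)) &
      (forall x : 'rV[R]_N, x != 0 ->
         (P t x : R[i]^o) @[t --> 0^'+] --> (0 : R[i]^o)) /\
      (forall phi : 'rV[R]_N -> R[i], Cc phi ->
         (integralC (fun x => P t x * phi x) : R[i]^o) @[t --> 0^'+] -->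
         (phi 0 : R[i]^o))].
Proof.
split; first by eexists; exact: log_diffusion_kernel_power.
move=> P kP; split.
- by move=> t x; exact: kernelE.
- by move=> t th; split; [exact: kernel_not_integrable|exact: kernel_weakLp].
- by split; [move=> K M; exact: kernel_blowup|move=> x; exact: kernel_cvg_half].
- by split; [move=> x; exact: kernel_cvg_0|move=> phi; exact: kernel_cvg_delta].
Qed.
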